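(* Let $f\in L^p(G_{\mathbf m}^2)$ for some $p\in[1,\infty]$ and let $\alpha,\beta\in(0,1)$ with $\alpha+\beta<1$. If $$\omega\Big(f,\frac1{M_n}\Big)_p=o\Big(\Big(\frac1{M_n}\Big)^{\alpha+\beta}\Big)\quad\text{as }n\to\infty,$$ then $$\left\Vert\sigma_{n,m}^{-\alpha,-\beta}(f)-f\right\Vert_p\to0\quad\text{as }n,m\to\infty.$$
   Context: Vilenkin group: $\mathbf m=(m_0,m_1,\dots)$ is a fixed bounded sequence of integers $m_k\ge 2$. $G_{\mathbf m}=\prod_{k\ge0}\mathbb Z/m_k\mathbb Z$ is the compact product group (discrete topology on each factor, coordinatewise addition modulo $m_k$), with elements $x=(x_0,x_1,\dots)$, $x_k\in\{0,\dots,m_k-1\}$, and $\mu$ is its normalized Haar measure; the normalized Haar measure on $G_{\mathbf m}^2=G_{\mathbf m}\times G_{\mathbf m}$ is also denoted $\mu$. Put $I_0=G_{\mathbf m}$ and $I_n=\{x\in G_{\mathbf m}:x_0=\dots=x_{n-1}=0\}$ for $n\ge1$. Put $M_0=1$, $M_{k+1}=m_kM_k$. Each integer $n\ge 0$ is uniquely $n=\sum_{j\ge0}n_jM_j$ with $n_j\in\{0,\dots,m_j-1\}$, finitely many nonzero. Vilenkin system: $r_k(x)=\exp(2\pi i x_k/m_k)$ and $\psi_n(x)=\prod_{k\ge0}r_k(x)^{n_k}$. Spaces: functions are complex valued. For $1\le p<\infty$, $L^p(G_{\mathbf m}^2)$ has norm $\|f\|_p=(\int_{G_{\mathbf m}^2}|f|^p\,d\mu)^{1/p}$;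 by convention $L^\infty(G_{\mathbf m}^2)$ means $C(G_{\mathbf m}^2)$, the continuous functions with the supremum norm. Fourier coefficients: $\widehat f(i,j)=\int_{G_{\mathbf m}^2}f(x,y)\overline{\psi_i(x)}\,\overline{\psi_j(y)}\,d\mu(x,y)$. Cesàro numbers: $A_0^{\gamma}=1$, $A_n^{\gamma}=\frac{(\gamma+1)\cdots(\gamma+n)}{n!}$. Cesàro means: $$\sigma_{n,m}^{-\alpha,-\beta}(x,y,f)=\frac1{A_n^{-\alpha}A_m^{-\beta}}\sum_{i=0}^n\sum_{j=0}^mA_{n-i}^{-\alpha}A_{m-j}^{-\beta}\widehat f(i,j)\psi_i(x)\psi_j(y),$$ and $\sigma_{n,m}^{-\alpha,-\beta}(f)$ is this function of $(x,y)$. Total modulus of continuity: $\omega(f,1/M_n)_p=\sup_{(u,v)\in I_n\times I_n}\|f(\cdot-u,\cdot-v)-f(\cdot,\cdot)\|_p$. The limit ''as $n,m\to\infty$'' means that both indices tend to infinity independently. *)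

(* Defs.v *)
From HB Require Import structures.
From mathcomp Require Import all_boot all_order all_algebra.
From mathcomp Require Import complex.
From mathcomp Require Import all_classical all_reals all_analysis.

Set Implicit Arguments.
Unset Strict Implicit.
Unset Printing Implicit Defensive.

Import Order.TTheory GRing.Theory Num.Theory.
Import numFieldNormedType.Exports.

Local Open Scope classical_set_scope.
Local Open Scope ring_scope.

(* 'Z_q is the ring of integers mod q only for q >= 2; the definitions below
   are meaningful under the hypothesis 2 <= m k for all k. *)
Definition vilenkin (m : nat -> nat) : Type := forall k : nat, 'Z_(m k).

Section VilenkinGroup.
Variable m : nat -> nat.
Implicit Types x y z : vilenkin m.

Let vadd x y : vilenkin m := fun k => x k + y k.
Let vopp x : vilenkin m := fun k => - x k.
Let vzero : vilenkin m := fun _ => 0.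

Let vaddA : associative vadd.
Proof. by move=> x y z; apply: functional_extensionality_dep => k; exact: addrA. Qed.

Let vaddC : commutative vadd.
Proof. by move=> x y; apply: functional_extensionality_dep => k; exact: addrC. Qed.

Let vadd0 : left_id vzero vadd.
Proof. by move=> x; apply: functional_extensionality_dep => k; exact: add0r. Qed.

Let vaddN : left_inverse vzero vopp vadd.
Proof. by move=> x; apply: functional_extensionality_dep => k; exact: addNr. Qed.

HB.instance Definition _ := Choice.copy (vilenkin m) (forall k, 'Z_(m k)).
HB.instance Definition _ :=
  GRing.isZmodule.Build (vilenkin m) vaddA vaddC vadd0 vaddN.
HB.instance Definition _ := isPointed.Build (vilenkin m) vzero.
HB.instance Definition _ := Topological.copy (vilenkin m)
  (prod_topology (fun k => discrete_topology 'Z_(m k))).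
HB.instance Definition _ :=
  Measurable.copy (vilenkin m) (g_sigma_algebraType (@open (vilenkin m))).

(* The subgroup I_n (I_0 is the whole group). *)
Definition vcyl (n : nat) : set (vilenkin m) :=
  [set x | forall k, (k < n)%N -> x k = 0].

(* The generalized powers M_k. *)
Fixpoint vpow (k : nat) : nat :=
  if k is k'.+1 then (m k' * vpow k')%N else 1%N.

(* The digit n_j of n = \sum_j n_j M_j with n_j < m_j. *)
Definition vdigit (n j : nat) : nat := ((n %/ vpow j) %% m j)%N.

End VilenkinGroup.

Section VilenkinSystem.
Variables (R : realType) (m : nat -> nat).

Definition rademacher (k : nat) (x : vilenkin m) : R[i] :=
  let t := 2 * pi * (nat_of_ord (x k))%:R / (m k)%:R in
  Complex (cos t) (sin t).

(* If all m_k are at least 2, then M_k >= 2 ^ k > n for k >= n, so the digits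
   of n of index at least n vanish and the product stops at n. *)
Definition vpsi (n : nat) (x : vilenkin m) : R[i] :=
  \prod_(k < n) rademacher k x ^+ vdigit m n k.

Definition cesaro_number (g : R) (n : nat) : R :=
  (\prod_(1 <= k < n.+1) (g + k%:R)) / n`!%:R.

End VilenkinSystem.

Section Spaces.
Variables (R : realType) (m : nat -> nat).
Local Notation G2 := (vilenkin m * vilenkin m)%type.
Variable mu : probability G2 R.
Implicit Types (f : G2 -> R[i]) (p : \bar R).

(* The sigma-algebra of G2 is the product of the Borel sigma-algebras, which is
   the Borel one because the topology of vilenkin m has a countable base.  As
   mu is a probability on a compact metrizable group, it is automatically
   regular, so translation invariance says that mu is the normalized Haar
   measure. *)
Definition haar : Prop :=
  forall (A : set G2) (w : G2), measurable A -> mu [set w + z | z in A] = mu A.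

(* The L^p norm of f; for p = +oo it is the supremum norm, not the essential
   supremum. *)
Definition vnorm p f : \bar R :=
  if p is +oo%E then ereal_sup [set (Normc.normc (f z))%:E | z in [set: G2]]
  else Lnorm mu p (fun z => (Normc.normc (f z))%:E).

(* Membership in L^p for 1 <= p, where L^oo means the continuous functions. *)
Definition in_Lp p f : Prop :=
  if p is +oo%E then continuous (f : G2 -> R[i]^o)
  else [/\ measurable_fun [set: G2] (fun z => complex.Re (f z)),
           measurable_fun [set: G2] (fun z => complex.Im (f z)) &
           (vnorm p f < +oo)%E].

Definition cintegral f : R[i] :=
  Complex (Rintegral mu [set: G2] (fun z => complex.Re (f z)))
          (Rintegral mu [set: G2] (fun z => complex.Im (f z))).

Definition fourier_coef f (i j : nat) : R[i] :=
  cintegral (fun z =>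
    f z * conjc (@vpsi R m i z.1) * conjc (@vpsi R m j z.2)).

(* cesaro_mean (- a) (- b) n k f is the Cesaro mean of order (-a, -b). *)
Definition cesaro_mean (a b : R) (n k : nat) f : G2 -> R[i] := fun z =>
  (real_complex R (cesaro_number a n * cesaro_number b k))^-1 *
  \sum_(i < n.+1) \sum_(j < k.+1)
     real_complex R (cesaro_number a (n - i) * cesaro_number b (k - j)) *
     fourier_coef f i j * vpsi R i z.1 * vpsi R j z.2.

(* The total modulus of continuity omega(f, 1 / M_n)_p. *)
Definition total_modulus p f (n : nat) : \bar R :=
  ereal_sup [set vnorm p (fun z => f (z - w) - f z)
            | w in @vcyl m n `*` @vcyl m n].

End Spaces.

(* Main.v *)
(* Write A_j for the Cesaro numbers of order -a, so that A_j ~ j^-a.  The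
   Dirichlet sums of length M_T vanish off I_T; with Abel summation this bounds
   the kernel of order -a off I_T by a multiple of \sum_(j < M_T) A_j / A_n.
   Hence the kernel truncated to frequencies below M_l has L^1 norm O(n^a) for
   all n, and only O(l + 1) if 2 M_l <= n.

   Let E_l f be the average of f over the cosets of I_l x I_l; by Jensen and
   Tonelli |E_l f - f|_p is controlled by the modulus w(f, 1 / M_l).  Take the least L
   with M_L > max(n, k).  The means of f and E_L f agree, so the error is the sum
   over l <= L of the errors on the pieces v_l = E_l f - E_(l-1) f, plus
   E_L f - f.  Each piece is a finite character sum, on which the error tends to
   0.  If 2 M_l <= max(n, k), one of the two kernels costs only O(l + 1), so the
   error on v_l is dominated by (l + 1)^2 M_l^(-min(alpha, beta)), which is
   summable, and Tannery's theorem applies.  The remaining pieces, at most two,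
   cost O(M_L^(alpha + beta)) w(f, 1 / M_(l-1)), which tends to 0 by
   hypothesis. *)

Require Import Defs.
From mathcomp Require Import all_boot all_order all_algebra.
From mathcomp Require Import complex.
From mathcomp Require Import all_classical all_reals all_analysis.
From mathcomp Require Import measurable_realfun.
From mathcomp Require Import ring lra zify.

Import Order.TTheory GRing.Theory Num.Theory.
Import numFieldNormedType.Exports.

Local Open Scope classical_set_scope.
Local Open Scope ring_scope.

(** The obstacle is that the kernels of negative order are not bounded in L^1: their norms are
    controlled only by n^a and k^b, and n and k are unrelated. Replacing f by a single average and
    estimating the difference would leave a factor n^a k^b that no modulus at the scale of the
    smaller index can absorb. A piece of level l, by contrast, sees only kernels cut at frequency
    M_l, whose norms are bounded in terms of l whatever n and k are. Both kernels can cost their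
    full power of M_l only at the last two levels. This is where the exponent alpha + beta and the
    little o are spent; at lower levels it is enough that M_l^(alpha + beta) times the modulus stays
    bounded.

    The other device is finiteness. For a function constant on the cosets of I_l x I_l, integrals
    are averages over M_l^2 representatives [vnat], so coefficients, convolution and kernel norms
    become finite sums. Genuine measure theory is concentrated in the comparison of f with its
    averages. *)

(** * Size and ratios of the Cesàro numbers of order -a *)

Section CesaroNumbers.
Context {R : realType} {a : R} (a01 : 0 < a < 1).
Local Notation A := (cesaro_number (- a)).

(** Young's inequality for (1 + x)^a and 1 with the conjugate exponents 1 / a and 1 / (1 - a). Both
    power bounds on the Cesàro numbers rest on it. *)
Lemma powR_bernoulli (x : R) : -1 <= x -> (1 + x) `^ a <= 1 + a * x.
Proof.
case/andP: (a01) => a0 a1 x1.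
have x0 : 0 <= 1 + x by lra.
have a1' : 0 < 1 - a by lra.
have := @conjugate_powR R ((1 + x) `^ a) 1 a^-1 (1 - a)^-1 (powR_ge0 _ _) ler01.
rewrite !invr_gt0 !invrK => /(_ a0 a1').
rewrite -powRrM divff ?gt_eqF// powRr1// powR1 mulr1.
move=> /(_ ltac:(ring)); lra.
Qed.

Lemma cesaro_number0 : A 0 = 1.
Proof. by rewrite /cesaro_number big_geq// divr1. Qed.

Lemma cesaro_numberS n : A n.+1 = A n * (1 - a / n.+1%:R).
Proof.
rewrite /cesaro_number big_nat_recr//= factS natrM invfM.
have h : n.+1%:R != 0 :> R by rewrite pnatr_eq0.
rewrite -!mulrA; congr (_ * _); rewrite [in RHS]mulrC.
by field; rewrite nat1r !pnatr_eq0 -lt0n fact_gt0.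
Qed.

Lemma cesaro_number_gt0 n : 0 < A n.
Proof.
case/andP: (a01) => a0 a1.
elim: n => [|n IH]; first by rewrite cesaro_number0.
rewrite cesaro_numberS mulr_gt0// subr_gt0 ltr_pdivrMr ?ltr0n// mul1r.
by rewrite (lt_le_trans a1)// ler1n.
Qed.

Lemma cesaro_number_ge0 n : 0 <= A n.
Proof. exact/ltW/cesaro_number_gt0. Qed.

Lemma cesaro_number_neq0 n : A n != 0.
Proof. by rewrite gt_eqF ?cesaro_number_gt0. Qed.

Lemma le_cesaro_number i j : (i <= j)%N -> A j <= A i.
Proof.
case/andP: (a01) => a0 a1.
move=> /subnK <-; elim: (j - i)%N => [|n IH]//.
apply: le_trans IH; rewrite addSn cesaro_numberS ger_pMr ?cesaro_number_gt0//.
by rewrite lerBlDr lerDl divr_ge0// ltW.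
Qed.

(** Induction: with v = 1 / (n + 1), Bernoulli gives (1 + v)^a <= 1 + a v <= 1 / (1 - a v), so the
    factor 1 - a v of the recursion is at most ((n + 1) / (n + 2))^a. *)
Lemma cesaro_number_ub n : A n <= (n.+1%:R `^ a)^-1.
Proof.
case/andP: (a01) => a0 a1.
elim: n => [|n IH]; first by rewrite cesaro_number0 powR1 invr1.
have n0 : 0 < n.+1%:R :> R by rewrite ltr0n.
have n1 : 1 <= n.+1%:R :> R by rewrite ler1n.
have -> : n.+2%:R = n.+1%:R * (1 + n.+1%:R^-1) :> R.
  by rewrite mulrDr mulr1 mulfV ?gt_eqF// [n.+2%:R]mulrS addrC.
have i0 : 0 < (n.+1%:R : R)^-1 by rewrite invr_gt0.
have d1 : 0 < 1 + n.+1%:R^-1 :> R by rewrite addr_gt0.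
rewrite (powRM _ (ltW n0) (ltW d1)) invfM cesaro_numberS.
have ain : a * n.+1%:R^-1 < 1 by rewrite ltr_pdivrMr//; lra.
move: (n.+1%:R^-1) i0 d1 ain => v i0 d1 ain.
apply: ler_pM => //; first exact: cesaro_number_ge0.
  by rewrite subr_ge0 ltW.
rewrite -[leLHS]invrK lef_pV2 ?posrE ?invr_gt0 ?subr_gt0// ?powR_gt0 ?addr_gt0//.
apply: le_trans (@powR_bernoulli _ _) _; first by lra.
have d0 : 0 < 1 - a * v by lra.
rewrite -[leRHS]mul1r ler_pdivlMr//.
have : 0 <= (a * v) ^+ 2 by exact: sqr_ge0.
by rewrite expr2; lra.
Qed.

Lemma cesaro_number_lb n : (1 - a) / n.+1%:R `^ a <= A n.
Proof.
case/andP: (a01) => a0 a1.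
case: n => [|n]; first by rewrite cesaro_number0 powR1; lra.
(* The strengthened claim, with n + 1 in place of n + 2, is an equality at the base, where A_1 = 1 -
   a; its induction step is Bernoulli at -1 / (n + 2). *)
suff : (1 - a) / n.+1%:R `^ a <= A n.+1.
  apply: le_trans; apply: ler_wpM2l; first by lra.
  rewrite lef_pV2 ?posrE ?powR_gt0 ?ltr0n//.
  by rewrite ge0_ler_powR ?nnegrE ?ler0n ?ler_nat ?ltW.
elim: n => [|n IH].
  by rewrite cesaro_numberS cesaro_number0 powR1 !divr1 mul1r.
have n0 : 0 < n.+2%:R :> R by rewrite ltr0n.
have n1 : 1 <= n.+2%:R :> R by rewrite ler1n.
have i0 : 0 < (n.+2%:R : R)^-1 by rewrite invr_gt0.
have i1 : (n.+2%:R : R)^-1 < 1 by rewrite invf_lt1// ltr1n.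
have d0 : 0 < 1 - (n.+2%:R : R)^-1 by rewrite subr_gt0.
have E : n.+1%:R `^ a = n.+2%:R `^ a * (1 - n.+2%:R^-1) `^ a.
  rewrite -(powRM _ (ltW n0) (ltW d0)); congr (_ `^ _).
  by rewrite mulrBr mulr1 mulfV ?gt_eqF// -[n.+2%:R]natr1 addrK.
have -> : (1 - a) / n.+2%:R `^ a = (1 - a) / n.+1%:R `^ a * (1 - n.+2%:R^-1) `^ a.
  by rewrite E invfM mulrA mulfVK// gt_eqF// powR_gt0.
have ain : a * n.+2%:R^-1 < 1 by rewrite ltr_pdivrMr//; lra.
rewrite cesaro_numberS.
apply: ler_pM => //; rewrite ?powR_ge0//.
  by rewrite divr_ge0 ?powR_ge0//; lra.
rewrite -mulrN; apply: powR_bernoulli.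
by rewrite lerN2 ltW.
Qed.

(** The sum is the Cesàro number of order 1 - a, expressed here through that of order -a. *)
Lemma sum_cesaro_number n :
  \sum_(i < n.+1) A i = A n * (n.+1%:R - a) / (1 - a).
Proof.
case/andP: (a01) => a0 a1.
have a1' : 1 - a != 0 by rewrite gt_eqF//; lra.
elim: n => [|n IH]; first by rewrite big_ord1 cesaro_number0 mul1r divff.
rewrite big_ord_recr/= IH cesaro_numberS.
have h : n.+1%:R != 0 :> R by rewrite pnatr_eq0.
rewrite -[n.+2%:R]natr1; field.
by rewrite a1' nat1r h.
Qed.

Lemma sum_cesaro_number_ub M : (0 < M)%N ->
  \sum_(i < M) A i <= M%:R / M%:R `^ a / (1 - a).
Proof.
case/andP: (a01) => a0 a1.
case: M => // n _; rewrite sum_cesaro_number ler_pM2r ?invr_gt0 ?subr_gt0//.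
rewrite mulrC; apply: ler_pM => //.
- by rewrite subr_ge0 ltW// (lt_le_trans a1)// ler1n.
- exact: cesaro_number_ge0.
- by rewrite lerBlDr lerDl ltW.
- exact: cesaro_number_ub.
Qed.

(** Each unit of shift divides by a factor of the recursion, which tends to 1. Thus the weight that
    the mean gives to a fixed frequency i tends to 1. *)
Lemma cesaro_number_ratio_cvg i : (A (n - i) / A n) @[n --> \oo] --> (1 : R).
Proof.
elim: i => [|i IH].
  apply: cvg_near_cst; apply: nearW => n.
  by rewrite subn0 divff ?cesaro_number_neq0.
have : (A (n - i) / A n) / (1 - a / (n - i)%:R) @[n --> \oo] --> (1 / (1 - a * 0) : R).
  apply: cvgM => //; apply: cvgV; first by rewrite mulr0 subr0 oner_eq0.
  apply: cvgB; first exact: cvg_cst.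
  apply: cvgMl_tmp.
  have H : ((n%:R : R)^-1) @[n --> \oo] --> (0 : R).
    apply/gtr0_cvgV0; last exact: cvgr_idn.
    by near=> n; rewrite ltr0n; near: n; exact: nbhs_infty_gt.
  by apply: (cvg_comp (fun n => (n - i)%N) (fun n => (n%:R : R)^-1) _ H); exact: cvg_subnr.
rewrite mulr0 subr0 divr1; apply: cvg_trans; apply: near_eq_cvg.
near=> n.
have ni : (i < n)%N by near: n; exact: nbhs_infty_gt.
rewrite -(subnSK ni) cesaro_numberS.
have h : 1 - a / (n - i.+1).+1%:R != 0.
  case/andP: (a01) => a0 a1.
  rewrite subr_eq0 eq_sym lt_eqF// ltr_pdivrMr ?ltr0n// mul1r.
  by rewrite (lt_le_trans a1)// ler1n.
by rewrite [_ * (1 - _) / A n]mulrAC mulfK.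
Unshelve. all: by end_near. Qed.

End CesaroNumbers.

(** * Mixed-radix digits, cylinders and coset representatives *)

Section GeneralizedPowers.
Context {m : nat -> nat} (m_ge2 : forall k, (2 <= m k)%N).
Local Notation M := (vpow m).

Lemma vpow_gt0 k : (0 < M k)%N.
Proof. by elim: k => //= k IH; rewrite muln_gt0 IH andbT (leq_trans _ (m_ge2 k)). Qed.

Lemma expn2_le_vpow k : (2 ^ k <= M k)%N.
Proof. by elim: k => //= k IH; rewrite expnS leq_mul. Qed.

Lemma ltn_vpow k : (k < M k)%N.
Proof. by apply: leq_trans (expn2_le_vpow k); exact: ltn_expl. Qed.

Lemma dvdn_vpow i j : (i <= j)%N -> (M i %| M j)%N.
Proof.
move=> /subnK <-; elim: (j - i)%N => //= n IH.
by rewrite (dvdn_trans IH)// dvdn_mull.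
Qed.

Lemma leq_vpow i j : (i <= j)%N -> (M i <= M j)%N.
Proof. by move=> /dvdn_vpow; apply: dvdn_leq; exact: vpow_gt0. Qed.

(** The factor m_i is split off so that it disappears modulo m_i when the digit of index i is
    taken. *)
Lemma vpow_lt_dvd i j : (i < j)%N -> exists2 d, M j = (d * m i * M i)%N & (0 < d)%N.
Proof.
move=> /dvdn_vpow /= /dvdnP[d Hd]; exists d; first by rewrite Hd mulnA.
by have := vpow_gt0 j; rewrite Hd muln_gt0 => /andP[].
Qed.

Lemma vpow_double k : (2 * M k <= M k.+1)%N.
Proof. by rewrite /= leq_mul. Qed.

Lemma vdigit_lt n k : (vdigit m n k < m k)%N.
Proof. by rewrite ltn_pmod// (leq_trans _ (m_ge2 k)). Qed.

Lemma vdigit_small n k : (n < M k)%N -> vdigit m n k = 0%N.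
Proof. by move=> h; rewrite /vdigit divn_small// mod0n. Qed.

(** No carry occurs: M_T divides the first summand and the second is smaller than M_T. *)
Lemma vdigit_addl b r T k : (r < M T)%N ->
  vdigit m (b * M T + r) k = if (k < T)%N then vdigit m r k else vdigit m (b * M T) k.
Proof.
move=> rT; case: ltnP => [kT|Tk].
  have [d Hd _] := vpow_lt_dvd _ _ kT.
  by rewrite /vdigit Hd !mulnA (divnMDl (b * d * m k) r (vpow_gt0 k)) modnMDl.
have /dvdnP[d dE] := dvdn_vpow _ _ Tk.
rewrite /vdigit dE [(d * M T)%N]mulnC !divnMA.
by rewrite (divnMDl _ _ (vpow_gt0 T)) (divn_small rT) addn0 mulnK ?vpow_gt0.
Qed.

Lemma vdigit_mulr b T k : (k < T)%N -> vdigit m (b * M T) k = 0%N.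
Proof.
move=> kT; have := vdigit_addl b 0 T k (vpow_gt0 T).
by rewrite addn0 kT => ->; rewrite /vdigit div0n mod0n.
Qed.

Lemma vdigit_mul d T : (d < m T)%N -> vdigit m (d * M T) T = d.
Proof. by move=> h; rewrite /vdigit mulnK ?vpow_gt0// modn_small. Qed.

(* For i < M_n these represent the cosets of I_n. *)
Definition vnat (i : nat) : vilenkin m := fun k => inZp (vdigit m i k).

Lemma Zp_trunc_vilenkin k : (Zp_trunc (m k)).+2 = m k.
Proof. exact: Zp_cast (m_ge2 k). Qed.

Lemma val_vnat i k : vnat i k = vdigit m i k :> nat.
Proof.
by rewrite /vnat /= modn_small// [X in (_ < X)%N]Zp_trunc_vilenkin vdigit_lt.
Qed.

Lemma vsubE (x y : vilenkin m) k : (x - y) k = x k - y k.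
Proof. by []. Qed.

Lemma vcyl0 n : vcyl n (0 : vilenkin m). Proof. by []. Qed.

Lemma vcylD n (x y : vilenkin m) : vcyl n x -> vcyl n y -> vcyl n (x + y).
Proof.
move=> hx hy k kn; rewrite -[LHS]/(x k + y k) hx// hy//; exact: addr0.
Qed.

Lemma vcylN n (x : vilenkin m) : vcyl n x -> vcyl n (- x).
Proof. by move=> hx k kn; rewrite -[LHS]/(- x k) hx//; exact: oppr0. Qed.

Lemma vcylB n (x y : vilenkin m) : vcyl n x -> vcyl n y -> vcyl n (x - y).
Proof. by move=> hx hy; apply: vcylD => //; exact: vcylN. Qed.

Lemma le_vcyl n n' : (n <= n')%N -> vcyl n' `<=` (@vcyl m n).
Proof. by move=> h x hx k kn; apply: hx; exact: leq_trans h. Qed.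

Lemma vcyl_vnat n i : vcyl n (vnat i) <-> (M n %| i)%N.
Proof.
elim: n => [|n [IH1 IH2]]; first by rewrite dvd1n; split.
have vE k : (vnat i k = 0) <-> vdigit m i k = 0%N.
  by rewrite -val_vnat; split=> [->//|h]; apply: val_inj.
split=> [h|/= h k].
  have hn : (M n %| i)%N by apply: IH1; exact: le_vcyl h.
  by have /vE/eqP := h n (ltnSn n); rewrite -/(dvdn _ _) dvdn_divRL.
have hn : (M n %| i)%N by rewrite (dvdn_trans _ h)// dvdn_mull.
rewrite ltnS leq_eqVlt => /predU1P[->|kn]; last exact: IH2.
by apply/vE/eqP; rewrite -/(dvdn _ _) dvdn_divRL.
Qed.

(** The first n digits and the residue modulo M_n determine each other, through the recursion [dE]
    for the residue modulo M_(k+1). *)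
Lemma vcyl_sub_vnat n i j : vcyl n (vnat i - vnat j) <-> i = j %[mod M n].
Proof.
have vE k : ((vnat i - vnat j) k = 0) <-> vdigit m i k = vdigit m j k.
  rewrite -!val_vnat vsubE.
  split=> [/eqP|h]; first by rewrite subr_eq0 => /eqP ->.
  by apply/eqP; rewrite subr_eq0; apply/eqP/val_inj.
have dE a k : (a %% M k.+1 = vdigit m a k * M k + a %% M k)%N.
  rewrite /vdigit modn_divl [LHS](divn_eq _ (M k)) /=.
  by congr (_ + _)%N; apply: modn_dvdm; rewrite dvdn_mull.
elim: n => [|n [IH1 IH2]]; first by rewrite !modn1; split.
split=> [h|h].
  rewrite !dE IH1; last exact: le_vcyl h.
  by have /vE -> := h n (ltnSn n).
have hn : i = j %[mod M n].
  have hd : (M n %| M n.+1)%N by exact: dvdn_vpow.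
  by rewrite -(modn_dvdm i hd) h modn_dvdm.
move=> k; rewrite ltnS leq_eqVlt => /predU1P[->|kn]; last exact: IH2.
apply/vE; move: h; rewrite !dE hn => /addIn /eqP.
by rewrite eqn_pmul2r ?vpow_gt0// => /eqP.
Qed.

(** The number with digits x_0, ..., x_(n-1): it selects the representative [vnat] of the coset of x
    modulo I_n. *)
Fixpoint vcode (n : nat) (x : vilenkin m) : nat :=
  if n is n'.+1 then (x n' * M n' + vcode n' x)%N else 0%N.

Lemma vcode_lt n x : (vcode n x < M n)%N.
Proof.
elim: n => //= n IH.
have xn : (x n < m n)%N by have := ltn_ord (x n); rewrite [X in (_ < X)%N]Zp_trunc_vilenkin.
apply: leq_trans (_ : ((x n).+1 * M n <= _)%N); last by rewrite leq_mul2r xn orbT.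
by rewrite mulSn addnC ltn_add2r.
Qed.

Lemma vcyl_vcode n x : vcyl n (x - vnat (vcode n x)).
Proof.
elim: n => // n IH.
suff h k : (k <= n)%N -> (vnat (vcode n.+1 x) k = x k :> nat).
  move=> k kn; rewrite vsubE.
  by apply/eqP; rewrite subr_eq0; apply/eqP/val_inj; exact: esym (h k kn).
rewrite val_vnat /= vdigit_addl ?vcode_lt//.
rewrite leq_eqVlt => /predU1P[->|kn].
  rewrite ltnn vdigit_mul//.
  by have := ltn_ord (x n); rewrite [X in (_ < X)%N]Zp_trunc_vilenkin.
rewrite kn -val_vnat; have /eqP := IH k kn.
by rewrite vsubE subr_eq0 => /eqP <-.
Qed.

Definition vperiodic {T : Type} (n : nat) (h : vilenkin m -> T) :=
  forall x u, vcyl n u -> h (x + u) = h x.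

(** The map [vnat] is not additive, since the group has no carries, so z - [vnat i] is only in the
    coset of some [vnat (c i)]. The map c is injective on the M_n representatives, hence permutes
    them; this is the finite form of invariance under reflection. *)
Lemma sum_vnat_reflect (V : nmodType) n (h : vilenkin m -> V) (z : vilenkin m) :
  vperiodic n h -> \sum_(i < M n) h (z - vnat i) = \sum_(i < M n) h (vnat i).
Proof.
move=> hper; pose c (i : 'I_(M n)) : 'I_(M n) := Ordinal (vcode_lt n (z - vnat i)).
have cE (i : 'I_(M n)) : h (z - vnat i) = h (vnat (c i)).
  by rewrite -(hper (vnat (c i)) _ (vcyl_vcode n (z - vnat i))) [X in _ = h X]addrC subrK.
rewrite (eq_bigr (fun i => h (vnat (c i)))) => [|i _]; last exact: cE.
rewrite [RHS](reindex_inj (h := c))//= => i j cij.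
have H (k : 'I_(M n)) : vcyl n (z - vnat k - vnat (c k)) by exact: vcyl_vcode.
have := vcylB _ _ _ (H j) (H i); rewrite cij.
rewrite [X in vcyl n X](_ : _ = vnat i - vnat j); last first.
  move: (vnat i) (vnat j) (vnat (c j)) => a b d.
  by rewrite opprD opprK addrACA addNr addr0 opprD opprK addrACA subrr add0r addrC.
move=> /vcyl_sub_vnat; rewrite !modn_small// => ij; exact: val_inj.
Qed.

End GeneralizedPowers.

(** * The complex modulus and the exponential on the circle *)

Section ComplexModulus.
Context {R : realType}.
Implicit Types x y : R[i].
Local Notation normc := (@Normc.normc R).

Lemma normc_ge0 x : 0 <= normc x.
Proof. by case: x => a b; exact: sqrtr_ge0. Qed.

Lemma normcB x y : normc (x - y) <= normc x + normc y.
Proof. by rewrite -[normc y](normcN (y : Rcomplex R)); exact: le_normcD. Qed.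

Lemma normc_sum (I : Type) (r : seq I) (P : pred I) (F : I -> R[i]) :
  normc (\sum_(i <- r | P i) F i) <= \sum_(i <- r | P i) normc (F i).
Proof.
elim/big_rec2: _ => [|i y x _ h]; first by rewrite Normc.normc0.
by apply: le_trans (le_normcD (F i : Rcomplex R) x) _; rewrite lerD2l.
Qed.

Lemma normcX x n : normc (x ^+ n) = normc x ^+ n.
Proof.
elim: n => [|n IH]; first exact: Normc.normc1.
by rewrite !exprS Normc.normcM IH.
Qed.

Lemma normc_real (a : R) : normc (real_complex R a) = `|a|.
Proof. by rewrite /= expr0n addr0 sqrtr_sqr. Qed.

Lemma normc_nat n : normc n%:R = n%:R.
Proof. by rewrite -(rmorph_nat (real_complex R)) normc_real ger0_norm. Qed.

Lemma normc_le_ReIm x : normc x <= `|complex.Re x| + `|complex.Im x|.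
Proof.
case: x => a b /=.
rewrite -[leRHS]ger0_norm ?addr_ge0// -[leRHS]sqrtr_sqr.
rewrite ler_sqrt ?sqr_ge0// sqrrD !real_normK ?num_real//.
by rewrite addrAC lerDl mulrn_wge0// mulr_ge0.
Qed.

Lemma Re_le_normc x : `|complex.Re x| <= normc x.
Proof. by case: x => a b /=; rewrite -sqrtr_sqr ler_wsqrtr// lerDl sqr_ge0. Qed.

Lemma Im_le_normc x : `|complex.Im x| <= normc x.
Proof. by case: x => a b /=; rewrite -sqrtr_sqr ler_wsqrtr// lerDr sqr_ge0. Qed.

Definition expi (t : R) : R[i] := Complex (cos t) (sin t).

Lemma expiD s t : expi (s + t) = expi s * expi t.
Proof. by rewrite /expi cosD sinD; congr Complex; rewrite addrC. Qed.

Lemma expi0 : expi 0 = 1.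
Proof. by rewrite /expi cos0 sin0. Qed.

Lemma expiMn t n : expi (t *+ n) = expi t ^+ n.
Proof.
elim: n => [|n IH]; first by rewrite mulr0n expi0.
by rewrite mulrS exprS expiD IH.
Qed.

Lemma expi_2pi : expi (2 * pi) = 1.
Proof. by rewrite /expi mulr_natl cos2pi sin2pi. Qed.

Lemma normc_expi t : normc (expi t) = 1.
Proof. by rewrite /= cos2Dsin2 sqrtr1. Qed.

(** If cos t were 1, the double angle formula would force sin (t / 2) = 0, although 0 < t / 2 <
    pi. *)
Lemma expi_neq1 (t : R) : 0 < t < 2 * pi -> expi t != 1.
Proof.
move=> /andP[t0 t2]; apply/eqP => -[c1 _].
have : 0 < sin (t / 2) by rewrite sin_gt0_pi//; apply/andP; split; lra.
move=> s0; have := sin2cos2 (t / 2).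
have : cos ((t / 2) *+ 2) = 1 by rewrite -[t / 2 *+ 2]mulr_natr mulfVK ?pnatr_eq0.
rewrite cos_mulr2n -[_ *+ 2]mulr_natr => c2 s2.
have : 0 < sin (t / 2) ^+ 2 by rewrite exprn_gt0.
by rewrite s2; lra.
Qed.

End ComplexModulus.

(** * Vilenkin characters: multiplicativity, periodicity, vanishing block sums *)

Section VilenkinCharacters.
Context {R : realType} {m : nat -> nat} (m_ge2 : forall k, (2 <= m k)%N).
Local Notation M := (vpow m).
Local Notation G := (vilenkin m).
Local Notation normc := (@Normc.normc R).
Local Notation rad := (@rademacher R m).
Local Notation psi := (@vpsi R m).
Implicit Types x y u : G.

Let mN0 k : (m k)%:R != 0 :> R.
Proof. by rewrite pnatr_eq0 -lt0n (leq_trans _ (m_ge2 k)). Qed.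

Lemma rademacherE k x : rad k x = expi (2 * pi / (m k)%:R) ^+ (x k).
Proof.
by rewrite -expiMn -[_ *+ nat_of_ord _]mulr_natr mulrAC.
Qed.

Lemma expi_root k : expi (2 * pi / (m k)%:R : R) ^+ m k = 1.
Proof. by rewrite -expiMn -[_ *+ m k]mulr_natr mulfVK// expi_2pi. Qed.

Lemma expi_modn k n :
  expi (2 * pi / (m k)%:R : R) ^+ (n %% m k) = expi (2 * pi / (m k)%:R) ^+ n.
Proof.
by rewrite [in RHS](divn_eq n (m k)) exprD mulnC exprM expi_root expr1n mul1r.
Qed.

Lemma expi_exp_neq1 k d : (0 < d < m k)%N ->
  expi (2 * pi / (m k)%:R : R) ^+ d != 1.
Proof.
move=> /andP[d0 dm]; rewrite -expiMn; apply: expi_neq1.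
have m0 : 0 < (m k)%:R :> R by rewrite ltr0n (leq_trans d0) // ltnW.
rewrite -[_ *+ d]mulr_natr; apply/andP; split.
  by rewrite mulr_gt0 ?ltr0n// divr_gt0// mulr_gt0 ?pi_gt0.
rewrite mulrAC ltr_pdivrMr// ltr_pM2l ?ltr_nat//.
by rewrite mulr_gt0 ?pi_gt0.
Qed.

Lemma rademacherD k x y : rad k (x + y) = rad k x * rad k y.
Proof.
rewrite !rademacherE -exprD.
have -> : nat_of_ord ((x + y) k) = ((x k + y k) %% m k)%N.
  transitivity ((x k + y k) %% (Zp_trunc (m k)).+2)%N; first by [].
  by congr modn; exact: Zp_trunc_vilenkin.
exact: expi_modn.
Qed.

Lemma rademacher_cyl k x : x k = 0 -> rad k x = 1.
Proof. by rewrite rademacherE => ->. Qed.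

Lemma rademacher_expm k x : rad k x ^+ m k = 1.
Proof. by rewrite rademacherE exprAC expi_root expr1n. Qed.

Lemma normc_rademacher k x : normc (rad k x) = 1.
Proof. exact: normc_expi. Qed.

Lemma vilenkin_lt x k : (x k < m k)%N.
Proof. by have := ltn_ord (x k); rewrite [X in (_ < X)%N](Zp_trunc_vilenkin m_ge2). Qed.

Lemma sum_rademacher k x : x k <> 0 -> \sum_(d < m k) rad k x ^+ d = 0.
Proof.
move=> xk; have r1 : rad k x != 1.
  rewrite rademacherE expi_exp_neq1// vilenkin_lt andbT lt0n.
  by apply/eqP => h; apply: xk; exact: val_inj.
apply/eqP; have := subrX1 (rad k x) (m k); rewrite rademacher_expm subrr.
by move/esym/eqP; rewrite mulf_eq0 subr_eq0 (negbTE r1).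
Qed.

(** The additional digits vanish. The range of the product in [vpsi] depends on n; a common K lets
    characters of different index be compared factor by factor. *)
Lemma vpsiE K n x : (n < M K)%N -> psi n x = \prod_(k < K) rad k x ^+ vdigit m n k.
Proof.
have ext N d : (n < M N)%N ->
    \prod_(k < N + d) rad k x ^+ vdigit m n k = \prod_(k < N) rad k x ^+ vdigit m n k.
  move=> h; elim: d => [|d IH]; first by rewrite addn0.
  rewrite addnS big_ord_recr/= IH vdigit_small ?expr0 ?mulr1//.
  by rewrite (leq_trans h)// (leq_vpow m_ge2)// leq_addr.
move=> h; rewrite -(ext K n)// addnC ext// (leq_trans (ltn_vpow m_ge2 n))//.
Qed.

Lemma normc_vpsi n x : normc (psi n x) = 1.
Proof.
rewrite /vpsi; elim/big_rec: _ => [|k z _ IH]; first exact: Normc.normc1.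
by rewrite Normc.normcM normcX normc_rademacher expr1n mul1r.
Qed.

Lemma vpsiD n x y : psi n (x + y) = psi n x * psi n y.
Proof.
rewrite /vpsi -big_split/=; apply: eq_bigr => k _.
by rewrite rademacherD exprMn.
Qed.

Lemma vpsi_cyl n T x : (n < M T)%N -> vcyl T x -> psi n x = 1.
Proof.
move=> nT xT; rewrite (vpsiE T)//; apply: big1 => k _.
by rewrite rademacher_cyl ?expr1n// xT.
Qed.

Lemma vpsi_at0 n : psi n (0 : G) = 1.
Proof. by rewrite (vpsi_cyl n n)// ltn_vpow. Qed.

(** Both sides are inverse to psi_n(x): the left one because the modulus is 1, the right one because
    psi_n is a homomorphism. *)
Lemma conjc_vpsi n x : conjc (psi n x) = psi n (- x).
Proof.
have h : psi n x * psi n (- x) = 1 by rewrite -vpsiD subrr vpsi_at0.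
have h2 : psi n x * conjc (psi n x) = 1.
  rewrite -sqr_normc; have -> : `|psi n x| = real_complex R (normc (psi n x)).
    by case: (psi n x).
  by rewrite normc_vpsi expr1n.
have p0 : psi n x != 0.
  by apply/eqP => e; move: h; rewrite e mul0r => /eqP; rewrite eq_sym oner_eq0.
by apply: (mulfI p0); rewrite h h2.
Qed.

Lemma vpsi_periodic n T : (n < M T)%N -> vperiodic T (psi n).
Proof. by move=> nT x u uT; rewrite vpsiD (vpsi_cyl n T u)// mulr1. Qed.

Lemma vpsi_addl b r T x : (r < M T)%N -> psi (b * M T + r) x = psi (b * M T) x * psi r x.
Proof.
move=> rT; set K := (b * M T + r + T)%N.
have hK : (K < M K)%N := ltn_vpow m_ge2 K.
have h1 : (b * M T + r < M K)%N by apply: leq_ltn_trans hK; rewrite leq_addr.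
have h2 : (b * M T < M K)%N by apply: leq_ltn_trans h1; rewrite leq_addr.
have h3 : (r < M K)%N by apply: leq_ltn_trans h1; rewrite leq_addl.
rewrite !(vpsiE K)// -big_split/=; apply: eq_bigr => k _.
rewrite -exprD (vdigit_addl m_ge2)//; congr (_ ^+ _).
case: ltnP => kT; first by rewrite (vdigit_mulr m_ge2).
by rewrite [vdigit m r k]vdigit_small ?addn0// (leq_trans rT)// (leq_vpow m_ge2).
Qed.

Lemma vpsi_mul d T x : (d < m T)%N -> psi (d * M T) x = rad T x ^+ d.
Proof.
move=> dT; rewrite (vpsiE T.+1); last by rewrite /= ltn_pmul2r ?vpow_gt0.
rewrite big_ord_recr/= (vdigit_mul m_ge2)// big1 ?mul1r// => k _.
by rewrite (vdigit_mulr m_ge2)//.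
Qed.

Lemma sum_blocks {V : nmodType} (F : nat -> V) q d :
  \sum_(i < q * d) F i = \sum_(b < q) \sum_(r < d) F (b * d + r)%N.
Proof.
elim: q => [|q IH]; first by rewrite mul0n !big_ord0.
rewrite mulSnr big_split_ord/= IH big_ord_recr/=; congr (_ + _).
Qed.

(** The block of length M_(T+1) factors into a geometric sum in r_T(x) and the block of length M_T.
    If x is outside I_T, the latter vanishes by induction; otherwise x_T is nonzero and the
    geometric sum over m_T powers of a root of unity vanishes. *)
Lemma sum_vpsi T x : ~ vcyl T x -> \sum_(r < M T) psi r x = 0.
Proof.
elim: T => [[]//|T IH] xT.
rewrite /= (sum_blocks (fun r => psi r x)).
under eq_bigr => b _.
  under eq_bigr => r _ do rewrite vpsi_addl//.
  rewrite -mulr_sumr vpsi_mul//.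
  over.
rewrite -mulr_suml.
have [/IH ->|xT'] := pselect (~ vcyl T x); first by rewrite mulr0.
rewrite sum_rademacher ?mul0r// => x0; apply: xT => k.
rewrite ltnS leq_eqVlt => /predU1P[->//|]; exact: (contrapT xT').
Qed.

(** The witness is the unit vector at the top nonzero digit k >= l of n, where psi_n is exp(2 pi i /
    m_k) to the power of that digit. It serves to annihilate the high Fourier coefficients of
    functions invariant under I_l. *)
Lemma exists_vpsi_neq1 l n : (M l <= n)%N -> exists2 u : G, vcyl l u & psi n u != 1.
Proof.
move=> ln.
have [k /andP[kn nk] kmax] : exists2 k, (M k <= n < M k.+1)%N & (l <= k)%N.
  have [i hi] : exists i, (n < M (l + i))%N.
    exists n.
    by rewrite (leq_trans (ltn_vpow m_ge2 n))// (leq_vpow m_ge2)// leq_addl.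
  elim: i hi => [|j IH]; first by rewrite addn0 ltnNge ln.
  rewrite addnS; have [nj _|nj nj1] := ltnP n (M (l + j)); first exact: IH.
  by exists (l + j)%N; [rewrite nj nj1|exact: leq_addr].
have dk : (0 < vdigit m n k < m k)%N.
  rewrite (vdigit_lt m_ge2) andbT /vdigit modn_small.
    by rewrite divn_gt0 ?vpow_gt0.
  by rewrite ltn_divLR ?vpow_gt0.
exists (vnat (M k)); first by apply/(vcyl_vnat m_ge2); exact: dvdn_vpow.
have digE j : vdigit m (M k) j = (j == k).
  rewrite -[M k]mul1n; case: (ltngtP j k) => [jk|kj|->].
  - by rewrite (vdigit_mulr m_ge2).
  - rewrite vdigit_small// mul1n; apply: leq_trans (leq_vpow m_ge2 _ _ kj) => /=.
    by rewrite ltn_Pmull ?vpow_gt0.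
  - by rewrite (vdigit_mul m_ge2).
rewrite (vpsiE k.+1)// big_ord_recr/= big1 ?mul1r => [|j _].
  by rewrite rademacherE (val_vnat m_ge2) digE eqxx expr1 expi_exp_neq1.
rewrite rademacherE (val_vnat m_ge2) digE.
by rewrite ltn_eqF// expr0 expr1n.
Qed.

End VilenkinCharacters.

(** * Abel summation with increasing coefficients *)

Section Abel.
Context {R : realType}.
Local Notation normc := (@Normc.normc R).

(** The boundary term a_N times the full sum costs K a_N. Its difference from the weighted sum
    collects the increments of a against partial sums, hence is at most K (a_N - a_0) <= K a_N. *)
Lemma abel_summation_le (a : nat -> R) (c : nat -> R[i]) (K : R) N :
  (forall i, (i <= N)%N -> 0 <= a i) ->
  (forall i, (i < N)%N -> a i <= a i.+1) ->
  (forall j, normc (\sum_(i < j) c i) <= K) ->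
  normc (\sum_(i < N.+1) real_complex R (a i) * c i) <= 2 * K * a N.
Proof.
move=> a0 aS cK; have K0 : 0 <= K by exact: le_trans (normc_ge0 _) (cK 0%N).
have H k : (k <= N)%N -> normc (real_complex R (a k) * (\sum_(i < k.+1) c i)
    - \sum_(i < k.+1) real_complex R (a i) * c i) <= K * (a k - a 0%N).
  elim: k => [_|k IH kN].
    by rewrite !big_ord1 !subrr mulr0 Normc.normc0.
  rewrite big_ord_recr/= [X in _ - X]big_ord_recr/= mulrDr opprD.
  rewrite addrACA subrr addr0.
  have -> : a k.+1 - a 0%N = (a k.+1 - a k) + (a k - a 0%N) by ring.
  rewrite [X in normc X](_ : _ = real_complex R (a k.+1 - a k) * (\sum_(i < k.+1) c i)
    + (real_complex R (a k) * (\sum_(i < k.+1) c i)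
    - \sum_(i < k.+1) real_complex R (a i) * c i)); last first.
    by rewrite rmorphB mulrBl addrA subrK.
  apply: le_trans (le_normcD (_ : Rcomplex R) _) _.
  rewrite mulrDr lerD//; last by apply: IH; exact: ltnW.
  by rewrite Normc.normcM normc_real mulrC ger0_norm ?subr_ge0 ?aS// ler_wpM2r// subr_ge0 aS.
set S := \sum_(i < N.+1) real_complex R (a i) * c i.
rewrite (_ : S = real_complex R (a N) * (\sum_(i < N.+1) c i) -
  (real_complex R (a N) * (\sum_(i < N.+1) c i) - S)); last by rewrite opprB addrC subrK.
apply: le_trans (normcB _ _) _.
rewrite -mulrA mulr_natl mulr2n lerD//.
  by rewrite Normc.normcM normc_real ger0_norm ?a0// mulrC ler_wpM2r ?a0.
by apply: le_trans (H N (leqnn _)) _; rewrite ler_wpM2l// gerBl a0.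
Qed.

End Abel.

(** * L^1 bounds for the one-dimensional Cesàro kernels *)

Section KernelEstimates.
Context {R : realType} {m : nat -> nat} (m_ge2 : forall k, (2 <= m k)%N).
Local Notation M := (vpow m).
Local Notation G := (vilenkin m).
Local Notation normc := (@Normc.normc R).
Local Notation psi := (@vpsi R m).

(** Complete blocks of length M_T cancel off I_T; fewer than M_T terms of modulus 1 remain. *)
Lemma normc_dirichlet T j (x : G) : ~ vcyl T x -> normc (\sum_(i < j) psi i x) <= (M T)%:R.
Proof.
move=> xT; rewrite (divn_eq j (M T)) big_split_ord/=.
rewrite (sum_blocks (fun i => psi i x)).
rewrite (eq_bigr (fun=> 0)) => [|b _]; last first.
  under eq_bigr => r _ do rewrite (vpsi_addl m_ge2)//.
  by rewrite -mulr_sumr (sum_vpsi m_ge2)// mulr0.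
rewrite big1// add0r; apply: le_trans (normc_sum _ _ _ _) _.
rewrite (eq_bigr (fun=> 1)) => [|r _]; last exact: normc_vpsi.
by rewrite sumr_const card_ord ler_nat ltnW// ltn_pmod// vpow_gt0.
Qed.

Lemma sum_dvdn (V : realType) q d : (0 < d)%N ->
  \sum_(c < q * d) ((d %| c)%N%:R : V) = q%:R.
Proof.
case: d => // d _; rewrite (sum_blocks (fun c => (d.+1 %| c)%N%:R)).
rewrite (eq_bigr (fun=> 1)) ?sumr_const ?card_ord// => b _.
rewrite big_ord_recl/= addn0 dvdn_mull// big1 ?addr0// => i _.
by rewrite dvdn_addr ?dvdn_mull// gtnNdvd//= /bump leq0n add1n ltnS.
Qed.

(** The group is split into the shells I_T \ I_(T+1) for T < l and the core I_l. On a shell h is at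
    most [s T], and the shell has at most the share 1 / M_T of the representatives. *)
Lemma vnat_mean_le (h : G -> R) (s : nat -> R) (s' : R) l :
  (forall T, 0 <= s T) -> 0 <= s' ->
  (forall T x, (T < l)%N -> ~ vcyl T.+1 x -> h x <= s T) ->
  (forall x, h x <= s') ->
  (M l)%:R^-1 * \sum_(c < M l) h (vnat c) <= \sum_(T < l) s T / (M T)%:R + s' / (M l)%:R.
Proof.
move=> s0 s'0 hs hs'.
have Ml0 : 0 < (M l)%:R :> R by rewrite ltr0n vpow_gt0.
have step (c : 'I_(M l)) : h (vnat c) <=
    \sum_(T < l) s T * (M T %| c)%N%:R + s' * (M l %| c)%N%:R.
  have [lc|lc] := boolP (M l %| c)%N.
    rewrite mulr1; apply: le_trans (hs' _) _.
    by rewrite lerDr sumr_ge0// => T _; rewrite mulr_ge0.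
  (* T is the largest level with M_T dividing c, so [vnat c] lies in the shell of index T. *)
  have [T Tl /andP[Tc nTc]] : exists2 T, (T < l)%N & (M T %| c)%N && ~~ (M T.+1 %| c)%N.
    move: (nat_of_ord c) lc => {}c.
    elim: (l) => [|k IH]; first by rewrite dvd1n.
    have [kc kc1|/IH[T Tk HT] _] := boolP (M k %| c)%N; first by exists k; rewrite ?kc.
    by exists T => //; exact: ltnW.
  rewrite mulr0 addr0 (bigD1 (Ordinal Tl))//= Tc mulr1.
  apply: le_trans (hs T _ Tl _) _; first by move=> /(vcyl_vnat m_ge2); exact/negP.
  by rewrite lerDl sumr_ge0// => i _; rewrite mulr_ge0.
rewrite mulrC ler_pdivrMr//; apply: le_trans (ler_sum _ (fun c _ => step c)) _.
rewrite big_split/= exchange_big/= mulrDl; apply: lerD.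
  rewrite mulr_suml; apply: ler_sum => T _.
  have /dvdnP[q qE] := dvdn_vpow _ _ (ltnW (ltn_ord T)) : (M T %| M l)%N.
  rewrite -mulr_sumr [in leLHS]qE sum_dvdn ?vpow_gt0// qE natrM.
  by rewrite [q%:R * _]mulrC mulrA mulfVK ?pnatr_eq0 -?lt0n ?vpow_gt0.
rewrite -mulr_sumr mulfVK ?gt_eqF//.
by have := sum_dvdn R 1 _ (vpow_gt0 m_ge2 l); rewrite mul1n => ->; rewrite mulr1.
Qed.

Section CesaroKernel.
Context (a : R) (a01 : 0 < a < 1).
Local Notation A := (cesaro_number (- a)).

Lemma le_sum_cesaro_number N N' : (N <= N')%N -> \sum_(i < N) A i <= \sum_(i < N') A i.
Proof.
move=> /subnKC <-; rewrite big_split_ord/= lerDl.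
by apply: sumr_ge0 => i _; exact: cesaro_number_ge0.
Qed.

Lemma sum_cesaro_rev n N : (N <= n.+1)%N ->
  \sum_(i < N) A (n - i) <= \sum_(i < N) A i.
Proof.
move=> Nn; rewrite (reindex_inj rev_ord_inj)/=; apply: ler_sum => i _.
by apply: le_cesaro_number => //; have := ltn_ord i; lia.
Qed.

Lemma normc_cesaro_kernel_trivial n N (x : G) : (N <= n.+1)%N ->
  normc (\sum_(i < N) real_complex R (A (n - i)) * psi i x) <= \sum_(i < N) A i.
Proof.
move=> Nn; apply: le_trans (normc_sum _ _ _ _) _.
apply: le_trans (sum_cesaro_rev n N Nn); apply: ler_sum => i _.
by rewrite Normc.normcM normc_vpsi mulr1 normc_real ger0_norm ?cesaro_number_ge0.
Qed.

(** The coefficients A_(n-i) increase with i, so Abel summation applies to the Dirichlet bound and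
    only the last coefficient matters. *)
Lemma normc_cesaro_kernel_smooth T n N (x : G) : (0 < N <= n)%N -> ~ vcyl T x ->
  normc (\sum_(i < N) real_complex R (A (n - i)) * psi i x)
    <= 2 * (M T)%:R * A (n - N.-1).
Proof.
case: N => //= N Nn xT.
apply: (abel_summation_le (fun i => A (n - i)) (fun i => psi i x)).
- by move=> i _; exact: cesaro_number_ge0.
- by move=> i iN; apply: le_cesaro_number => //; lia.
- by move=> j; exact: normc_dirichlet.
Qed.

(** The largest coefficients belong to the last frequencies. The last M_T of them are bounded
    trivially; in the remaining sum the last coefficient is at most A_(M_T), and Abel summation
    gives 2 M_T A_(M_T), which is at most twice the sum of the A_i with i < M_T because A decreases.
    The bound depends on neither n nor N. *)
Lemma normc_cesaro_kernel_le T n N (x : G) : (N <= n.+1)%N -> ~ vcyl T x ->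
  normc (\sum_(i < N) real_complex R (A (n - i)) * psi i x)
    <= 3 * \sum_(i < M T) A i.
Proof.
move=> Nn xT; have S0 k : 0 <= \sum_(i < k) A i.
  by apply: sumr_ge0 => i _; exact: cesaro_number_ge0.
have [NM|MN] := leqP N (M T).
  apply: le_trans (normc_cesaro_kernel_trivial _ _ _ Nn) _.
  by apply: le_trans (le_sum_cesaro_number _ _ NM) _; have := S0 (M T); lra.
have NE : (N = (N - M T) + M T)%N by rewrite subnK// ltnW.
rewrite NE big_split_ord/=; apply: le_trans (le_normcD (_ : Rcomplex R) _) _.
have -> : 3 * \sum_(i < M T) A i = 2 * (\sum_(i < M T) A i) + \sum_(i < M T) A i by ring.
apply: lerD.
  apply: le_trans (normc_cesaro_kernel_smooth T _ _ _ _ xT) _.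
    by have := vpow_gt0 m_ge2 T; lia.
  rewrite -mulrA ler_wpM2l//.
  apply: (@le_trans _ _ (\sum_(i < M T) A (M T))).
    rewrite sumr_const card_ord mulr_natl ler_wMn2r//.
    by apply: le_cesaro_number => //; lia.
  by apply: ler_sum => i _; apply: le_cesaro_number => //; exact: ltnW.
apply: le_trans (normc_sum _ _ _ _) _.
apply: le_trans (sum_cesaro_rev (n - (N - M T)) (M T) _); last by lia.
apply: ler_sum => i _.
rewrite Normc.normcM normc_vpsi mulr1 normc_real ger0_norm ?cesaro_number_ge0//.
by rewrite subnDA.
Qed.

(* Truncated to frequencies below M_l: on functions constant on the cosets of
   I_l, convolution with it is the one-dimensional Cesaro mean. *)
Definition cesaro_kernel (n l : nat) (x : G) : R[i] :=
  \sum_(i < minn n.+1 (M l)) real_complex R (A (n - i) / A n) * psi i x.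

(* The L^1 norm of the kernel, which is constant on the cosets of I_l. *)
Definition cesaro_lebesgue (n l : nat) : R :=
  (M l)%:R^-1 * \sum_(c < M l) normc (cesaro_kernel n l (vnat c)).

Lemma cesaro_lebesgue_ge0 n l : 0 <= cesaro_lebesgue n l.
Proof. by rewrite mulr_ge0 ?invr_ge0// sumr_ge0// => c _; exact: normc_ge0. Qed.

Lemma cesaro_kernelE n l x : cesaro_kernel n l x = real_complex R (A n)^-1 *
  \sum_(i < minn n.+1 (M l)) real_complex R (A (n - i)) * psi i x.
Proof.
rewrite mulr_sumr; apply: eq_bigr => i _.
by rewrite mulrA -rmorphM mulrC [_^-1 * _]mulrC mulrC.
Qed.

Lemma cesaro_lebesgueE n l : cesaro_lebesgue n l = (A n)^-1 *
  ((M l)%:R^-1 * \sum_(c < M l)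
    normc (\sum_(i < minn n.+1 (M l)) real_complex R (A (n - i)) * psi i (vnat c))).
Proof.
rewrite /cesaro_lebesgue mulrCA; congr (_ * _); rewrite mulr_sumr.
apply: eq_bigr => c _; rewrite cesaro_kernelE Normc.normcM normc_real ger0_norm//.
by rewrite invr_ge0 cesaro_number_ge0.
Qed.

Lemma inv_cesaro_number_le n : (A n)^-1 <= n.+1%:R `^ a / (1 - a).
Proof.
case/andP: (a01) => a0 a1.
have p0 : 0 < n.+1%:R `^ a by rewrite powR_gt0.
rewrite -[leRHS]invf_div lef_pV2 ?posrE ?cesaro_number_gt0//; last first.
  by rewrite divr_gt0// subr_gt0.
exact: cesaro_number_lb.
Qed.

Context (B : nat) (m_le : forall k, (m k <= B)%N).

(** The shell of index T contributes at most 3 / M_T times a sum of order M_(T+1)^(1-a), hence, as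
    m_T <= B, a multiple of 2^(-aT). The series over the shells is geometric, and all growth in n
    comes from 1 / A_n. *)
Lemma cesaro_lebesgue_le : exists2 C : R, 0 < C &
  forall n l, cesaro_lebesgue n l <= C * n.+1%:R `^ a.
Proof.
case/andP: (a01) => a0 a1; have a1' : 0 < 1 - a by rewrite subr_gt0.
set q : R := (2 `^ a)^-1.
have q0 : 0 < q by rewrite invr_gt0 powR_gt0.
have q1 : q < 1.
  rewrite invf_lt1 ?powR_gt0// -[X in X < _](powRr0 2).
  by rewrite /powR !ifF ?pnatr_eq0// ltr_expR ltr_pM2r// ln_gt0// ltr1n.
(* The sum of the geometric series over the shells, plus the contribution of the core I_l. *)
pose C0 := 3 * B%:R / (1 - a) / (1 - q) + (1 - a)^-1.
have C00 : 0 < C0.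
  rewrite ltr_wpDl ?invr_gt0// !divr_ge0 ?mulr_ge0 ?subr_ge0 ?ler0n//; exact: ltW.
exists (C0 / (1 - a)); first by rewrite divr_gt0.
move=> n l; rewrite cesaro_lebesgueE mulrAC mulrC -[leRHS]mulrA mulrC.
rewrite [leRHS]mulrC; apply: ler_pM => //.
- by rewrite invr_ge0 cesaro_number_ge0.
- by rewrite mulr_ge0 ?invr_ge0// sumr_ge0// => c _; exact: normc_ge0.
- exact: inv_cesaro_number_le.
have S0 k : 0 <= \sum_(i < k) A i.
  by apply: sumr_ge0 => i _; exact: cesaro_number_ge0.
have h := vnat_mean_le _ (fun T => 3 * \sum_(i < M T.+1) A i) (\sum_(i < M l) A i) l.
pose k (x : G) := normc (\sum_(i < minn n.+1 (M l)) real_complex R (A (n - i)) * psi i x).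
apply: le_trans (h k _ _ _ _) _ => //; rewrite /k.
- by move=> T; rewrite mulr_ge0.
- by move=> T x Tl xT; apply: normc_cesaro_kernel_le => //; exact: geq_minl.
- move=> x; apply: le_trans (normc_cesaro_kernel_trivial _ _ _ _) _; first exact: geq_minl.
  by apply: le_sum_cesaro_number; exact: geq_minr.
have powM T : 0 < (M T)%:R :> R by rewrite ltr0n vpow_gt0.
have powMa T : ((M T)%:R `^ a)^-1 <= q ^+ T.
  rewrite exprVn lef_pV2 ?posrE ?powR_gt0 ?exprn_gt0 ?powR_gt0//.
  rewrite -powR_mulrn ?powR_ge0// -powRrM mulrC powRrM powR_mulrn// -natrX.
  by rewrite ge0_ler_powR ?nnegrE ?ler0n ?(ltW a0)// ler_nat expn2_le_vpow.
have SB T : \sum_(i < M T.+1) A i <= B%:R / (1 - a) * q ^+ T * (M T)%:R.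
  apply: le_trans (sum_cesaro_number_ub a01 _ (vpow_gt0 m_ge2 _)) _.
  have xq : ((M T.+1)%:R `^ a)^-1 <= q ^+ T.
    by apply: le_trans (powMa _) _; rewrite exprS ler_piMl ?exprn_ge0 ?(ltW q0) ?(ltW q1).
  move: ((_ `^ _)^-1) xq => x xq; rewrite [M T.+1]/= natrM.
  have -> : (m T)%:R * (M T)%:R * x / (1 - a) = (m T)%:R * x * ((1 - a)^-1 * (M T)%:R) by ring.
  have -> : B%:R / (1 - a) * q ^+ T * (M T)%:R = B%:R * q ^+ T * ((1 - a)^-1 * (M T)%:R) by ring.
  rewrite ler_wpM2r ?mulr_ge0 ?invr_ge0 ?(ltW a1')//.
  apply: (@le_trans _ _ ((m T)%:R * q ^+ T)); first by rewrite ler_wpM2l.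
  by rewrite ler_wpM2r ?exprn_ge0 ?(ltW q0)// ler_nat.
rewrite lerD//.
  apply: (@le_trans _ _ (\sum_(T < l) 3 * B%:R / (1 - a) * q ^+ T)).
    apply: ler_sum => T _; rewrite ler_pdivrMr//.
    apply: (@le_trans _ _ (3 * (B%:R / (1 - a) * q ^+ T * (M T)%:R))).
      by rewrite ler_wpM2l.
    by rewrite !mulrA.
  rewrite -mulr_sumr ler_wpM2l ?divr_ge0 ?mulr_ge0 ?ler0n ?(ltW a1')//.
  rewrite -[leLHS](mulfK (x := 1 - q)); last by rewrite gt_eqF// subr_gt0.
  rewrite ler_piMl ?invr_ge0 ?subr_ge0 ?(ltW q1)//.
  have -> : (\sum_(i < l) q ^+ i) * (1 - q) = 1 - q ^+ l.
    by rewrite -[RHS]opprB subrX1 -mulNr opprB mulrC.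
  by rewrite gerBl exprn_ge0// ltW.
rewrite ler_pdivrMr//; apply: le_trans (sum_cesaro_number_ub a01 _ (vpow_gt0 m_ge2 _)) _.
rewrite mulrC ler_wpM2l ?invr_ge0 ?(ltW a1')// ler_piMr// (le_trans (powMa l))//.
by rewrite exprn_ile1 ?ltW.
Qed.

(** All frequencies are at most n / 2, so no coefficient exceeds A_(n - M_l), which is comparable to
    A_n. Each of the l shells then contributes a bounded amount. *)
Lemma cesaro_lebesgue_le_smooth : exists2 C : R, 0 < C &
  forall n l, (2 * M l <= n)%N -> cesaro_lebesgue n l <= C * l.+1%:R.
Proof.
case/andP: (a01) => a0 a1; have a1' : 0 < 1 - a by rewrite subr_gt0.
(* At most 2 B for each shell and 1 for the core, times the ratio A_(n - M_l) / A_n, which is at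
   most 2^a / (1 - a) because n + 1 <= 2 (n - M_l + 1). *)
exists ((2 * B%:R + 1) * (2 / (1 - a))).
  by rewrite mulr_gt0 ?divr_gt0// ltr_wpDl// mulr_ge0.
move=> n l ln.
have Ml0 := vpow_gt0 m_ge2 l.
have minE : minn n.+1 (M l) = M l by apply/minn_idPr; lia.
rewrite cesaro_lebesgueE minE.
have h := vnat_mean_le _ (fun T => 2 * (M T.+1)%:R * A (n - M l)) ((M l)%:R * A (n - M l)) l.
have A0 := cesaro_number_ge0 a01 (n - M l).
apply: (@le_trans _ _ ((A n)^-1 * ((2 * B%:R + 1) * l.+1%:R * A (n - M l)))).
  rewrite ler_wpM2l ?invr_ge0 ?cesaro_number_ge0//.
  pose k (x : G) := normc (\sum_(i < M l) real_complex R (A (n - i)) * psi i x).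
  apply: le_trans (h k _ _ _ _) _ => //; rewrite /k.
  - by move=> T; apply: mulr_ge0 => //; exact: mulr_ge0.
  - by rewrite mulr_ge0.
  - move=> T x Tl xT.
    apply: le_trans (normc_cesaro_kernel_smooth _ _ _ _ _ xT) _; first by lia.
    rewrite ler_wpM2l ?mulr_ge0//; apply: le_cesaro_number => //; lia.
  - move=> x; apply: le_trans (normc_sum _ _ _ _) _.
    have -> : (M l)%:R * A (n - M l) = \sum_(i < M l) A (n - M l).
      by rewrite sumr_const card_ord mulr_natl.
    apply: ler_sum => i _.
    rewrite Normc.normcM normc_vpsi mulr1 normc_real ger0_norm ?cesaro_number_ge0//.
    by apply: le_cesaro_number => //; have := ltn_ord i; lia.
  rewrite [X in _ + X]mulrAC mulfV ?pnatr_eq0 -?lt0n// mul1r.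
  apply: (@le_trans _ _ (\sum_(T < l) (2 * B%:R) * A (n - M l) + A (n - M l))).
    rewrite lerD2r; apply: ler_sum => T _.
    rewrite ler_pdivrMr ?ltr0n ?vpow_gt0// /= natrM.
    have -> : 2 * ((m T)%:R * (M T)%:R) * A (n - M l) = (m T)%:R * (2 * A (n - M l) * (M T)%:R) by ring.
    have -> : 2 * B%:R * A (n - M l) * (M T)%:R = B%:R * (2 * A (n - M l) * (M T)%:R) by ring.
    by apply: ler_wpM2r; [apply: mulr_ge0 => //; exact: mulr_ge0|rewrite ler_nat].
  rewrite sumr_const card_ord -[_ *+ l]mulr_natr.
  have -> : 2 * B%:R * A (n - M l) * l%:R + A (n - M l) = (2 * B%:R * l%:R + 1) * A (n - M l) by ring.
  rewrite ler_wpM2r//.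
  rewrite -[l.+1%:R]natr1; have : 0 <= l%:R :> R by []; have : 0 <= B%:R :> R by [].
  by move: (l%:R : R) (B%:R : R) => x y y0 x0; rewrite mulrDl !mulrDr !mulr1 mul1r; lra.
rewrite [leRHS]mulrAC [leLHS]mulrCA ler_wpM2l//.
rewrite mulrC; apply: le_trans (ler_pM _ _ (cesaro_number_ub a01 _) (inv_cesaro_number_le n)) _ => //.
  by rewrite invr_ge0 cesaro_number_ge0.
rewrite mulrA ler_wpM2r ?invr_ge0 ?(ltW a1')// mulrC ler_pdivrMr ?powR_gt0 ?ltr0n//.
apply: (@le_trans _ _ ((2 * (n - M l).+1%:R) `^ a)).
  rewrite ge0_ler_powR ?nnegrE ?(ltW a0) ?mulr_ge0 ?ler0n// -natrM ler_nat; lia.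
rewrite powRM// ler_wpM2r ?powR_ge0// -[leRHS]powRr1//.
by rewrite ler_powR ?ler1n// (ltW a1).
Qed.

End CesaroKernel.
End KernelEstimates.

(** * Topology and measurability on the group and its square *)

Section VilenkinTopology.
Context {m : nat -> nat} (m_ge2 : forall k, (2 <= m k)%N).
Local Notation G := (vilenkin m).
Local Notation G2 := (G * G)%type.

Lemma vilenkin_cvg (F : set_system G) (x : G) : Filter F ->
  (forall k, F [set y | y k = x k]) -> F --> x.
Proof.
move=> FF Fx; apply/cvg_sup => k A /= [_ [[B Bop <-] Bx BA]].
rewrite nbhs_filterE; apply: filterS (Fx k) => y yx; apply: BA.
by rewrite /preimage /= yx.
Qed.

Lemma open_vilenkin_coord k (a : 'Z_(m k)) : open [set x : G | x k = a].
Proof.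
rewrite openE => x /= xa.
have /cvg_sup/(_ k) : nbhs x --> x by exact: cvg_id.
apply; exists [set y : G | y k = a]; split => //.
exists [set a]; last by [].
exact: (@discrete_open (discrete_topology 'Z_(m k))).
Qed.

Lemma open_vilenkin_cyl (U : set G) x : open U -> U x ->
  exists n, forall y, vcyl n (y - x) -> U y.
Proof.
move=> Uo Ux; pose F := filter_from setT (fun n => [set y : G | vcyl n (y - x)]).
have FF : Filter F.
  apply: filter_fromT_filter; first by exists 0%N.
  move=> i j; exists (maxn i j) => y h; split; apply: le_vcyl h.
    exact: leq_maxl.
  exact: leq_maxr.
have Fx : F --> x.
  apply: vilenkin_cvg => k; exists k.+1 => // y h /=.
  by have := h k (ltnSn k); rewrite vsubE => /eqP; rewrite subr_eq0 => /eqP.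
have [n _ h] := Fx U (open_nbhs_nbhs (conj Uo Ux)).
by exists n.
Qed.

Lemma measurable_vilenkin_coord k (a : 'Z_(m k)) : measurable [set x : G | x k = a].
Proof. by apply: sub_sigma_algebra; exact: open_vilenkin_coord. Qed.

(** An open set is a countable union of cosets of the I_n with centers [vnat i], and membership in a
    coset is decided by finitely many coordinates. *)
Lemma measurable_fun_vilenkin d (T : measurableType d) (phi : T -> G) :
  (forall k a, measurable [set t | phi t k = a]) -> measurable_fun setT phi.
Proof.
move=> h.
have hn n c : measurable [set t | vcyl n (phi t - c)].
  elim: n => [|n IH].
    by rewrite [X in measurable X](_ : _ = setT)//; apply/seteqP; split.
  rewrite [X in measurable X](_ : _ = [set t | vcyl n (phi t - c)] `&` [set t | phi t n = c n]).
    exact: measurableI.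
  apply/seteqP; split=> t /=.
    move=> H; split; first exact: le_vcyl H.
    by have := H n (ltnSn n); rewrite vsubE => /eqP; rewrite subr_eq0 => /eqP.
  move=> [H1 H2] k; rewrite ltnS leq_eqVlt => /predU1P[->|]; last exact: H1.
  by rewrite vsubE H2 subrr.
apply: (measurability (@open G)) => //.
move=> _ [U Uo <-]; rewrite setTI.
rewrite [X in measurable X](_ : _ = \bigcup_n \bigcup_(i in [set i | forall y : G, vcyl n (y - vnat i) -> U y])
   [set t | vcyl n (phi t - vnat i)]).
  by apply: bigcupT_measurable => n; apply: bigcup_measurable.
apply/seteqP; split=> [t /= Ut|t [n _ [i /= H ht]]]; last exact: H.
have [n hU] := open_vilenkin_cyl _ _ Uo Ut.
exists n => //; exists (vcode n (phi t)); last exact: vcyl_vcode.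
move=> y hy /=; apply: hU; rewrite -[y](subrK (vnat (vcode n (phi t)))) -addrA.
by apply: vcylD => //; rewrite -opprB; apply: vcylN; exact: vcyl_vcode.
Qed.

Lemma measurable_vcyl_shift n (c : G) : measurable [set x : G | vcyl n (x - c)].
Proof.
elim: n => [|n IH].
  by rewrite [X in measurable X](_ : _ = setT)//; apply/seteqP; split.
rewrite [X in measurable X](_ : _ = [set x : G | vcyl n (x - c)] `&` [set x : G | x n = c n]).
  by apply: measurableI => //; exact: measurable_vilenkin_coord.
apply/seteqP; split=> t /=.
  move=> H; split; first exact: le_vcyl H.
  by have := H n (ltnSn n); rewrite vsubE => /eqP; rewrite subr_eq0 => /eqP.
move=> [H1 H2] k; rewrite ltnS leq_eqVlt => /predU1P[->|]; last exact: H1.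
by rewrite vsubE H2 subrr.
Qed.

Lemma measurable_vadd_coord k a (f g : G2 * G2 -> G) :
  measurable_fun setT f -> measurable_fun setT g ->
  measurable [set t | (f t + g t) k = a].
Proof.
move=> mf mg.
rewrite [X in measurable X](_ : _ = \bigcup_(n : nat)
   ((f @^-1` [set x | x k = inZp n]) `&` (g @^-1` [set x | x k = a - inZp n]))).
  apply: bigcupT_measurable => n; apply: measurableI.
    by rewrite -[X in measurable X]setTI; apply: mf => //; exact: measurable_vilenkin_coord.
  by rewrite -[X in measurable X]setTI; apply: mg => //; exact: measurable_vilenkin_coord.
apply/seteqP; split=> [t /= <-|t [n _ /= [h1 h2]]].
  exists (f t k : nat) => //=; split; first by rewrite valZpK.
  by rewrite valZpK -[(f t + g t) k]/(f t k + g t k) addrC addKr.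
by rewrite -[(f t + g t) k]/(f t k + g t k) h1 h2 addrC subrK.
Qed.

(** Tonelli's theorem will need joint measurability of h (z + w) for the product sigma-algebra. A
    coordinate of a sum is decided by countably many cases on the coordinates of the summands. *)
Lemma measurable_fun_vadd : measurable_fun setT (fun t : G2 * G2 => t.1 + t.2).
Proof.
have m1 : measurable_fun setT (fun t : G2 * G2 => t.1) := measurable_fst.
have m2 : measurable_fun setT (fun t : G2 * G2 => t.2) := measurable_snd.
apply: measurable_fun_pair; apply: measurable_fun_vilenkin => k a.
  apply: (measurable_vadd_coord k a (fun t => t.1.1) (fun t => t.2.1)).
    exact: (measurableT_comp measurable_fst m1).
  exact: (measurableT_comp measurable_fst m2).
apply: (measurable_vadd_coord k a (fun t => t.1.2) (fun t => t.2.2)).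
  exact: (measurableT_comp measurable_snd m1).
exact: (measurableT_comp measurable_snd m2).
Qed.

Lemma measurable_fun_vshift (w : G2) : measurable_fun setT (fun z : G2 => w + z).
Proof.
have h : measurable_fun setT (fun z : G2 => (w, z)) := pair1_measurable w.
exact: (measurableT_comp measurable_fun_vadd h).
Qed.

Definition vperiodic2 {T : Type} (n : nat) (g : G2 -> T) :=
  forall z w, vcyl n w.1 -> vcyl n w.2 -> g (z + w) = g z.

Definition vnat2 (i j : nat) : G2 := (vnat i, vnat j).

Definition vcoset2 n (c : G2) : set G2 :=
  [set z | vcyl n (z.1 - c.1) /\ vcyl n (z.2 - c.2)].

Lemma measurable_vcoset2 n c : measurable (vcoset2 n c).
Proof.
rewrite [X in measurable X](_ : _ =
  [set x : G | vcyl n (x - c.1)] `*` [set x : G | vcyl n (x - c.2)]).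
  by apply: measurableX; exact: measurable_vcyl_shift.
by apply/seteqP; split.
Qed.

Lemma vperiodic2_coset {T : Type} n (g : G2 -> T) z c :
  vperiodic2 n g -> vcoset2 n c z -> g z = g c.
Proof. by move=> gn [h1 h2]; rewrite -(gn c (z - c)) // addrC subrK. Qed.

Lemma vcoset2_vcode n z : vcoset2 n (vnat2 (vcode n z.1) (vcode n z.2)) z.
Proof. by split; exact: vcyl_vcode. Qed.

(** Every preimage is a union of cosets, taken from the countable family of those centered at the
    [vnat2 i j]. *)
Lemma measurable_vperiodic2 d (T : measurableType d) n (g : G2 -> T) :
  vperiodic2 n g -> measurable_fun setT g.
Proof.
move=> gn _ S mS; rewrite setTI.
rewrite [X in measurable X](_ : _ = \bigcup_i \bigcup_(j in [set j | S (g (vnat2 i j))])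
   vcoset2 n (vnat2 i j)).
  by apply: bigcupT_measurable => i; apply: bigcup_measurable => j _; exact: measurable_vcoset2.
apply/seteqP; split=> [z /= Sz|z [i _ [j /= H hz]]].
  exists (vcode n z.1) => //; exists (vcode n z.2); last exact: vcoset2_vcode.
  by rewrite /= -(vperiodic2_coset _ _ z _ gn)//; exact: vcoset2_vcode.
by rewrite /preimage /= (vperiodic2_coset _ _ _ _ gn hz).
Qed.

Lemma compact_vilenkin2 : compact [set: G2].
Proof.
have cG : compact [set: G].
  have cZ k : compact [set: discrete_topology 'Z_(m k)].
    by apply: finite_compact; exact: (@finite_finset 'Z_(m k)).
  suff -> : [set: G] = [set f : forall k, discrete_topology 'Z_(m k) |
      forall k, [set: discrete_topology 'Z_(m k)] (f k)] by exact: tychonoff cZ.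
  by apply/seteqP; split.
by rewrite -setXTT; exact: compact_setX.
Qed.

Definition vtrunc n (z : G2) : G2 := vnat2 (vcode n z.1) (vcode n z.2).

Lemma cvg_vtrunc z : vtrunc n z @[n --> \oo] --> z.
Proof.
have h x : vnat (vcode n x) @[n --> \oo] --> (x : G).
  apply: vilenkin_cvg => k; exists k.+1 => // n /= kn.
  have := vcyl_vcode m_ge2 n x k kn; rewrite vsubE => /eqP.
  by rewrite subr_eq0 => /eqP.
by case: z => x y; exact: (cvg_pair (h x) (h y)).
Qed.

Lemma vcode_coset n (x y : G) : vcyl n (x - y) -> vcode n x = vcode n y.
Proof.
elim: n => //= n IH h; rewrite IH; last exact: le_vcyl h.
have := h n (ltnSn n); rewrite vsubE => /eqP; rewrite subr_eq0 => /eqP.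
by move=> ->.
Qed.

Lemma vtrunc_periodic n : vperiodic2 n (vtrunc n).
Proof.
move=> z w h1 h2; rewrite /vtrunc (vcode_coset n (z + w).1 z.1).
  rewrite (vcode_coset n (z + w).2 z.2)//.
  by rewrite -[(z + w).2]/(z.2 + w.2) addrC addKr.
by rewrite -[(z + w).1]/(z.1 + w.1) addrC addKr.
Qed.

(** The function is the pointwise limit of its compositions with [vtrunc], which are constant on
    cosets. This works directly with the product sigma-algebra instead of identifying it with the
    Borel one. *)
Lemma continuous_measurable {R : realType} (g : G2 -> R) :
  continuous g -> measurable_fun setT g.
Proof.
move=> cg; apply: (measurable_realfun.measurable_fun_cvg (h := fun n => g \o vtrunc n)).
  move=> n; apply: (measurable_vperiodic2 _ _ n) => z w h1 h2 /=.
  by rewrite vtrunc_periodic.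
move=> z _; apply: (cvg_comp (fun n => vtrunc n z) g (cvg_vtrunc z)).
exact: cg.
Qed.

Lemma continuous_bounded {R : realType} (g : G2 -> R) :
  continuous g -> exists K, forall z, `|g z| <= K.
Proof.
move=> cg.
have := @continuous_compact _ _ g [set: G2].
move=> /(_ _ compact_vilenkin2) cpt.
have /compact_bounded [K [Kr H]] : compact (g @` [set: G2]).
  by apply: cpt; apply: continuous_subspaceT.
exists (K + 1) => z; apply: (H (K + 1)); first by rewrite ltrDl.
by exists z.
Qed.

End VilenkinTopology.

(** * Translation-invariant integration of complex functions *)

Section HaarIntegral.
Context {R : realType} {m : nat -> nat} (m_ge2 : forall k, (2 <= m k)%N).
Local Notation M := (vpow m).
Local Notation G := (vilenkin m).
Local Notation G2 := (G * G)%type.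
Context (mu : probability G2 R) (mu_haar : haar mu).

(** [haar] speaks of images, whereas the pushforward measure needs preimages: the preimage under
    translation by w is the image under translation by -w. *)
Lemma haar_preimage (A : set G2) w : measurable A -> mu ((fun z => w + z) @^-1` A) = mu A.
Proof.
move=> mA; rewrite -[RHS](mu_haar A (- w) mA); congr (mu _).
apply/seteqP; split=> [z /= Az|_ [z Az <-]]; last by rewrite /preimage /= addNKr.
by exists (w + z) => //; rewrite addKr.
Qed.

Lemma ge0_integral_shift (f : G2 -> \bar R) w : measurable_fun setT f ->
  (forall z, (0 <= f z)%E) -> (\int[mu]_z f (w + z)%R = \int[mu]_z f z)%E.
Proof.
move=> mf f0.
have h := ge0_integral_pushforward (measurable_fun_vshift m_ge2 w) mu measurableT mf
  (fun z _ => f0 z).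
rewrite preimage_setT in h; rewrite -[LHS]h.
apply: eq_measure_integral => [|mw A mA _]; first exact: measurable_fun_vshift.
exact: (haar_preimage A w mA).
Qed.

Lemma integral_shift (f : G2 -> \bar R) w : measurable_fun setT f ->
  (\int[mu]_z f (w + z)%R = \int[mu]_z f z)%E.
Proof.
move=> mf; rewrite integralE [in RHS]integralE.
rewrite -(ge0_integral_shift (f^\+)%E w)//; last exact: measurable_funepos.
rewrite -(ge0_integral_shift (f^\-)%E w)//; last exact: measurable_funeneg.
by congr (_ - _)%E; apply: eq_integral => z _; rewrite ?funeposE ?funenegE.
Qed.

Implicit Types f g : G2 -> R[i].

Definition cmeasurable f := measurable_fun setT (fun z => complex.Re (f z)) /\
  measurable_fun setT (fun z => complex.Im (f z)).

Definition cintegrable f := mu.-integrable setT (EFin \o (fun z => complex.Re (f z))) /\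
  mu.-integrable setT (EFin \o (fun z => complex.Im (f z))).

Lemma cintegral_shift f w : cmeasurable f ->
  cintegral mu (fun z => f (w + z)) = cintegral mu f.
Proof.
move=> [mr mi]; rewrite /cintegral /Rintegral; congr (Complex (fine _) (fine _)).
  by apply: (integral_shift (fun z => (complex.Re (f z))%:E)); exact/measurable_EFinP.
by apply: (integral_shift (fun z => (complex.Im (f z))%:E)); exact/measurable_EFinP.
Qed.

Lemma cmeasurable_integrable f : cintegrable f -> cmeasurable f.
Proof.
by move=> [ir ii]; split; apply/measurable_EFinP; [exact: measurable_int ir|exact: measurable_int ii].
Qed.

Lemma cmeasurableD f g : cmeasurable f -> cmeasurable g -> cmeasurable (fun z => f z + g z).
Proof.
move=> [fr fi] [gr gi]; split.
  rewrite (_ : (fun z => _) = (fun z => complex.Re (f z)) \+ (fun z => complex.Re (g z))).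
    exact: measurable_funD.
  by apply/funext => z /=; case: (f z); case: (g z).
rewrite (_ : (fun z => _) = (fun z => complex.Im (f z)) \+ (fun z => complex.Im (g z))).
  exact: measurable_funD.
by apply/funext => z /=; case: (f z); case: (g z).
Qed.

Lemma cmeasurableZ (c : R[i]) f : cmeasurable f -> cmeasurable (fun z => c * f z).
Proof.
case: c => a b [fr fi]; split.
  rewrite (_ : (fun z => _) = (cst a \* (fun z => complex.Re (f z))) \- (cst b \* (fun z => complex.Im (f z)))).
    by apply: measurable_funB; exact: measurable_funM.
  by apply/funext => z /=; case: (f z).
rewrite (_ : (fun z => _) = (cst a \* (fun z => complex.Im (f z))) \+ (cst b \* (fun z => complex.Re (f z)))).
  by apply: measurable_funD; exact: measurable_funM.
by apply/funext => z /=; case: (f z).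
Qed.

Lemma cmeasurableB f g : cmeasurable f -> cmeasurable g -> cmeasurable (fun z => f z - g z).
Proof.
move=> mf mg; have := cmeasurableD _ _ mf (cmeasurableZ (-1) _ mg).
by rewrite (_ : (fun z => f z + -1 * g z) = (fun z => f z - g z))//; apply/funext => z; rewrite mulN1r.
Qed.

Lemma cmeasurable_shift f w : cmeasurable f -> cmeasurable (fun z => f (w + z)).
Proof.
move=> [fr fi]; split.
  exact: (measurableT_comp fr (measurable_fun_vshift m_ge2 w)).
exact: (measurableT_comp fi (measurable_fun_vshift m_ge2 w)).
Qed.

Lemma cmeasurable_normc f : cmeasurable f -> measurable_fun setT (fun z => Normc.normc (f z)).
Proof.
move=> [fr fi].
rewrite (_ : (fun z => _) = Num.sqrt \o ((fun z => complex.Re (f z) ^+ 2) \+ (fun z => complex.Im (f z) ^+ 2))).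
  apply: (measurableT_comp (continuous_measurable_fun (@sqrt_continuous R))).
  by apply: measurable_funD; exact: measurable_funX.
by apply/funext => z /=; case: (f z).
Qed.

Lemma vperiodic2_bounded n (g : G2 -> R) : vperiodic2 n g -> [bounded g z | z in [set: G2]].
Proof.
move=> gn.
exists (\sum_(i < M n) \sum_(j < M n) `|g (vnat2 i j)|); split; first exact: num_real.
move=> K gK z _ /=; apply: le_trans (ltW gK).
rewrite (vperiodic2_coset n g z (vnat2 (vcode n z.1) (vcode n z.2)))//; last first.
  exact: vcoset2_vcode.
rewrite (bigD1 (Ordinal (vcode_lt m_ge2 n z.1)))//= (bigD1 (Ordinal (vcode_lt m_ge2 n z.2)))//=.
by rewrite -addrA lerDl addr_ge0// ?sumr_ge0// => i _; rewrite sumr_ge0.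
Qed.

Lemma vperiodic2_cmeasurable n g : vperiodic2 n g -> cmeasurable g.
Proof.
by move=> gn; split; apply: (measurable_vperiodic2 m_ge2 _ _ n) => z w h1 h2; rewrite gn.
Qed.

Lemma vperiodic2_cintegrable n g : vperiodic2 n g -> cintegrable g.
Proof.
move=> gn; have [mr mi] := vperiodic2_cmeasurable n g gn.
have fin : (mu [set: G2] < +oo)%E by rewrite probability_setT ltry.
by split; apply: measurable_bounded_integrable => //; apply: (vperiodic2_bounded n) => z w h1 h2; rewrite gn.
Qed.

Lemma cintegrableD f g : cintegrable f -> cintegrable g -> cintegrable (fun z => f z + g z).
Proof.
move=> [fr fi] [gr gi]; split.
  have := integrableD measurableT fr gr; congr (mu.-integrable _ _).
  by apply/funext => z /=; rewrite -EFinD; case: (f z); case: (g z).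
have := integrableD measurableT fi gi; congr (mu.-integrable _ _).
by apply/funext => z /=; rewrite -EFinD; case: (f z); case: (g z).
Qed.

Lemma cintegrableM n f g : cintegrable f -> vperiodic2 n g -> cintegrable (fun z => f z * g z).
Proof.
move=> [fr fi] gn; have [mr mi] := vperiodic2_cmeasurable n g gn.
have br : [bounded complex.Re (g z) | z in [set: G2]].
  by apply: (vperiodic2_bounded n) => z w h1 h2; rewrite gn.
have bi : [bounded complex.Im (g z) | z in [set: G2]].
  by apply: (vperiodic2_bounded n) => z w h1 h2; rewrite gn.
split.
  have := integrableB measurableT (integrableMl measurableT fr mr br) (integrableMl measurableT fi mi bi).
  congr (mu.-integrable _ _); apply/funext => z /=.
  by rewrite -!EFinM -EFinB; case: (f z); case: (g z).
have := integrableD measurableT (integrableMl measurableT fr mi bi) (integrableMl measurableT fi mr br).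
congr (mu.-integrable _ _); apply/funext => z /=.
by rewrite -!EFinM -EFinD; case: (f z); case: (g z) => a b c d.
Qed.

Lemma vperiodic2_cst n (c : R[i]) : vperiodic2 n (fun _ : G2 => c).
Proof. by []. Qed.

Lemma cintegralD f g : cintegrable f -> cintegrable g ->
  cintegral mu (fun z => f z + g z) = cintegral mu f + cintegral mu g.
Proof.
move=> [fr fi] [gr gi]; rewrite /cintegral.
rewrite -[RHS]/(Complex (_ + _) (_ + _)) -!RintegralD//.
by congr (Complex _ _); apply: eq_Rintegral => z _; case: (f z); case: (g z).
Qed.

Lemma cintegralM (c : R[i]) f : cintegrable f ->
  cintegral mu (fun z => f z * c) = cintegral mu f * c.
Proof.
case: c => a b [fr fi]; rewrite /cintegral.
transitivity (Complex (\int[mu]_(z in setT) (a * complex.Re (f z) + (- b) * complex.Im (f z)))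
   (\int[mu]_(z in setT) (b * complex.Re (f z) + a * complex.Im (f z))))%R.
  congr (Complex _ _); apply: eq_Rintegral => z _; case: (f z) => x y /=.
    by rewrite mulNr [a * x]mulrC [b * y]mulrC.
  by rewrite [b * x]mulrC [a * y]mulrC.
have iZ r (h : G2 -> R) : mu.-integrable setT (EFin \o h) ->
    mu.-integrable setT (EFin \o (fun z => r * h z)).
  by move=> ih; have := integrableZl measurableT r ih; congr (mu.-integrable _ _).
rewrite !RintegralD ?RintegralZl//; try exact: iZ.
by congr (Complex _ _) => /=; ring.
Qed.

Lemma cintegrable_sum (I : Type) (s : seq I) (F : I -> G2 -> R[i]) :
  (forall i, cintegrable (F i)) -> cintegrable (fun z => \sum_(i <- s) F i z).
Proof.
move=> iF; elim: s => [|i s IH].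
  rewrite (_ : (fun z => _) = fun=> 0); first exact: (vperiodic2_cintegrable 0).
  by apply/funext => z; rewrite big_nil.
rewrite (_ : (fun z => _) = fun z => F i z + \sum_(i <- s) F i z).
  exact: cintegrableD.
by apply/funext => z; rewrite big_cons.
Qed.

Lemma cintegral_sum (I : Type) (s : seq I) (F : I -> G2 -> R[i]) :
  (forall i, cintegrable (F i)) ->
  cintegral mu (fun z => \sum_(i <- s) F i z) = \sum_(i <- s) cintegral mu (F i).
Proof.
move=> iF; elim: s => [|i s IH].
  rewrite (_ : (fun z => _) = fun=> 0); last by apply/funext => z; rewrite big_nil.
  have h := cintegralM 0 (fun=> 0) (vperiodic2_cintegrable 0 _ (vperiodic2_cst 0 0)).
  rewrite big_nil -[RHS](mulr0 (cintegral mu (fun=> 0))) -h.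
  by congr cintegral; apply/funext => z; rewrite mulr0.
rewrite big_cons (_ : (fun z => _) = fun z => F i z + \sum_(i <- s) F i z); last first.
  by apply/funext => z; rewrite big_cons.
by rewrite cintegralD ?IH//; exact: cintegrable_sum.
Qed.

Definition vind n (c z : G2) : R[i] := if `[< vcoset2 n c z >] then 1 else 0.

Lemma vind_periodic n c : vperiodic2 n (vind n c).
Proof.
move=> z w h1 h2; rewrite /vind; congr (if _ then _ else _).
apply/asboolP/asboolP => -[H1 H2]; split.
- have := vcylB _ _ _ H1 h1; rewrite -[(z + w).1]/(z.1 + w.1).
  by rewrite addrAC addrK.
- have := vcylB _ _ _ H2 h2; rewrite -[(z + w).2]/(z.2 + w.2).
  by rewrite addrAC addrK.
- by have := vcylD _ _ _ H1 h1; rewrite addrAC.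
- by have := vcylD _ _ _ H2 h2; rewrite addrAC.
Qed.

Lemma vind_coset n c c' z : vcoset2 n c c' -> vind n c z = vind n c' z.
Proof.
move=> [h1 h2]; rewrite /vind; congr (if _ then _ else _).
apply/asboolP/asboolP => -[H1 H2]; split.
- by have := vcylB _ _ _ H1 h1; rewrite opprB addrA subrK.
- by have := vcylB _ _ _ H2 h2; rewrite opprB addrA subrK.
- by have := vcylD _ _ _ H1 h1; rewrite addrA subrK.
- by have := vcylD _ _ _ H2 h2; rewrite addrA subrK.
Qed.

Lemma vcoset2_vnat n (i j k l : 'I_(M n)) :
  `[< vcoset2 n (vnat2 i j : G2) (vnat2 k l) >] = (k == i) && (l == j).
Proof.
apply/asboolP/andP => [[/=]|[/eqP -> /eqP ->]]; last first.
  by split; rewrite subrr; exact: vcyl0.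
by move=> /(vcyl_sub_vnat m_ge2) h1 /(vcyl_sub_vnat m_ge2) h2; split;
  apply/eqP/val_inj; move: h1 h2; rewrite !modn_small.
Qed.

Lemma vind_partition n (h : G2 -> R[i]) z : vperiodic2 n h ->
  h z = \sum_(i < M n) \sum_(j < M n) vind n (vnat2 i j) z * h (vnat2 i j).
Proof.
move=> hn.
have [k kE] : exists k : 'I_(M n), vcode n z.1 = k :> nat.
  by exists (Ordinal (vcode_lt m_ge2 n z.1)).
have [l lE] : exists l : 'I_(M n), vcode n z.2 = l :> nat.
  by exists (Ordinal (vcode_lt m_ge2 n z.2)).
have hz := vcoset2_vcode m_ge2 n z; rewrite kE lE in hz.
have E (i j : 'I_(M n)) : vind n (vnat2 i j) z = if (k == i) && (l == j) then 1 else 0.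
  rewrite (vperiodic2_coset n _ z (vnat2 k l) (vind_periodic n _))//.
  by rewrite /vind vcoset2_vnat.
rewrite (bigD1 k)//= (bigD1 l)//= E !eqxx mul1r.
rewrite big1 ?addr0 => [|j jl]; last by rewrite E eqxx eq_sym (negbTE jl) mul0r.
rewrite big1 ?addr0 => [|i ik]; first exact: (vperiodic2_coset n).
by apply: big1 => j _; rewrite E eq_sym (negbTE ik) mul0r.
Qed.

Lemma cintegral_vperiodic2 n f g : cintegrable f -> vperiodic2 n g ->
  cintegral mu (fun z => f z * g z) = \sum_(i < M n) \sum_(j < M n)
     cintegral mu (fun z => f z * vind n (vnat2 i j) z) * g (vnat2 i j).
Proof.
move=> fi gn.
rewrite (_ : (fun z => _) = fun z => \sum_(i < M n) \sum_(j < M n)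
    (f z * vind n (vnat2 i j) z) * g (vnat2 i j)); last first.
  apply/funext => z; rewrite (vind_partition n g z gn) mulr_sumr; apply: eq_bigr => i _.
  by rewrite mulr_sumr; apply: eq_bigr => j _; rewrite mulrA.
have ii (i j : nat) : cintegrable (fun z => (f z * vind n (vnat2 i j) z) * g (vnat2 i j)).
  apply: (cintegrableM n); last by [].
  by apply: (cintegrableM n) => //; exact: vind_periodic.
rewrite (cintegral_sum _ _ (fun (i : 'I_(M n)) z => \sum_(j < M n)
    (f z * vind n (vnat2 i j) z) * g (vnat2 i j))); last first.
  by move=> i; apply: (cintegrable_sum _ _ (fun (j : 'I_(M n)) z =>
    (f z * vind n (vnat2 i j) z) * g (vnat2 i j))) => j.
apply: eq_bigr => i _.
rewrite (cintegral_sum _ _ (fun (j : 'I_(M n)) z => (f z * vind n (vnat2 i j) z) * g (vnat2 i j)))//.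
apply: eq_bigr => j _; rewrite cintegralM//.
by apply: (cintegrableM n) => //; exact: vind_periodic.
Qed.

Lemma cintegral1 : cintegral mu (fun=> 1) = 1.
Proof.
rewrite /cintegral /= !Rintegral_cst//.
rewrite (_ : fine _ = 1); last exact: (congr1 fine (probability_setT mu)).
by rewrite mul1r mul0r.
Qed.

(** All cosets have the same integral by translation invariance, and the M_n^2 of them partition a
    group of measure 1. *)
Lemma cintegral_vind n c : cintegral mu (vind n c) = ((M n)%:R * (M n)%:R)^-1.
Proof.
have E d : cintegral mu (vind n d) = cintegral mu (vind n 0).
  rewrite -(cintegral_shift (vind n d) d); last exact: vperiodic2_cmeasurable (vind_periodic n d).
  congr cintegral; apply/funext => z; rewrite /vind; congr (if _ then _ else _).
  by apply/asboolP/asboolP => -[]; rewrite /vcoset2 /= !subr0 ![_ + _ - _]addrAC !subrr !add0r.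
have := cintegral_vperiodic2 n (fun=> 1) (fun=> 1)
  (vperiodic2_cintegrable 0 _ (vperiodic2_cst 0 1)) (vperiodic2_cst n 1).
rewrite (_ : (fun=> 1 * 1) = fun=> 1); last by apply/funext => z; rewrite mulr1.
rewrite cintegral1 (eq_bigr (fun=> \sum_(j < M n) cintegral mu (vind n 0))) => [|i _]; last first.
  apply: eq_bigr => j _; rewrite mulr1 -(E (vnat2 i j)); congr cintegral.
  by apply/funext => z; rewrite mul1r.
rewrite E !sumr_const !card_ord -mulrnA -[X in _ = X -> _]mulr_natl natrM => /esym h.
have MN : (M n)%:R * (M n)%:R != 0 :> R[i].
  by rewrite -natrM pnatr_eq0 muln_eq0 negb_or -!lt0n !(vpow_gt0 m_ge2).
by apply: (mulfI MN); rewrite h mulfV.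
Qed.

End HaarIntegral.

(** * Coset averages, Fourier coefficients, and the mean as a finite convolution *)

Section CesaroMeanPeriodic.
Context {R : realType} {m : nat -> nat} (m_ge2 : forall k, (2 <= m k)%N).
Local Notation M := (vpow m).
Local Notation G := (vilenkin m).
Local Notation G2 := (G * G)%type.
Local Notation psi := (@vpsi R m).
Context (mu : probability G2 R) (mu_haar : haar mu).
Implicit Types f g : G2 -> R[i].

(** The conditional expectation E_n f: the integral over the coset of z, divided by its measure
    M_n^(-2). *)
Definition vavg n f : G2 -> R[i] := fun z =>
  (M n)%:R * (M n)%:R * cintegral mu (fun y => f y * vind n z y).

Lemma le_vperiodic2 {T : Type} n n' (g : G2 -> T) : (n <= n')%N ->
  vperiodic2 n g -> vperiodic2 n' g.
Proof. by move=> nn' gn z w h1 h2; apply: gn; exact: le_vcyl nn' _ _. Qed.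

Lemma vavg_periodic n f : vperiodic2 n (vavg n f).
Proof.
move=> z w h1 h2; rewrite /vavg; congr (_ * cintegral mu _).
apply/funext => y; congr (_ * _); apply/esym/vind_coset; split.
  by rewrite -[(z + w).1]/(z.1 + w.1) addrC addKr.
by rewrite -[(z + w).2]/(z.2 + w.2) addrC addKr.
Qed.

Lemma natr_vpow_neq0 n : (M n)%:R * (M n)%:R != 0 :> R[i].
Proof. by rewrite -natrM pnatr_eq0 muln_eq0 negb_or -!lt0n !(vpow_gt0 m_ge2). Qed.

Lemma cintegral_mul_vind n g c : vperiodic2 n g ->
  cintegral mu (fun z => g z * vind n c z) = g c / ((M n)%:R * (M n)%:R).
Proof.
move=> gn; rewrite -(cintegral_vind m_ge2 mu mu_haar n c) mulrC.
rewrite -(cintegralM mu); last exact: vperiodic2_cintegrable (vind_periodic n c).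
congr cintegral; apply/funext => z; rewrite /vind.
case: asboolP => [h|]; last by rewrite mulr0 mul0r.
by rewrite mulr1 mul1r; exact: (vperiodic2_coset n).
Qed.

Lemma cintegral_vavg_vind n f c :
  cintegral mu (fun z => vavg n f z * vind n c z) = cintegral mu (fun z => f z * vind n c z).
Proof.
rewrite cintegral_mul_vind; last exact: vavg_periodic.
by rewrite /vavg mulrC mulKf ?natr_vpow_neq0.
Qed.

Definition vpsi2c i j (z : G2) : R[i] := conjc (psi i z.1) * conjc (psi j z.2).

Lemma vpsi2c_periodic n i j : (i < M n)%N -> (j < M n)%N -> vperiodic2 n (vpsi2c i j).
Proof.
move=> hi hj z w h1 h2; rewrite /vpsi2c.
rewrite -[(z + w).1]/(z.1 + w.1) -[(z + w).2]/(z.2 + w.2).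
by rewrite !(vpsi_periodic m_ge2 _ n).
Qed.

Lemma fourier_coefE f i j : fourier_coef mu f i j = cintegral mu (fun z => f z * vpsi2c i j z).
Proof. by rewrite /fourier_coef; congr cintegral; apply/funext => z; rewrite -mulrA. Qed.

Lemma fourier_coef_sum n f i j : cintegrable mu f -> (i < M n)%N -> (j < M n)%N ->
  fourier_coef mu f i j = \sum_(c < M n) \sum_(d < M n)
    cintegral mu (fun z => f z * vind n (vnat2 c d) z) * vpsi2c i j (vnat2 c d).
Proof.
move=> fi hi hj; rewrite fourier_coefE.
exact: (cintegral_vperiodic2 m_ge2 mu n f _ fi (vpsi2c_periodic n i j hi hj)).
Qed.

(** Characters of index below M_n are constant on cosets, so the coefficient depends only on the
    integrals over cosets, which averaging preserves. *)
Lemma fourier_coef_vavg n f i j : cintegrable mu f -> (i < M n)%N -> (j < M n)%N ->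
  fourier_coef mu (vavg n f) i j = fourier_coef mu f i j.
Proof.
move=> fi hi hj; rewrite !(fourier_coef_sum n)//; last first.
  exact: (vperiodic2_cintegrable m_ge2 mu n _ (vavg_periodic n f)).
by apply: eq_bigr => c _; apply: eq_bigr => d _; rewrite cintegral_vavg_vind.
Qed.

(** Translation by w preserves the integral but multiplies the integrand by the conjugate character
    at w, which is not 1. *)
Lemma fourier_coef_eq0 n g i j (w : G2) : vperiodic2 n g ->
  vcyl n w.1 -> vcyl n w.2 -> vpsi2c i j w != 1 -> fourier_coef mu g i j = 0.
Proof.
move=> gn w1 w2 hw; rewrite fourier_coefE; set F := fun z => _.
(* K exceeds the level of g and resolves both frequencies, so the integrand is constant on cosets of
   level K and therefore integrable. *)
have [K [nK hi hj]] : exists K, [/\ (n <= K)%N, (i < M K)%N & (j < M K)%N].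
  exists (n + i + j)%N; have hK := ltn_vpow m_ge2 (n + i + j).
  by split; [|apply: leq_ltn_trans hK|apply: leq_ltn_trans hK]; lia.
have gK := le_vperiodic2 n K g nK gn.
have FK : vperiodic2 K F.
  move=> z v h1 h2; rewrite /F (gK z v h1 h2); congr (_ * _).
  exact: (vpsi2c_periodic K i j hi hj z v h1 h2).
have Fi : cintegrable mu F := vperiodic2_cintegrable m_ge2 mu K F FK.
have FE : (fun z => F (w + z)) = (fun z => F z * vpsi2c i j w).
  apply/funext => z.
  have -> : F (w + z) = g (z + w) * vpsi2c i j (z + w) by rewrite /F addrC.
  rewrite (gn z w w1 w2) -[RHS]mulrA; congr (_ * _); rewrite /vpsi2c.
  rewrite -[(z + w).1]/(z.1 + w.1) -[(z + w).2]/(z.2 + w.2) !(vpsiD m_ge2) !rmorphM.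
  by rewrite mulrACA.
have E : cintegral mu F = cintegral mu F * vpsi2c i j w.
  rewrite -(cintegralM mu _ _ Fi) -FE.
  exact/esym/(cintegral_shift m_ge2 mu mu_haar F w (cmeasurable_integrable mu F Fi)).
have : cintegral mu F * (vpsi2c i j w - 1) == 0 by rewrite mulrBr -E mulr1 subrr.
by rewrite mulf_eq0 subr_eq0 (negbTE hw) orbF => /eqP.
Qed.

Lemma conjc_eq1 (x : R[i]) : (conjc x == 1) = (x == 1).
Proof. by rewrite -[X in _ == X]conjc1 (inj_eq (can_inj (@conjcK R))). Qed.

Lemma fourier_coef_periodic_l n g i j : vperiodic2 n g -> (M n <= i)%N ->
  fourier_coef mu g i j = 0.
Proof.
move=> gn /(exists_vpsi_neq1 (R := R) m_ge2)[u un pu].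
apply: (fourier_coef_eq0 n _ _ _ (u, 0)) => //.
by rewrite /vpsi2c /= (vpsi_at0 m_ge2) conjc1 mulr1 conjc_eq1.
Qed.

Lemma fourier_coef_periodic_r n g i j : vperiodic2 n g -> (M n <= j)%N ->
  fourier_coef mu g i j = 0.
Proof.
move=> gn /(exists_vpsi_neq1 (R := R) m_ge2)[u un pu].
apply: (fourier_coef_eq0 n _ _ _ (0, u)) => //.
by rewrite /vpsi2c /= (vpsi_at0 m_ge2) conjc1 mul1r conjc_eq1.
Qed.

Lemma fourier_coefD f g i j : cintegrable mu f -> cintegrable mu g ->
  fourier_coef mu (fun z => f z + g z) i j = fourier_coef mu f i j + fourier_coef mu g i j.
Proof.
move=> fi gi; rewrite !fourier_coefE.
have [K hi hj] : exists2 K, (i < M K)%N & (j < M K)%N.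
  exists (i + j)%N; have hK := ltn_vpow m_ge2 (i + j);
  by apply: leq_ltn_trans hK; lia.
have pK := vpsi2c_periodic K i j hi hj.
rewrite -(cintegralD mu _ _ (cintegrableM m_ge2 mu K _ _ fi pK) (cintegrableM m_ge2 mu K _ _ gi pK)).
by congr cintegral; apply/funext => z; rewrite mulrDl.
Qed.

Lemma cesaro_meanD (a b : R) n k f g : cintegrable mu f -> cintegrable mu g ->
  cesaro_mean mu a b n k (fun z => f z + g z) =
  (fun z => cesaro_mean mu a b n k f z + cesaro_mean mu a b n k g z).
Proof.
move=> fi gi; apply/funext => z; rewrite /cesaro_mean -mulrDr -big_split/=.
congr (_ * _); apply: eq_bigr => i _; rewrite -big_split/=; apply: eq_bigr => j _.
by rewrite fourier_coefD// mulrDr !mulrDl.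
Qed.

Lemma cesaro_mean_vavg (a b : R) l n k f : cintegrable mu f ->
  (n < M l)%N -> (k < M l)%N ->
  cesaro_mean mu a b n k (vavg l f) = cesaro_mean mu a b n k f.
Proof.
move=> fi nl kl; apply/funext => z; rewrite /cesaro_mean; congr (_ * _).
apply: eq_bigr => i _; apply: eq_bigr => j _; rewrite fourier_coef_vavg//.
  by rewrite (leq_ltn_trans _ nl)// -ltnS.
by rewrite (leq_ltn_trans _ kl)// -ltnS.
Qed.

Lemma sum_ord_minn (V : nmodType) (F : nat -> V) N L :
  (forall i, (L <= i)%N -> F i = 0) -> \sum_(i < N) F i = \sum_(i < minn N L) F i.
Proof.
move=> FL; have [NL|LN] := leqP N L; first by [].
rewrite -(subnKC (ltnW LN)) big_split_ord/= [X in _ + X]big1 ?addr0//.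
by move=> i _; rewrite FL// leq_addr.
Qed.

Let cesaro_rearrange1 (K : comPzRingType) (x y p1 p2 q1 q2 : K) :
  x * y * (p1 * q1) * (p2 * q2) = y * (x * (p2 * p1 * (q2 * q1))).
Proof. by ring. Qed.

Let cesaro_rearrange2 (K : comPzRingType) (a' b' a b x p q : K) :
  a' * b' * (a * b * x * p * q) = a * a' * (b * b') * (x * (p * q)).
Proof. by ring. Qed.

Let cesaro_rearrange3 (K : comPzRingType) (a b y x p q : K) :
  a * b * (y * (x * (p * q))) = y * (x * (a * p * (b * q))).
Proof. by ring. Qed.

Section Convolution.
Context (a b : R) (a01 : 0 < a < 1) (b01 : 0 < b < 1).
Local Notation A := (cesaro_number (- a)).
Local Notation B := (cesaro_number (- b)).

Lemma cesaro_kernel_periodic (c : R) n l :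
  vperiodic l (cesaro_kernel c n l : G -> R[i]).
Proof.
move=> x u ul; apply: eq_bigr => i _; congr (_ * _).
by apply: (vpsi_periodic m_ge2 _ l) => //; exact: leq_trans (ltn_ord i) (geq_minr _ _).
Qed.

(** Frequencies from M_l on drop out, the other coefficients are finite averages, and summing over
    frequencies reassembles a product of two one-dimensional kernels. Writing the mean as a
    combination of translates of g is what lets a translation-invariant norm act on it. *)
Lemma cesaro_mean_periodic n k l g z : vperiodic2 l g ->
  cesaro_mean mu (- a) (- b) n k g z = ((M l)%:R * (M l)%:R)^-1 *
    \sum_(c < M l) \sum_(d < M l)
      cesaro_kernel a n l (vnat c : G) * cesaro_kernel b k l (vnat d : G) *
      g (z - vnat2 c d).
Proof.
move=> gl; have gi := vperiodic2_cintegrable m_ge2 mu l g gl.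
pose N1 := minn n.+1 (M l); pose N2 := minn k.+1 (M l).
have E1 : cesaro_mean mu (- a) (- b) n k g z = (real_complex R (A n * B k))^-1 *
    \sum_(i < N1) \sum_(j < N2) real_complex R (A (n - i) * B (k - j)) *
     fourier_coef mu g i j * psi i z.1 * psi j z.2.
  rewrite /cesaro_mean; congr (_ * _).
  rewrite (sum_ord_minn _ (fun i => \sum_(j < k.+1) real_complex R (A (n - i) * B (k - j)) *
     fourier_coef mu g i j * psi i z.1 * psi j z.2) _ (M l)); last first.
    move=> i li; apply: big1 => j _.
    by rewrite (fourier_coef_periodic_l l)// mulr0 !mul0r.
  apply: eq_bigr => i _.
  apply: (sum_ord_minn _ (fun j => real_complex R (A (n - i) * B (k - j)) *
     fourier_coef mu g i j * psi i z.1 * psi j z.2) _ (M l)) => j lj.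
  by rewrite (fourier_coef_periodic_r l)// mulr0 !mul0r.
have E2 i j : (i < N1)%N -> (j < N2)%N -> fourier_coef mu g i j * (psi i z.1 * psi j z.2) =
    ((M l)%:R * (M l)%:R)^-1 * \sum_(c < M l) \sum_(d < M l)
      g (vnat2 c d) * (psi i (z.1 - vnat c) * psi j (z.2 - vnat d)).
  move=> hi hj; rewrite (fourier_coef_sum l)//; first last.
  - exact: leq_trans hj (geq_minr _ _).
  - exact: leq_trans hi (geq_minr _ _).
  rewrite mulr_suml mulr_sumr; apply: eq_bigr => c _.
  rewrite mulr_suml mulr_sumr; apply: eq_bigr => d _.
  rewrite cintegral_mul_vind// /vpsi2c !(vpsiD m_ge2) !(conjc_vpsi m_ge2) /=.
  exact: cesaro_rearrange1.
rewrite E1.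
transitivity (((M l)%:R * (M l)%:R)^-1 * \sum_(c < M l) \sum_(d < M l)
   g (vnat2 c d) * (cesaro_kernel a n l (z.1 - vnat c) * cesaro_kernel b k l (z.2 - vnat d))).
  transitivity (\sum_(i < N1) \sum_(j < N2) real_complex R (A (n - i) / A n * (B (k - j) / B k)) *
     (fourier_coef mu g i j * (psi i z.1 * psi j z.2))).
    rewrite mulr_sumr; apply: eq_bigr => i _; rewrite mulr_sumr; apply: eq_bigr => j _.
    rewrite -fmorphV invfM !rmorphM; exact: cesaro_rearrange2.
  rewrite mulr_sumr.
  transitivity (\sum_(i < N1) \sum_(j < N2) \sum_(c < M l) \sum_(d < M l)
    ((M l)%:R * (M l)%:R)^-1 * (g (vnat2 c d) *
     ((real_complex R (A (n - i) / A n) * psi i (z.1 - vnat c)) *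
      (real_complex R (B (k - j) / B k) * psi j (z.2 - vnat d))))).
    apply: eq_bigr => i _; apply: eq_bigr => j _; rewrite E2// !mulr_sumr.
    apply: eq_bigr => c _; rewrite !mulr_sumr; apply: eq_bigr => d _.
    rewrite rmorphM; exact: cesaro_rearrange3.
  rewrite (eq_bigr (fun i : 'I_N1 => \sum_(c < M l) \sum_(d < M l) \sum_(j < N2)
    ((M l)%:R * (M l)%:R)^-1 * (g (vnat2 c d) *
     ((real_complex R (A (n - i) / A n) * psi i (z.1 - vnat c)) *
      (real_complex R (B (k - j) / B k) * psi j (z.2 - vnat d)))))) => [|i _]; last first.
    by rewrite exchange_big/=; apply: eq_bigr => c _; rewrite exchange_big.
  rewrite exchange_big/=; apply: eq_bigr => c _.
  rewrite exchange_big/= mulr_sumr; apply: eq_bigr => d _.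
  rewrite /cesaro_kernel -/N1 -/N2 big_distrl/= !mulr_sumr; apply: eq_bigr => i _.
  by rewrite !mulr_sumr; apply: eq_bigr => j _.
congr (_ * _).
(* At this point the kernels are evaluated at differences and g at representatives; reflecting the
   representatives, one variable at a time, exchanges these roles. *)
pose h x y := g (x, y) * (cesaro_kernel a n l (z.1 - x) * cesaro_kernel b k l (z.2 - y)).
have kN (c : R) N (x y u : G) : vcyl l u ->
    cesaro_kernel c N l (x - (y + u)) = cesaro_kernel c N l (x - y).
  move=> ul; rewrite opprD addrA; apply: (cesaro_kernel_periodic c N l (x - y) (- u)).
  exact: vcylN.
transitivity (\sum_(c < M l) \sum_(d < M l) h (vnat c) (vnat d)); first by [].
rewrite -(sum_vnat_reflect m_ge2 _ l (fun x => \sum_(d < M l) h x (vnat d)) z.1); last first.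
  move=> x u ul; apply: eq_bigr => d _; rewrite /h (kN a n z.1 x u ul).
  congr (_ * _); rewrite -(gl (x, vnat d) (u, 0) ul (vcyl0 l)).
  by rewrite -[(x, _) + _]/(x + u, vnat d + 0) addr0.
apply: eq_bigr => c _.
rewrite -(sum_vnat_reflect m_ge2 _ l (fun y => h (z.1 - vnat c) y) z.2); last first.
  move=> x u ul; rewrite /h (kN b k z.2 x u ul).
  congr (_ * _); rewrite -(gl (z.1 - vnat c, x) (0, u) (vcyl0 l) ul).
  by rewrite -[(_, _) + _]/(z.1 - vnat c + 0, x + u) addr0.
by apply: eq_bigr => d _; rewrite /h !subKr [LHS]mulrC.
Qed.

End Convolution.
End CesaroMeanPeriodic.

(** * L^p norms of real functions and Jensen's inequality *)

Section RealNorm.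
Context {d} {T : measurableType d} {R : realType}.
Context (mu : probability T R).
Implicit Types (p : \bar R) (h : T -> R).

(** At +oo this follows the convention of [vnorm], a supremum over all points. Norm inequalities are
    proved for real functions and passed to complex ones through the modulus. *)
Definition rnorm p h : \bar R :=
  if p is +oo%E then ereal_sup [set (`|h z|)%:E | z in [set: T]]
  else Lnorm mu p (EFin \o h).

Lemma rnorm_ge0 p h : (1 <= p)%E -> (0 <= rnorm p h)%E.
Proof.
case: p => [r| |//] _; first exact: Lnorm_ge0.
apply: (@le_trans _ _ (`|h point|)%:E); first by rewrite lee_fin.
by apply: ereal_sup_ubound; exists point.
Qed.

Lemma rnorm_le p h1 h2 : (1 <= p)%E -> measurable_fun setT h1 -> measurable_fun setT h2 ->
  (forall z, `|h1 z| <= `|h2 z|) -> (rnorm p h1 <= rnorm p h2)%E.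
Proof.
case: p => [r| |//] p1 m1 m2 h12 /=.
  rewrite lee_fin in p1; have r0 : 0 < r by exact: lt_le_trans p1.
  rewrite !Lnorm.unlock; apply: gt0_ler_poweR; rewrite ?invr_ge0 ?(ltW r0)//.
  - by rewrite in_itv/= leey andbT integral_ge0// => x _; exact: poweR_ge0.
  - by rewrite in_itv/= leey andbT integral_ge0// => x _; exact: poweR_ge0.
  apply: ge0_le_integral => //.
  - by move=> x _; exact: poweR_ge0.
  - apply/measurable_EFinP/(measurableT_comp (measurable_powR r)).
    exact: (measurableT_comp _ m1).
  - apply/measurable_EFinP/(measurableT_comp (measurable_powR r)).
    exact: (measurableT_comp _ m2).
  by move=> x _; rewrite lee_fin ge0_ler_powR ?nnegrE ?(ltW r0).
apply: ge_ereal_sup => _ [z _ <-]; apply: le_trans (_ : ((`|h2 z|)%:E <= _)%E).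
  by rewrite lee_fin.
by apply: ereal_sup_ubound; exists z.
Qed.

Lemma rnormD p h1 h2 : (1 <= p)%E -> measurable_fun setT h1 -> measurable_fun setT h2 ->
  (rnorm p (fun z => (h1 z + h2 z)%R) <= rnorm p h1 + rnorm p h2)%E.
Proof.
case: p => [r| |//] p1 m1 m2 /=; first exact: (@eminkowski _ _ _ mu h1 h2).
apply: ge_ereal_sup => _ [z _ <-].
apply: (@le_trans _ _ ((`|h1 z|)%:E + (`|h2 z|)%:E)%E).
  by rewrite -EFinD lee_fin ler_normD.
by apply: leeD; apply: ereal_sup_ubound; exists z.
Qed.

Lemma rnormZ p h (c : R) : (1 <= p)%E -> measurable_fun setT h ->
  (rnorm p (fun z => (c * h z)%R) = `|c|%:E * rnorm p h)%E.
Proof.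
case: p => [r| |//] p1 mh /=.
  rewrite lee_fin in p1; have r0 : 0 < r by exact: lt_le_trans p1.
  rewrite !Lnorm.unlock.
  have -> : (\int[mu]_x `|(EFin \o (fun z => (c * h z)%R)) x| `^ r =
     ((`|c| `^ r)%:E * \int[mu]_x `|(EFin \o h) x| `^ r))%E.
    rewrite -ge0_integralZl//.
    - by apply: eq_integral => x _ /=; rewrite normrM powRM.
    - apply/measurable_EFinP/(measurableT_comp (measurable_powR r)).
      exact: (measurableT_comp _ mh).
    - by move=> x _; exact: poweR_ge0.
  rewrite poweRM ?lee_fin ?powR_ge0//; last first.
    by apply: integral_ge0 => x _; exact: poweR_ge0.
  by rewrite poweR_EFin -powRrM mulfV ?gt_eqF// powRr1.
rewrite -ereal_supZl//; last by apply/set0P; exists (`|h point|)%:E; exists point.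
congr ereal_sup; apply/seteqP; split.
  by move=> _ [z _ <-]; exists (`|h z|)%:E; [exists z|rewrite -EFinM normrM].
by move=> _ [_ [z _ <-] <-]; exists z => //; rewrite -EFinM normrM.
Qed.

Lemma rnorm_normr p h : rnorm p (fun z => `|h z|) = rnorm p h.
Proof.
case: p => [r| |] /=.
- exact: (Lnorm_abse mu (EFin \o h) r%:E).
- by congr ereal_sup; apply/seteqP; split=> _ [z _ <-]; exists z => //; rewrite normr_id.
- exact: (Lnorm_abse mu (EFin \o h) -oo%E).
Qed.

(** Young's inequality for t and s^(r-1) with exponents r and r / (r - 1), the latter turning
    s^(r-1) into s^r. *)
Lemma young_tangent (r s t : R) : 1 <= r -> 0 <= s -> 0 <= t ->
  r * s `^ (r - 1) * t <= t `^ r + (r - 1) * s `^ r.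
Proof.
move=> r1 s0 t0; have r0 : 0 < r by exact: lt_le_trans r1.
(* For r = 1 there is no finite conjugate exponent, but the claim reduces to t <= t. *)
move: r1; rewrite le_eqVlt => /predU1P[<-|r1].
  by rewrite subrr powRr0 mul1r mul1r mul0r addr0 powRr1.
have rB : 0 < r - 1 by rewrite subr_gt0.
have q0 : 0 < r / (r - 1) by rewrite divr_gt0.
have := @conjugate_powR R t (s `^ (r - 1)) r (r / (r - 1)) t0 (powR_ge0 _ _) r0 q0.
rewrite -powRrM mulrCA mulfV ?gt_eqF// mulr1.
have -> : r^-1 + (r / (r - 1))^-1 = 1 by field; rewrite !gt_eqF.
move=> /(_ erefl) h.
have -> : r * s `^ (r - 1) * t = r * (t * s `^ (r - 1)) by ring.
apply: le_trans (ler_wpM2l (ltW r0) h) _; rewrite le_eqVlt; apply/orP; left; apply/eqP.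
by field; rewrite !gt_eqF.
Qed.

(* The tangent at [s] to the convex function [t ^ r] is Young's inequality. *)
Lemma jensen_powR (A : set T) (t : T -> R) (r s v : R) : measurable A ->
  measurable_fun setT t -> (forall z, 0 <= t z) -> 1 <= r -> 0 <= s ->
  mu A = v%:E -> (\int[mu]_(z in A) (t z)%:E = (s * v)%:E)%E ->
  ((s `^ r * v)%:E <= \int[mu]_(z in A) (t z `^ r)%:E)%E.
Proof.
move=> mA mt t0 r1 s0 muA it; have r0 : 0 < r by exact: lt_le_trans r1.
have v0 : 0 <= v by rewrite -lee_fin -muA measure_ge0.
have mtA : measurable_fun A (EFin \o t).
  by apply/measurable_EFinP; exact: measurable_funTS.
have mtr : measurable_fun A (fun z => (t z `^ r)%:E).
  by apply/measurable_EFinP/measurable_funTS; exact: (measurableT_comp (measurable_powR r)).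
have : (\int[mu]_(z in A) (r * s `^ (r - 1) * t z)%:E <=
   \int[mu]_(z in A) ((t z `^ r)%:E + ((r - 1) * s `^ r)%:E))%E.
  apply: ge0_le_integral => //.
  - by move=> z _; rewrite lee_fin !mulr_ge0 ?powR_ge0// ltW.
  - by apply/measurable_EFinP/measurable_funM => //; exact: measurable_funTS.
  - by apply: emeasurable_funD.
  - by move=> z _; rewrite -EFinD lee_fin; exact: young_tangent.
rewrite ge0_integralD//; first last.
- by move=> z _; rewrite lee_fin mulr_ge0 ?powR_ge0// subr_ge0.
- by move=> z _; rewrite lee_fin powR_ge0.
have -> : (\int[mu]_(z in A) (r * s `^ (r - 1) * t z)%:E =
    (r * s `^ (r - 1))%:E * \int[mu]_(z in A) (t z)%:E)%E.
  rewrite -ge0_integralZl//; last by rewrite lee_fin mulr_ge0 ?powR_ge0// ltW.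
  by move=> z _; rewrite lee_fin.
have ic c : (\int[mu]_(_ in A) c%:E = (c * v)%:E)%E.
  by rewrite (integral_cst _ mA c%:E) EFinM -muA.
rewrite it ic -EFinM.
have X0 : (0 <= \int[mu]_(z in A) (t z `^ r)%:E)%E.
  by apply: integral_ge0 => z _; rewrite lee_fin powR_ge0.
case: (\int[mu]_(z in A) (t z `^ r)%:E)%E X0 => [x| |] X0; last 2 first.
- by move=> _; exact: leey.
- by rewrite leNgt ltNy0 in X0.
rewrite -EFinD !lee_fin.
have -> : r * s `^ (r - 1) * (s * v) = r * (s * s `^ (r - 1)) * v by ring.
rewrite mulr_powRB1// => h; lra.
Qed.

End RealNorm.

(** * Translation invariance of the norm and the distance to the coset average *)

Section VilenkinNorm.
Context {R : realType} {m : nat -> nat} (m_ge2 : forall k, (2 <= m k)%N).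
Local Notation M := (vpow m).
Local Notation G := (vilenkin m).
Local Notation G2 := (G * G)%type.
Context (mu : probability G2 R) (mu_haar : haar mu).
Context (p : \bar R) (p_ge1 : (1 <= p)%E).
Local Notation normc := (@Normc.normc R).
Implicit Types (f g : G2 -> R[i]) (h : G2 -> R) (w : G2).

Lemma vnormE f : vnorm mu p f = rnorm mu p (fun z => normc (f z)).
Proof.
rewrite /vnorm /rnorm; case: p => //.
by congr ereal_sup; apply/seteqP; split=> _ [z _ <-]; exists z => //; rewrite ger0_norm ?normc_ge0.
Qed.

Lemma vnorm_ge0 f : (0 <= vnorm mu p f)%E.
Proof.
by rewrite vnormE rnorm_ge0.
Qed.

Lemma vnormD f g : cmeasurable f -> cmeasurable g ->
  (vnorm mu p (fun z => (f z + g z)%R) <= vnorm mu p f + vnorm mu p g)%E.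
Proof.
move=> mf mg; rewrite !vnormE.
have mf' := cmeasurable_normc f mf; have mg' := cmeasurable_normc g mg.
apply: le_trans (rnormD mu p _ _ p_ge1 mf' mg').
apply: rnorm_le => //.
- exact: (cmeasurable_normc _ (cmeasurableD f g mf mg)).
- exact: measurable_funD.
move=> z; rewrite !ger0_norm ?addr_ge0 ?normc_ge0//; exact: (le_normcD (f z : Rcomplex R)).
Qed.

Lemma vnormZ f (c : R[i]) : cmeasurable f ->
  (vnorm mu p (fun z => (c * f z)%R) = (normc c)%:E * vnorm mu p f)%E.
Proof.
move=> mf; rewrite !vnormE.
have := rnormZ mu p _ (normc c) p_ge1 (cmeasurable_normc f mf).
rewrite ger0_norm ?normc_ge0// => <-; congr rnorm.
by apply/funext => z; rewrite Normc.normcM.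
Qed.

Lemma vnorm_sum (I : Type) (s : seq I) (F : I -> G2 -> R[i]) :
  (forall i, cmeasurable (F i)) ->
  cmeasurable (fun z => \sum_(i <- s) F i z) /\
  (vnorm mu p (fun z => (\sum_(i <- s) F i z)%R) <= \sum_(i <- s) vnorm mu p (F i))%E.
Proof.
move=> mF; elim: s => [|i s [IH1 IH2]].
  rewrite (_ : (fun z => \sum_(i <- [::]) F i z) = fun=> 0); last first.
    by apply/funext => z; rewrite big_nil.
  have m0 := vperiodic2_cmeasurable m_ge2 0 _ (vperiodic2_cst 0 0 : vperiodic2 0 (fun _ : G2 => 0 : R[i])).
  split => //; rewrite big_nil.
  have := vnormZ (fun=> 0) 0 m0; rewrite Normc.normc0 mul0e => h.
  rewrite (_ : (fun=> 0) = (fun z : G2 => 0 * (0 : R[i]))) ?h//.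
  by apply/funext => z; rewrite mul0r.
rewrite (_ : (fun z => \sum_(j <- i :: s) F j z) = fun z => F i z + \sum_(j <- s) F j z); last first.
  by apply/funext => z; rewrite big_cons.
split; first exact: cmeasurableD.
rewrite big_cons; apply: le_trans (vnormD _ _ (mF i) IH1) _.
exact: leeD.
Qed.

Lemma rnorm_shift h w : measurable_fun setT h ->
  rnorm mu p (fun z => h (w + z)) = rnorm mu p h.
Proof.
move=> mh; rewrite /rnorm; case: p p_ge1 => [r| |//] _.
  rewrite !Lnorm.unlock; congr (_ `^ _)%E.
  apply: (ge0_integral_shift m_ge2 mu mu_haar (fun z => `|(EFin \o h) z| `^ r)%E w).
    apply/measurable_EFinP/(measurableT_comp (measurable_powR r)).
    exact: (measurableT_comp _ mh).
  by move=> z; exact: poweR_ge0.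
congr ereal_sup; apply/seteqP; split=> _ [z _ <-]; first by exists (w + z).
by exists (z - w) => //; rewrite addrC subrK.
Qed.

Lemma vnorm_shift f w : cmeasurable f -> vnorm mu p (fun z => f (z - w)) = vnorm mu p f.
Proof.
move=> mf; rewrite !vnormE -[RHS](rnorm_shift _ (- w)); last exact: cmeasurable_normc.
by congr rnorm; apply/funext => z; rewrite addrC.
Qed.

Lemma mu_vcoset2 n c : mu (vcoset2 n c) = ((M n)%:R * (M n)%:R)^-1%:E.
Proof.
have mA := measurable_vcoset2 n c.
have fA : mu (vcoset2 n c) \is a fin_num by exact: fin_num_measure.
have := cintegral_vind m_ge2 mu mu_haar n c => /(congr1 (@complex.Re R)).
rewrite -natrM -(rmorph_nat (real_complex R)) -fmorphV natrM /= /Rintegral => <-.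
have E : (\int[mu]_z (complex.Re (vind n c z))%:E = mu (vcoset2 n c))%E.
  rewrite (eq_integral (fun z => (\1_(vcoset2 n c) z)%:E)); last first.
    move=> z _; rewrite /vind indicE; case: asboolP => h; first by rewrite mem_set.
    by rewrite memNset.
  by rewrite integral_indic// setIT.
by rewrite E fineK.
Qed.

(** Real counterpart of [vavg], written as an integral over the coset so that Jensen's inequality
    applies there. *)
Definition havg n h : G2 -> R := fun z =>
  (M n)%:R * (M n)%:R * \int[mu]_(y in vcoset2 n z) h y.

Lemma vcoset2_eq n z w : vcyl n w.1 -> vcyl n w.2 -> vcoset2 n (z + w) = (vcoset2 n z : set G2).
Proof.
move=> h1 h2; apply/seteqP; split=> y [H1 H2]; split.
- have := vcylD _ _ _ H1 h1; rewrite -[(z + w).1]/(z.1 + w.1) opprD addrA.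
  by rewrite subrK.
- have := vcylD _ _ _ H2 h2; rewrite -[(z + w).2]/(z.2 + w.2) opprD addrA.
  by rewrite subrK.
- by rewrite -[(z + w).1]/(z.1 + w.1) opprD addrA; exact: vcylB.
- by rewrite -[(z + w).2]/(z.2 + w.2) opprD addrA; exact: vcylB.
Qed.

Lemma havg_periodic n h : vperiodic2 n (havg n h).
Proof. by move=> z w h1 h2; rewrite /havg vcoset2_eq. Qed.

Section Average.
Context (n : nat) (h : G2 -> R) (W : R).
Context (mh : measurable_fun setT h) (ih : mu.-integrable setT (EFin \o h)).
Context (hW : forall w, vcyl n w.1 -> vcyl n w.2 ->
  (rnorm mu p (fun z => (h (w + z) - h z)%R) <= W%:E)%E).
Local Notation K := ((M n)%:R * (M n)%:R : R).

Let K_gt0 : 0 < K.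
Proof. by rewrite -natrM ltr0n muln_gt0 !(vpow_gt0 m_ge2). Qed.

Let W_ge0 : 0 <= W.
Proof.
rewrite -lee_fin; apply: le_trans (hW 0 (vcyl0 n) (vcyl0 n)).
exact: rnorm_ge0.
Qed.

(** The mean oscillation about h z on the coset of z. It dominates |E_n h - h|, and as the mean of a
    nonnegative function it is what Jensen's inequality raises to the power r. *)
Let osc z : R := K * \int[mu]_(y in vcoset2 n z) `|h y - h z|.

Let idiff z : mu.-integrable (vcoset2 n z) (EFin \o (fun y => h y - h z)).
Proof.
have mA := measurable_vcoset2 n z.
have i1 : mu.-integrable (vcoset2 n z) (EFin \o h).
  exact: (integrableS measurableT mA (@subsetT _ _) ih).
have i2 : mu.-integrable (vcoset2 n z) (EFin \o cst (h z)).
  by apply: finite_measure_integrable_cst.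
by have := integrableB mA i1 i2; congr (mu.-integrable _ _).
Qed.

Let havg_osc z : `|havg n h z - h z| <= osc z.
Proof.
have mA := measurable_vcoset2 n z.
have i1 : mu.-integrable (vcoset2 n z) (EFin \o h).
  exact: (integrableS measurableT mA (@subsetT _ _) ih).
have i2 : mu.-integrable (vcoset2 n z) (EFin \o cst (h z)).
  by apply: finite_measure_integrable_cst.
have -> : havg n h z - h z = K * \int[mu]_(y in vcoset2 n z) (h y - h z).
  rewrite (RintegralB mA i1 i2) mulrBr Rintegral_cst//; congr (_ - _).
  rewrite (_ : fine _ = K^-1); last exact: (congr1 fine (mu_vcoset2 n z)).
  by rewrite mulrC mulfVK ?gt_eqF.
rewrite normrM gtr0_norm// ler_wpM2l ?(ltW K_gt0)//.
exact: le_normr_Rintegral.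
Qed.

Let osc_ge0 z : 0 <= osc z.
Proof. exact: le_trans (havg_osc z). Qed.

Lemma osc_integral z :
  (\int[mu]_(y in vcoset2 n z) (`|h y - h z|)%:E = (osc z * K^-1)%:E)%E.
Proof.
rewrite /osc mulrAC mulfV ?gt_eqF// mul1r /Rintegral fineK//.
have mA := measurable_vcoset2 n z.
by apply: integrable_fin_num => //; exact: (integrable_norm (idiff z)).
Qed.

(** For y in the coset of z, the hypothesis at the displacement y - z, evaluated at z, bounds the
    integrand pointwise. *)
Let rnorm_havg_sup : p = +oo%E -> forall z, osc z <= W.
Proof.
move=> py z; have mA := measurable_vcoset2 n z.
rewrite -(ler_pM2r (x := K^-1)) ?invr_gt0// -lee_fin -osc_integral.
have -> : ((W * K^-1)%:E = \int[mu]_(y in vcoset2 n z) W%:E)%E.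
  by rewrite (integral_cst _ mA W%:E) EFinM -(mu_vcoset2 n z).
apply: ge0_le_integral => //.
  apply/measurable_EFinP/measurable_funTS; apply: (measurableT_comp (@normr_measurable R setT)).
  exact: measurable_funB.
move=> y [h1 h2]; have := hW (y - z) h1 h2; rewrite py /rnorm.
by apply: le_trans; apply: ereal_sup_ubound; exists z => //; rewrite subrK.
Qed.

(** Jensen bounds the r-th power of the oscillation by a mean over the coset. Substituting y = z + w
    makes the domain I_n x I_n independent of z. Tonelli then leaves, for each w, the r-th power of
    the norm of h (w + z) - h z in z, at most W^r, and K cancels the measure of I_n x I_n. *)
Let rnorm_havg_powR (r : R) : p = r%:E ->
  (\int[mu]_z (`|havg n h z - h z| `^ r)%:E <= (W `^ r)%:E)%E.
Proof.
move=> pr; have := p_ge1; rewrite pr lee_fin => r1.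
have r0 : 0 < r by exact: lt_le_trans r1.
pose F (t : G2 * G2) : \bar R := (`|h (t.1 + t.2) - h t.1| `^ r * \1_(vcoset2 n 0) t.2)%:E.
have mF : measurable_fun setT F.
  apply/measurable_EFinP/measurable_funM.
    apply: (measurableT_comp (measurable_powR r)).
    apply: (measurableT_comp (@normr_measurable R setT)).
    apply: measurable_funB; first exact: (measurableT_comp mh (measurable_fun_vadd m_ge2)).
    exact: (measurableT_comp mh measurable_fst).
  apply: (measurableT_comp (measurable_indic _) measurable_snd).
  exact: measurable_vcoset2.
have F0 t : (0 <= F t)%E by rewrite lee_fin mulr_ge0 ?powR_ge0.
have step z : ((`|havg n h z - h z| `^ r)%:E <= K%:E * \int[mu]_w F (z, w))%E.
  have mA := measurable_vcoset2 n z.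
  have mt : measurable_fun setT (fun y => `|h y - h z|).
    apply: (measurableT_comp (@normr_measurable R setT)).
    exact: measurable_funB.
  have := jensen_powR mu (vcoset2 n z) (fun y => `|h y - h z|) r (osc z) K^-1 mA mt
    (fun y => normr_ge0 _) r1 (osc_ge0 z) (mu_vcoset2 n z) (osc_integral z).
  have -> : (\int[mu]_(y in vcoset2 n z) (`|h y - h z| `^ r)%:E = \int[mu]_w F (z, w))%E.
    rewrite integral_mkcond.
    rewrite -[LHS](ge0_integral_shift m_ge2 mu mu_haar _ z); first last.
    - by apply: erestrict_ge0 => y _; rewrite lee_fin powR_ge0.
    - apply/(measurable_restrictT _ mA); apply/measurable_EFinP; apply: measurable_funTS.
      exact: (measurableT_comp (measurable_powR r)).
    apply: eq_integral => w _; rewrite /F /= /patch indicE.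
    have -> : (z + w \in vcoset2 n z) = (w \in vcoset2 n (0 : G2)).
      have zE (x y : G) : x + y - x = y by rewrite addrC addKr.
      by apply/idP/idP; rewrite !inE => -[]; rewrite /vcoset2 /= !subr0 !zE.
    by case: ifP => _; rewrite ?mulr1 ?mulr0.
  move=> J.
  apply: (@le_trans _ _ ((osc z) `^ r)%:E).
    by rewrite lee_fin ge0_ler_powR ?nnegrE ?(ltW r0).
  have K0 : (0 <= K%:E)%E by rewrite lee_fin ltW.
  apply: le_trans (lee_wpmul2l K0 J).
  by rewrite -EFinM mulrC mulfVK ?gt_eqF.
apply: (@le_trans _ _ (\int[mu]_z (K%:E * \int[mu]_w F (z, w)))%E).
  apply: ge0_le_integral => //.
  - apply/measurable_EFinP/(measurableT_comp (measurable_powR r)).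
    apply: (measurableT_comp (@normr_measurable R setT)); apply: measurable_funB => //.
    exact: (measurable_vperiodic2 m_ge2 _ _ n _ (havg_periodic n h)).
  - by apply: measurable_funeM; exact: measurable_fun_fubini_tonelli_F.
rewrite ge0_integralZl//; first last.
- by move=> z _; exact: integral_ge0.
- exact: measurable_fun_fubini_tonelli_F.
rewrite (fubini_tonelli F mF F0).
apply: (@le_trans _ _ (K%:E * \int[mu]_w ((W `^ r)%:E * (\1_(vcoset2 n (0 : G2)) w)%:E))%E).
  apply: lee_wpmul2l; first by rewrite lee_fin ltW.
  apply: ge0_le_integral => //.
  - by move=> w _; exact: integral_ge0.
  - exact: measurable_fun_fubini_tonelli_G.
  - apply: measurable_funeM; apply/measurable_EFinP; apply: measurable_indic.
    exact: measurable_vcoset2.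
  move=> w _; rewrite /F /= indicE; case: (boolP (w \in _)) => [|_]; last first.
    by rewrite mule0; under eq_integral do rewrite mulr0; rewrite integral0.
  rewrite inE /vcoset2 /= !subr0 => -[h1 h2]; rewrite mule1.
  under eq_integral do rewrite mulr1.
  have := hW w h1 h2; rewrite pr /rnorm => H.
  have := poweR_Lnorm mu (EFin \o (fun z => (h (w + z) - h z)%R)) (lt0r_neq0 r0).
  move=> E; apply: (@le_trans _ _ ('N[mu]_r%:E[EFin \o (fun z => (h (w + z) - h z)%R)] `^ r)%E).
    rewrite E le_eqVlt; apply/orP; left; apply/eqP; apply: eq_integral => z _.
    by rewrite [z + w]addrC.
  rewrite -poweR_EFin; apply: gt0_ler_poweR => //; first exact: ltW.
    by rewrite in_itv/= leey andbT Lnorm_ge0.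
  by rewrite in_itv/= leey andbT lee_fin.
have mI := measurable_vcoset2 n (0 : G2).
rewrite ge0_integralZl//; first last.
- by rewrite lee_fin powR_ge0.
- by apply/measurable_EFinP; exact: measurable_indic.
rewrite integral_indic// setIT.
rewrite [X in (_ * (_ * X))%E](_ : _ = (K^-1)%:E); last exact: mu_vcoset2.
by rewrite -!EFinM lee_fin mulrCA mulfV ?gt_eqF// mulr1.
Qed.

Lemma rnorm_havg : (rnorm mu p (fun z => (havg n h z - h z)%R) <= W%:E)%E.
Proof.
have sup := rnorm_havg_sup; have pow := rnorm_havg_powR.
rewrite /rnorm; case: p p_ge1 sup pow => [r| |//] p1 sup pow; last first.
  apply: ge_ereal_sup => _ [z _ <-]; rewrite lee_fin.
  by apply: le_trans (havg_osc z) _; exact: sup.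
rewrite lee_fin in p1; have r0 : 0 < r by exact: lt_le_trans p1.
rewrite Lnorm.unlock /=.
have -> : W%:E = ((W `^ r)%:E `^ r^-1)%E.
  by rewrite poweR_EFin -powRrM mulfV ?gt_eqF// powRr1.
apply: gt0_ler_poweR; rewrite ?invr_ge0 ?(ltW r0)//.
- by rewrite in_itv/= leey andbT integral_ge0// => x _; rewrite lee_fin powR_ge0.
- by rewrite in_itv/= leey andbT lee_fin powR_ge0.
exact: pow.
Qed.

End Average.
End VilenkinNorm.

(** * Integrability in L^p and the total modulus of continuity *)

Section LpSpaces.
Context {R : realType} {m : nat -> nat} (m_ge2 : forall k, (2 <= m k)%N).
Local Notation M := (vpow m).
Local Notation G := (vilenkin m).
Local Notation G2 := (G * G)%type.
Context (mu : probability G2 R) (mu_haar : haar mu).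
Context (p : \bar R) (p_ge1 : (1 <= p)%E).
Local Notation normc := (@Normc.normc R).
Implicit Types (f g : G2 -> R[i]).

Lemma vavg_Re n f z : complex.Re (vavg mu n f z) = havg mu n (fun y => complex.Re (f y)) z.
Proof.
rewrite /vavg /havg -!natrM -(rmorph_nat (real_complex R)).
rewrite [complex.Re _]/= mul0r subr0; congr (_ * _).
rewrite [RHS]Rintegral_mkcond; apply: eq_Rintegral => y _.
rewrite /vind /patch; case: asboolP => h.
  by rewrite mulr1 mem_set.
by rewrite mulr0 memNset.
Qed.

Lemma vavg_Im n f z : complex.Im (vavg mu n f z) = havg mu n (fun y => complex.Im (f y)) z.
Proof.
rewrite /vavg /havg -!natrM -(rmorph_nat (real_complex R)).
rewrite [complex.Im _]/= mul0r addr0; congr (_ * _).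
rewrite [RHS]Rintegral_mkcond; apply: eq_Rintegral => y _.
rewrite /vind /patch; case: asboolP => h.
  by rewrite mulr1 mem_set.
by rewrite mulr0 memNset.
Qed.

Lemma ReB (x y : R[i]) : complex.Re (x - y) = complex.Re x - complex.Re y.
Proof. by case: x; case: y. Qed.

Lemma ImB (x y : R[i]) : complex.Im (x - y) = complex.Im x - complex.Im y.
Proof. by case: x; case: y. Qed.

(** The real estimate is applied to real and imaginary parts separately, each moving under
    translation by no more than f does; hence W twice. *)
Lemma vnorm_vavg n f (W : R) : cintegrable mu f ->
  (forall w, vcyl n w.1 -> vcyl n w.2 ->
    (vnorm mu p (fun z => (f (w + z) - f z)%R) <= W%:E)%E) ->
  (vnorm mu p (fun z => (vavg mu n f z - f z)%R) <= (W + W)%:E)%E.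
Proof.
move=> fi hW; have [mr mi] := cmeasurable_integrable mu f fi.
have [ir ii] := fi.
have mav := vperiodic2_cmeasurable m_ge2 n _ (vavg_periodic mu n f).
have md := cmeasurableB _ _ mav (conj mr mi).
have ms w : cmeasurable (fun z => f (w + z) - f z).
  exact: (cmeasurableB _ _ (cmeasurable_shift m_ge2 f w (conj mr mi)) (conj mr mi)).
have hr := rnorm_havg m_ge2 mu mu_haar p p_ge1 n (fun z => complex.Re (f z)) W mr ir.
have hi := rnorm_havg m_ge2 mu mu_haar p p_ge1 n (fun z => complex.Im (f z)) W mi ii.
rewrite vnormE EFinD.
have mR := md.1; have mI := md.2.
apply: (@le_trans _ _ (rnorm mu p (fun z => `|complex.Re (vavg mu n f z - f z)|)%R +
    rnorm mu p (fun z => `|complex.Im (vavg mu n f z - f z)|)%R)%E).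
  apply: le_trans (rnormD mu p _ _ p_ge1 (measurableT_comp (@normr_measurable R setT) mR)
     (measurableT_comp (@normr_measurable R setT) mI)).
  apply: rnorm_le => //; first exact: cmeasurable_normc.
    by apply: measurable_funD; exact: (measurableT_comp (@normr_measurable R setT)).
  move=> z; rewrite ger0_norm ?normc_ge0//.
  rewrite ger0_norm; last by apply: addr_ge0; exact: normr_ge0.
  exact: normc_le_ReIm.
apply: leeD.
  apply: (@le_trans _ _ (rnorm mu p (fun z => complex.Re (vavg mu n f z - f z)))).
    by rewrite le_eqVlt; apply/orP; left; apply/eqP; exact: rnorm_normr.
  rewrite (_ : (fun z => complex.Re _) = (fun z => havg mu n (fun z => complex.Re (f z)) z - complex.Re (f z))).
    apply: hr => w h1 h2; apply: le_trans (hW w h1 h2); rewrite vnormE.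
    apply: rnorm_le => //.
    + apply: measurable_funB => //.
      exact: (measurableT_comp mr (measurable_fun_vshift m_ge2 w)).
    + exact: cmeasurable_normc.
    + by move=> z; rewrite -ReB [leRHS]ger0_norm ?normc_ge0// Re_le_normc.
  by apply/funext => z; rewrite ReB vavg_Re.
apply: (@le_trans _ _ (rnorm mu p (fun z => complex.Im (vavg mu n f z - f z)))).
  by rewrite le_eqVlt; apply/orP; left; apply/eqP; exact: rnorm_normr.
rewrite (_ : (fun z => complex.Im _) = (fun z => havg mu n (fun z => complex.Im (f z)) z - complex.Im (f z))).
  apply: hi => w h1 h2; apply: le_trans (hW w h1 h2); rewrite vnormE.
  apply: rnorm_le => //.
  + apply: measurable_funB => //.
    exact: (measurableT_comp mi (measurable_fun_vshift m_ge2 w)).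
  + exact: cmeasurable_normc.
  + by move=> z; rewrite -ImB [leRHS]ger0_norm ?normc_ge0// Im_le_normc.
by apply/funext => z; rewrite ImB vavg_Im.
Qed.

Lemma continuous_ReIm f : continuous (f : G2 -> R[i]^o) ->
  continuous (fun z => complex.Re (f z)) /\ continuous (fun z => complex.Im (f z)).
Proof.
move=> fc.
have near_normc z (e : R) : 0 < e -> \forall y \near z, normc (f z - f y) < e.
  move=> e0; have := fc z => /cvgrPdist_lt /(_ (real_complex R e)).
  by rewrite ltcR => /(_ e0); apply: filterS => y; rewrite -ltcR; case: (f z - f y).
split=> z; apply/cvgrPdist_lt => e e0.
  by apply: filterS (near_normc z e e0) => y; apply: le_lt_trans; rewrite -ReB Re_le_normc.
by apply: filterS (near_normc z e e0) => y; apply: le_lt_trans; rewrite -ImB Im_le_normc.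
Qed.

Lemma bounded_integrable (h : G2 -> R) K : measurable_fun setT h ->
  (forall z, `|h z| <= K) -> mu.-integrable setT (EFin \o h).
Proof.
move=> mh hK.
have fin : (mu [set: G2] < +oo)%E by rewrite probability_setT ltry.
apply: measurable_bounded_integrable => //.
exists K; split; first exact: num_real.
by move=> B KB z _ /=; apply: le_trans (ltW KB).
Qed.

(** On a probability space L^p embeds in L^1; at +oo a finite supremum makes h bounded. *)
Lemma rnorm_integrable (h : G2 -> R) : measurable_fun setT h ->
  (rnorm mu p h < +oo)%E -> mu.-integrable setT (EFin \o h).
Proof.
move=> mh; rewrite /rnorm; case: p p_ge1 => [r| |//] r1 hfin.
  apply/Lfun1_integrable.
  have hr : h \in Lfun mu r%:E by rewrite inE/=; apply/andP; split; rewrite inE.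
  apply: (Lfun_subset (lexx _) r1 _ r1 hr).
  by rewrite fin_num_measure.
have [K hK] : exists K, forall z, `|h z| <= K.
  have [x xE] : exists x, ereal_sup [set (`|h z|)%:E | z in [set: G2]] = x%:E.
    move: hfin; have : (0 <= ereal_sup [set (`|h z|)%:E | z in [set: G2]])%E.
      apply: (@le_trans _ _ (`|h point|)%:E); first by rewrite lee_fin.
      by apply: ereal_sup_ubound; exists point.
    case: (ereal_sup _) => [x _ _|_|]; first by exists x.
      by rewrite ltxx.
    by rewrite leNgt ltNy0.
  exists x => z; rewrite -lee_fin -xE; apply: ereal_sup_ubound; by exists z.
exact: bounded_integrable hK.
Qed.

Lemma in_Lp_cintegrable f : in_Lp mu p f -> cintegrable mu f.
Proof.
rewrite /in_Lp => H.
have [mf fin] : cmeasurable f /\ (vnorm mu p f < +oo)%E.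
  case: p p_ge1 H => [r| |//] _; first by move=> [mr mi fin].
  move=> /continuous_ReIm[cr ci].
  split; first by split; exact: continuous_measurable.
  have [K1 h1] := continuous_bounded _ cr; have [K2 h2] := continuous_bounded _ ci.
  apply: (@le_lt_trans _ _ (K1 + K2)%:E); last exact: ltry.
  apply: ge_ereal_sup => _ [z _ <-]; rewrite lee_fin.
  by apply: le_trans (normc_le_ReIm _) _; exact: lerD.
have mn := cmeasurable_normc f mf; have [mr mi] := mf.
rewrite vnormE in fin.
split; apply: rnorm_integrable => //; apply: le_lt_trans fin; apply: rnorm_le => // z.
  by rewrite [leRHS]ger0_norm ?normc_ge0// Re_le_normc.
by rewrite [leRHS]ger0_norm ?normc_ge0// Im_le_normc.
Qed.

Lemma in_Lp_vnorm_lty f : in_Lp mu p f -> (vnorm mu p f < +oo)%E.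
Proof.
rewrite /in_Lp; case: p p_ge1 => [r| |//] _; first by case.
move=> /continuous_ReIm[cr ci].
have [K1 h1] := continuous_bounded _ cr; have [K2 h2] := continuous_bounded _ ci.
apply: (@le_lt_trans _ _ (K1 + K2)%:E); last exact: ltry.
apply: ge_ereal_sup => _ [z _ <-]; rewrite lee_fin.
by apply: le_trans (normc_le_ReIm _) _; exact: lerD.
Qed.

Lemma total_modulus_fin f n : in_Lp mu p f -> total_modulus mu p f n \is a fin_num.
Proof.
move=> fp; have mf := cmeasurable_integrable mu f (in_Lp_cintegrable f fp).
have := in_Lp_vnorm_lty f fp; have v0 := vnorm_ge0 mu p p_ge1.
move=> fin; have ffin : vnorm mu p f \is a fin_num by rewrite ge0_fin_numE.
rewrite ge0_fin_numE.
  apply: (@le_lt_trans _ _ (vnorm mu p f + vnorm mu p f)%E); last first.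
    by rewrite -(fineK ffin) -EFinD ltry.
  apply: ge_ereal_sup => _ [w _ <-].
  have ms : cmeasurable (fun z => f (z - w)).
    by have := cmeasurable_shift m_ge2 f (- w) mf; congr cmeasurable; apply/funext => z; rewrite addrC.
  have mN := cmeasurableZ (-1) f mf.
  rewrite (_ : (fun z => f (z - w) - f z) = (fun z => f (z - w) + (-1) * f z)); last first.
    by apply/funext => z; rewrite mulN1r.
  apply: le_trans (vnormD mu p p_ge1 _ _ ms mN) _.
  rewrite (vnorm_shift m_ge2 mu mu_haar p p_ge1 f w mf) (vnormZ mu p p_ge1 _ _ mf).
  by rewrite normcN Normc.normc1 mul1e.
apply: le_trans (v0 (fun z => f (z - 0) - f z)) _.
by apply: ereal_sup_ubound; exists 0.
Qed.

(** The modulus is defined with the translate by -w; I_n x I_n is symmetric. *)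
Lemma vnorm_diff_le_modulus f n w : in_Lp mu p f -> vcyl n w.1 -> vcyl n w.2 ->
  (vnorm mu p (fun z => (f (w + z) - f z)%R) <= (fine (total_modulus mu p f n))%:E)%E.
Proof.
move=> fp h1 h2; rewrite fineK; last exact: total_modulus_fin.
apply: ereal_sup_ubound; exists (- w); first by split; exact: vcylN.
by congr vnorm; apply/funext => z; rewrite opprK [z + w]addrC.
Qed.

Lemma vnorm_vavg_modulus f n : in_Lp mu p f ->
  (vnorm mu p (fun z => (vavg mu n f z - f z)%R) <=
    (2 * fine (total_modulus mu p f n))%:E)%E.
Proof.
move=> fp; rewrite mulr_natl mulr2n; apply: vnorm_vavg; first exact: in_Lp_cintegrable.
by move=> w h1 h2; exact: vnorm_diff_le_modulus.
Qed.

Lemma modulus_ge0 f n : 0 <= fine (total_modulus mu p f n).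
Proof.
apply: fine_ge0; apply: le_trans (vnorm_ge0 mu p p_ge1 (fun z => f (z - 0) - f z)) _.
by apply: ereal_sup_ubound; exists 0.
Qed.

End LpSpaces.

(** * Operator bounds for the mean on periodic functions *)

Section CesaroOperator.
Context {R : realType} {m : nat -> nat} (m_ge2 : forall k, (2 <= m k)%N).
Local Notation M := (vpow m).
Local Notation G := (vilenkin m).
Local Notation G2 := (G * G)%type.
Context (mu : probability G2 R) (mu_haar : haar mu).
Context (p : \bar R) (p_ge1 : (1 <= p)%E).
Local Notation normc := (@Normc.normc R).
Implicit Types (f g : G2 -> R[i]).

(** A discrete Young inequality: the triangle inequality, and the invariance of the norm under each
    translation. *)
Lemma vnorm_convolution l g (q : nat -> nat -> R[i]) (x : R) :
  cmeasurable g -> (vnorm mu p g <= x%:E)%E ->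
  (vnorm mu p (fun z => (((M l)%:R * (M l)%:R)^-1 *
      \sum_(c < M l) \sum_(d < M l) q c d * g (z - vnat2 c d))%R)
    <= (((M l)%:R * (M l)%:R)^-1 * (\sum_(c < M l) \sum_(d < M l) normc (q c d)) * x)%:E)%E.
Proof.
move=> mg gx.
have mS (w : G2) : cmeasurable (fun z => g (z - w)).
  have := cmeasurable_shift m_ge2 g (- w) mg; congr cmeasurable.
  by apply/funext => z; rewrite addrC.
have mt c d : cmeasurable (fun z => q c d * g (z - vnat2 c d)) := cmeasurableZ _ _ (mS _).
have m2 (c : 'I_(M l)) : cmeasurable (fun z => \sum_(d < M l) q c d * g (z - vnat2 c d)).
  exact: (vnorm_sum m_ge2 mu p p_ge1 _ _ (fun (d : 'I_(M l)) z => q c d * g (z - vnat2 c d)) (fun d => mt c d)).1.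
have [m1 H1] := vnorm_sum m_ge2 mu p p_ge1 _ (index_enum 'I_(M l))
  (fun (c : 'I_(M l)) z => \sum_(d < M l) q c d * g (z - vnat2 c d)) m2.
rewrite (vnormZ mu p p_ge1 _ _ m1) Normc.normcV Normc.normcM normc_nat.
have K0 : 0 <= ((M l)%:R * (M l)%:R : R)^-1 by rewrite invr_ge0 mulr_ge0.
rewrite -mulrA EFinM; apply: lee_wpmul2l; first by rewrite lee_fin.
apply: le_trans H1 _; rewrite mulr_suml -sumEFin; apply: lee_sum => c _.
have [_ H2] := vnorm_sum m_ge2 mu p p_ge1 _ (index_enum 'I_(M l))
  (fun (d : 'I_(M l)) z => q c d * g (z - vnat2 c d)) (fun d => mt c d).
apply: le_trans H2 _; rewrite mulr_suml -sumEFin; apply: lee_sum => d _.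
rewrite (vnormZ mu p p_ge1 _ _ (mS _)) (vnorm_shift m_ge2 mu mu_haar p p_ge1 _ _ mg).
by rewrite EFinM; apply: lee_wpmul2l => //; rewrite lee_fin normc_ge0.
Qed.

Section Kernels.
Context (a b : R) (a01 : 0 < a < 1) (b01 : 0 < b < 1).
Local Notation sigma := (cesaro_mean mu (- a) (- b)).

(** The kernel is a product in the two variables, so its L^1 norm is the product of the
    one-dimensional ones. *)
Lemma vnorm_cesaro_mean n k l g x : vperiodic2 l g -> (vnorm mu p g <= x%:E)%E ->
  (vnorm mu p (sigma n k g) <=
    (@cesaro_lebesgue R m a n l * @cesaro_lebesgue R m b k l * x)%:E)%E.
Proof.
move=> gl gx; have mg := vperiodic2_cmeasurable m_ge2 l g gl.
have := vnorm_convolution l g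
  (fun c d => cesaro_kernel a n l (vnat c : G) * cesaro_kernel b k l (vnat d : G)) x mg gx.
rewrite (_ : (fun z => _ * _) = sigma n k g); last first.
  by apply/funext => z; rewrite (cesaro_mean_periodic m_ge2 mu mu_haar _ _ _ _ _ _ _ gl).
congr (_ <= _%:E)%E; congr (_ * x); rewrite /cesaro_lebesgue.
rewrite mulrACA -invfM; congr (_ * _).
rewrite mulr_suml; apply: eq_bigr => c _.
by rewrite mulr_sumr; apply: eq_bigr => d _; rewrite Normc.normcM.
Qed.

(** The total deviation from 1 of the Cesàro weights at frequencies below M_l; it bounds pointwise
    the distance from the Cesàro kernel to the Dirichlet kernel of length M_l. *)
Definition cesaro_defect (c : R) (n l : nat) : R :=
  \sum_(i < M l) `|cesaro_number (- c) (n - i) / cesaro_number (- c) n - 1|.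

Lemma cesaro_defect_ge0 c n l : 0 <= cesaro_defect c n l.
Proof. exact: sumr_ge0. Qed.

Lemma normc_cesaro_kernel_defect c n l (y : G) : (M l <= n.+1)%N ->
  normc (cesaro_kernel c n l y - \sum_(i < M l) vpsi R i y) <= cesaro_defect c n l.
Proof.
move=> ln; rewrite /cesaro_kernel (minn_idPr ln) -sumrB.
apply: le_trans (normc_sum _ _ _ _) _; apply: ler_sum => i _.
rewrite -[X in _ - X]mul1r -mulrBl Normc.normcM normc_vpsi mulr1.
by rewrite -(rmorph1 (real_complex R)) -rmorphB normc_real.
Qed.

Lemma cesaro_defect_cvg (c : R) (l : nat) : 0 < c < 1 ->
  cesaro_defect c n l @[n --> \oo] --> (0 : R).
Proof.
move=> c01; rewrite /cesaro_defect.
elim: (M l) => [|N IH].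
  by rewrite (_ : (fun n => _) = cst 0) ?funeqE//; [exact: cvg_cst|move=> n; rewrite big_ord0].
rewrite (_ : (fun n => _) = (fun n =>
    \sum_(i < N) `|cesaro_number (- c) (n - i) / cesaro_number (- c) n - 1|
    + `|cesaro_number (- c) (n - N) / cesaro_number (- c) n - 1|)); last first.
  by apply/funext => n; rewrite big_ord_recr.
rewrite -[X in _ --> X](addr0 0); apply: cvgD => //.
rewrite -[X in _ --> X](normr0 R) -[X in `|X|](subrr 1); apply: cvg_norm.
by apply: cvgB; [exact: cesaro_number_ratio_cvg|exact: cvg_cst].
Qed.

(** The Dirichlet kernel D of length M_l is M_l at the representative 0 and vanishes at the others,
    so convolution with D in both variables reproduces g. The kernels are compared through k1 k2 - D
    D = (k1 - D) k2 + D (k2 - D). The bound is crude in l, but it is used with l fixed. *)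
Lemma vnorm_cesaro_mean_sub n k l g x : (M l <= n.+1)%N -> (M l <= k.+1)%N ->
  0 <= x -> vperiodic2 l g -> (vnorm mu p g <= x%:E)%E ->
  (vnorm mu p (fun z => (sigma n k g z - g z)%R) <=
   ((cesaro_defect a n l * ((M l)%:R + cesaro_defect b k l) + (M l)%:R * cesaro_defect b k l) * x)%:E)%E.
Proof.
move=> ln lk x0 gl gx; have mg := vperiodic2_cmeasurable m_ge2 l g gl.
pose D (c : nat) : R[i] := \sum_(i < M l) vpsi R i (vnat c : G).
have D0 : D 0%N = (M l)%:R.
  rewrite /D (eq_bigr (fun=> 1)) ?sumr_const ?card_ord// => i _.
  by apply: (vpsi_cyl m_ge2 _ l) => //; apply/(vcyl_vnat m_ge2); exact: dvdn0.
have DN (c : 'I_(M l)) : c != 0%N :> nat -> D c = 0.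
  move=> c0; apply: (sum_vpsi m_ge2) => /(vcyl_vnat m_ge2).
  by rewrite gtnNdvd ?lt0n.
have DM c : normc (D c) <= (M l)%:R.
  apply: le_trans (normc_sum _ _ _ _) _.
  rewrite (eq_bigr (fun=> 1)) ?sumr_const ?card_ord// => i _.
  exact: normc_vpsi.
pose k1 (c : nat) := cesaro_kernel a n l (vnat c : G).
pose k2 (c : nat) := cesaro_kernel b k l (vnat c : G).
have gE z : g z = ((M l)%:R * (M l)%:R)^-1 *
   \sum_(c < M l) \sum_(d < M l) D c * D d * g (z - vnat2 c d).
  have Ml0 := vpow_gt0 m_ge2 l.
  rewrite (bigD1 (Ordinal Ml0))//= (bigD1 (Ordinal Ml0))//= D0.
  rewrite big1 ?addr0 => [|d dN]; last first.
    by rewrite (DN d) ?mulr0 ?mul0r//; apply: contra dN => /eqP dN; apply/eqP/val_inj.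
  rewrite big1 ?addr0 => [|c cN]; last first.
    rewrite big1// => d _.
    by rewrite (DN c) ?mul0r ?mul0r//; apply: contra cN => /eqP cN; apply/eqP/val_inj.
  rewrite mulKf ?(natr_vpow_neq0 m_ge2)//.
  rewrite -[RHS](gl _ (vnat2 0 0)) ?subrK//; by apply/(vcyl_vnat m_ge2); exact: dvdn0.
rewrite (_ : (fun z => _ - _) = (fun z => ((M l)%:R * (M l)%:R)^-1 *
   \sum_(c < M l) \sum_(d < M l) (k1 c * k2 d - D c * D d) * g (z - vnat2 c d))); last first.
  apply/funext => z; rewrite (cesaro_mean_periodic m_ge2 mu mu_haar _ _ _ _ _ _ _ gl).
  rewrite [X in _ - X]gE -mulrBr -sumrB; congr (_ * _); apply: eq_bigr => c _.
  by rewrite -sumrB; apply: eq_bigr => d _; rewrite mulrBl.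
apply: le_trans (vnorm_convolution l g (fun c d => k1 c * k2 d - D c * D d) x mg gx) _.
rewrite lee_fin ler_wpM2r//.
set e1 := cesaro_defect a n l; set e2 := cesaro_defect b k l.
have MM0 : 0 < (M l)%:R * (M l)%:R :> R by rewrite -natrM ltr0n muln_gt0 !(vpow_gt0 m_ge2).
rewrite mulrC ler_pdivrMr//.
have step (c d : 'I_(M l)) : normc (k1 c * k2 d - D c * D d) <=
    e1 * ((M l)%:R + e2) + (M l)%:R * e2.
  have h1 : normc (k1 c - D c) <= e1 by exact: normc_cesaro_kernel_defect.
  have h2 : normc (k2 d - D d) <= e2 by exact: normc_cesaro_kernel_defect.
  have h3 : normc (k2 d) <= (M l)%:R + e2.
    rewrite -(subrK (D d) (k2 d)) addrC; apply: le_trans (le_normcD (_ : Rcomplex R) _) _.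
    exact: lerD.
  rewrite (_ : k1 c * k2 d - D c * D d = (k1 c - D c) * k2 d + D c * (k2 d - D d)); last first.
    by rewrite mulrBl mulrBr addrA subrK.
  apply: le_trans (le_normcD (_ : Rcomplex R) _) _; rewrite !Normc.normcM.
  by apply: lerD; apply: ler_pM; rewrite ?normc_ge0.
apply: (@le_trans _ _ (\sum_(c < M l) \sum_(d < M l) (e1 * ((M l)%:R + e2) + (M l)%:R * e2))).
  by apply: ler_sum => c _; apply: ler_sum => d _; exact: step.
by rewrite !sumr_const !card_ord -mulrnA -[leLHS]mulr_natr natrM.
Qed.

End Kernels.
End CesaroOperator.

(** * Tannery's argument in two indices, and the tail of the majorant *)

Section Tannery.
Context {R : realType}.

Lemma sum_ord_le_split (t c : nat -> R) (e1 e2 : R) l0 N : (l0 <= N)%N ->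
  \sum_(l < l0) t l <= e1 -> \sum_(l0 <= l < N) c l <= e2 ->
  (forall l, (l < N)%N -> t l <= c l) -> \sum_(l < N) t l <= e1 + e2.
Proof.
move=> lN h1 h2 tc; rewrite -(big_mkord xpredT t) (big_cat_nat (leq0n l0) lN)/=.
rewrite big_mkord; apply: lerD => //; apply: le_trans h2.
by apply: ler_sum_nat => l /andP[_]; exact: tc.
Qed.

(** Here [L] gives the top level, [c] is the summable majorant below the last two levels, [y] bounds
    the pieces at those two levels, and [u] is the remainder. The last two terms move with n and k
    and escape the majorant, so they need a vanishing bound of their own. *)
Lemma double_tannery (V : nat -> nat -> \bar R) (t : nat -> nat -> nat -> R)
    (L : nat -> nat) (y u c : nat -> R) :
  (forall k, exists N0, forall N, (N0 <= N)%N -> (k < L N)%N) ->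
  (forall n k, (0 < L (maxn n k))%N ->
    (V n k <= (\sum_(l < (L (maxn n k)).+1) t l n k + u (L (maxn n k)))%:E)%E) ->
  (forall l e, 0 < e -> exists N0, forall n k, (N0 <= n)%N -> (N0 <= k)%N -> t l n k <= e) ->
  (forall l n k, (l.+1 < L (maxn n k))%N -> t l n k <= c l) ->
  (forall l n k, (L (maxn n k) <= l.+1)%N -> (l <= L (maxn n k))%N -> t l n k <= y l) ->
  (forall e, 0 < e -> exists l0, forall l, (l0 <= l)%N -> y l <= e) ->
  (forall e, 0 < e -> exists l0, forall l, (l0 <= l)%N -> u l <= e) ->
  (forall e, 0 < e -> exists l0, forall N, \sum_(l0 <= l < N) c l <= e) ->
  forall e, 0 < e -> exists N0, forall n k, (N0 <= n)%N -> (N0 <= k)%N -> (V n k <= e%:E)%E.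
Proof.
move=> Loo VL t0 tc ty y0 u0 c0 e e0.
(* The five shares go to the initial terms, the majorized terms, the two top terms and the
   remainder. *)
have e5 : 0 < e / 5 by rewrite divr_gt0.
have [l0 hc] := c0 _ e5; have [l1 hy] := y0 _ e5; have [l2 hu] := u0 _ e5.
have [N1 ht] : exists N1, forall n k, (N1 <= n)%N -> (N1 <= k)%N ->
    \sum_(l < l0) t l n k <= e / 5.
  (* Equal shares for the l0 initial terms; the successor avoids division by zero. *)
  have el : 0 < e / 5 / l0.+1%:R by rewrite divr_gt0.
  have [N1 hN1] : exists N1, forall l, (l < l0)%N -> forall n k, (N1 <= n)%N -> (N1 <= k)%N ->
      t l n k <= e / 5 / l0.+1%:R.
    move: (e / 5 / _) el => e6 e60.
    elim: (l0) => [|j [N1 IH]]; first by exists 0%N.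
    have [N2 h2] := t0 j _ e60; exists (maxn N1 N2) => l.
    rewrite ltnS leq_eqVlt => /predU1P[->|lj] n k; rewrite !geq_max => /andP[n1 n2] /andP[k1 k2].
      exact: h2.
    exact: IH.
  exists N1 => n k hn hk.
  apply: (@le_trans _ _ (\sum_(l < l0) (e / 5 / l0.+1%:R))).
    by apply: ler_sum => l _; exact: hN1.
  rewrite sumr_const card_ord -[_ *+ l0]mulr_natr mulrAC ler_pdivrMr//.
  by rewrite ler_wpM2l// ?ler_nat// ltW.
have [N2 hN2] := Loo (l0 + l1 + l2).+1.
exists (maxn N1 N2) => n k; rewrite !geq_max => /andP[n1 n2] /andP[k1 k2].
have hL : ((l0 + l1 + l2).+1 < L (maxn n k))%N by apply: hN2; rewrite (leq_trans n2)// leq_maxl.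
apply: le_trans (VL n k _) _; first by rewrite (leq_trans _ hL).
case E : (L (maxn n k)) hL => [//|K] hL; rewrite lee_fin.
rewrite 2!big_ord_recr/=.
have h1 : \sum_(l < K) t l n k <= e / 5 + e / 5.
  apply: (sum_ord_le_split (fun l => t l n k) c _ _ l0); first by lia.
  - exact: ht.
  - exact: hc.
  - by move=> l lK; apply: tc; rewrite E ltnS.
have h2 : t K n k <= e / 5.
  by apply: le_trans (ty K n k _ _) (hy _ _); rewrite ?E//; lia.
have h3 : t K.+1 n k <= e / 5.
  by apply: le_trans (ty K.+1 n k _ _) (hy _ _); rewrite ?E//; lia.
have h4 : u K.+1 <= e / 5 by apply: hu; lia.
have -> : e = e / 5 + e / 5 + e / 5 + e / 5 + e / 5 by field.
by rewrite !lerD.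
Qed.

Lemma summable_tail (q : R) (e : R) : 0 < q < 1 -> 0 < e -> exists l0, forall N,
  \sum_(l0 <= l < N) l.+1%:R ^+ 2 * q ^+ l <= e.
Proof.
move=> /andP[q0 q1] e0.
(* With s = 1 / w and h = s - 1, Bernoulli gives l + 1 <= (1 + 1 / h) s^l. Since q = s^(-4),
   squaring spends half of the decay: (l + 1)^2 q^l <= H r^l with r = s^(-2), a geometric series. *)
pose w := q `^ 4^-1.
have w0 : 0 < w by exact: powR_gt0.
have one : 1 `^ 4^-1 = 1 :> R by rewrite powR1.
have w1 : w < 1.
  rewrite -[X in _ < X]one; apply: gt0_ltr_powR; rewrite ?nnegrE ?invr_gt0//.
  exact: ltW.
have wq : w ^+ 4 = q.
  by rewrite -powR_mulrn ?powR_ge0// -powRrM mulVf ?powRr1 ?(ltW q0)// pnatr_eq0.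
pose s := w^-1.
have s1 : 1 < s by rewrite /s invf_gt1.
have sq : s ^+ 4 * q = 1 by rewrite -wq exprVn mulVf// expf_neq0// gt_eqF.
pose r := s ^- 2.
have r0 : 0 < r by rewrite invr_gt0 exprn_gt0// (lt_trans _ s1).
have r1 : r < 1 by rewrite invf_lt1 ?exprn_gt0 ?(lt_trans _ s1)// exprn_egt1.
pose h := s - 1; have h0 : 0 < h by rewrite subr_gt0.
pose H := (1 + h^-1) ^+ 2.
have H0 : 0 < H by rewrite exprn_gt0// addr_gt0// invr_gt0.
have bern l : 1 + h * l%:R <= s ^+ l.
  elim: l => [|l IH]; first by rewrite mulr0 addr0 expr0.
  rewrite exprS; have sE : s = 1 + h by rewrite addrC subrK.
  apply: (@le_trans _ _ (s * (1 + h * l%:R))); last first.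
    by rewrite ler_wpM2l// ltW// (lt_trans _ s1).
  rewrite sE -[l.+1%:R]natr1; have l00 : 0 <= l%:R :> R by [].
  have -> : (1 + h) * (1 + h * l%:R) = 1 + h * (l%:R + 1) + h * h * l%:R by ring.
  by rewrite lerDl !mulr_ge0// ltW.
have bnd l : l.+1%:R ^+ 2 * q ^+ l <= H * r ^+ l.
  have hl : l.+1%:R <= (1 + h^-1) * s ^+ l.
    apply: (@le_trans _ _ ((1 + h^-1) * (1 + h * l%:R))); last first.
      by rewrite ler_wpM2l// addr_ge0// invr_ge0 ltW.
    have -> : (1 + h^-1) * (1 + h * l%:R) = l%:R + 1 + (h^-1 + h * l%:R).
      by field; rewrite gt_eqF.
    by rewrite -[l.+1%:R]natr1 lerDl addr_ge0 ?invr_ge0 ?mulr_ge0// ltW.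
  have hl2 : l.+1%:R ^+ 2 <= H * (s ^+ 2) ^+ l.
    rewrite /H -exprM mulnC exprM -exprMn !expr2; apply: ler_pM => //.
  apply: le_trans (ler_wpM2r (exprn_ge0 l (ltW q0)) hl2) _.
  rewrite -mulrA ler_wpM2l ?(ltW H0)// -exprMn.
  have -> : s ^+ 2 * q = r.
    have s20 : s ^+ 2 != 0 by rewrite expf_neq0// gt_eqF// (lt_trans _ s1).
    by apply: (mulfI s20); rewrite /r mulfV// mulrA -exprD; exact: sq.
  by [].
have r1' : 0 < 1 - r by rewrite subr_gt0.
have [l0 hl0] : exists l0, H * r ^+ l0 / (1 - r) <= e.
  have : r ^+ n @[n --> \oo] --> (0 : R) by apply: cvg_expr; rewrite gtr0_norm.
  have d0 : 0 < e * (1 - r) / H by apply: divr_gt0 => //; exact: mulr_gt0.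
  move=> /cvgrPdist_le /(_ _ d0).
  move=> [l0 _ /(_ l0 (leqnn _))] /=; rewrite sub0r normrN ger0_norm ?exprn_ge0 ?(ltW r0)//.
  by move=> hl; exists l0; rewrite ler_pdivrMr// mulrC -ler_pdivlMr.
exists l0 => N; apply: le_trans hl0.
apply: (@le_trans _ _ (\sum_(l0 <= l < N) H * r ^+ l)).
  by apply: ler_sum => l _; exact: bnd.
rewrite -mulr_sumr -mulrA ler_wpM2l ?(ltW H0)// ler_pdivlMr//.
have [Nl|lN] := leqP N l0.
  by rewrite big_geq// mul0r exprn_ge0// ltW.
have geo k : (\sum_(i < k) r ^+ (i + l0)) * (1 - r) = r ^+ l0 - r ^+ (k + l0).
  elim: k => [|k IH]; first by rewrite big_ord0 mul0r subrr.
  by rewrite big_ord_recr/= mulrDl IH addSn exprS; ring.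
rewrite -{1}[l0]add0n big_addn big_mkord geo gerBl.
by rewrite exprn_ge0// ltW.
Qed.

End Tannery.

(** * The telescoped error and its pieces *)

Section Convergence.
Context {R : realType} {m : nat -> nat} (m_ge2 : forall k, (2 <= m k)%N).
Local Notation M := (vpow m).
Local Notation G := (vilenkin m).
Local Notation G2 := (G * G)%type.
Context (mu : probability G2 R) (mu_haar : haar mu).
Context (p : \bar R) (p_ge1 : (1 <= p)%E).
Context (f : G2 -> R[i]) (f_Lp : in_Lp mu p f).
Context (a b : R) (a01 : 0 < a < 1) (b01 : 0 < b < 1).
Local Notation sigma := (cesaro_mean mu (- a) (- b)).
Local Notation u := (fun n => fine (total_modulus mu p f n)).
Local Notation lebesgue := (@cesaro_lebesgue R m).

Lemma cesaro_mean_vperiodic n k l (g : G2 -> R[i]) : vperiodic2 l g -> vperiodic2 l (sigma n k g).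
Proof.
move=> gl z w h1 h2; rewrite !(cesaro_mean_periodic m_ge2 mu mu_haar _ _ _ _ _ _ _ gl).
congr (_ * _); apply: eq_bigr => c _; apply: eq_bigr => d _; congr (_ * _).
by rewrite addrAC; exact: gl.
Qed.

Definition vpiece (l : nat) : G2 -> R[i] :=
  if l is k.+1 then (fun z => vavg mu l f z - vavg mu k f z) else vavg mu 0 f.

Lemma vpiece_periodic l : vperiodic2 l (vpiece l).
Proof.
case: l => [|l] /=; first exact: vavg_periodic.
move=> z w h1 h2; rewrite (vavg_periodic mu l.+1 f z w h1 h2).
by rewrite (le_vperiodic2 l l.+1 _ (leqnSn l) (vavg_periodic mu l f) z w h1 h2).
Qed.

(** Each average is within twice the modulus at its level from f; level 0 has no predecessor to
    subtract, so the norm of f itself enters. *)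
Definition vpiece_bound (l : nat) : R :=
  if l is k.+1 then 2 * u l + 2 * u k else fine (vnorm mu p f) + 2 * u 0%N.

Lemma vpiece_bound_ge0 l : 0 <= vpiece_bound l.
Proof.
have u0 := modulus_ge0 mu p p_ge1 f.
case: l => [|l] /=; apply: addr_ge0; rewrite ?mulr_ge0//.
by apply: fine_ge0; exact: vnorm_ge0.
Qed.

Let fi := in_Lp_cintegrable m_ge2 mu p p_ge1 f f_Lp.
Let mf := cmeasurable_integrable mu f fi.
Let mavg l : cmeasurable (vavg mu l f) := vperiodic2_cmeasurable m_ge2 l _ (vavg_periodic mu l f).

Lemma vnorm_vpiece l : (vnorm mu p (vpiece l) <= (vpiece_bound l)%:E)%E.
Proof.
have hv j := vnorm_vavg_modulus m_ge2 mu mu_haar p p_ge1 f j f_Lp.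
have md j : cmeasurable (fun z => vavg mu j f z - f z) := cmeasurableB _ _ (mavg j) mf.
case: l => [|l].
  rewrite (_ : vpiece 0 = (fun z => f z + (vavg mu 0 f z - f z))); last first.
    by apply/funext => z /=; rewrite addrC subrK.
  apply: le_trans (vnormD mu p p_ge1 _ _ mf (md 0%N)) _.
  rewrite /vpiece_bound EFinD fineK; first by apply: leeD.
  by rewrite ge0_fin_numE ?vnorm_ge0// (in_Lp_vnorm_lty mu p p_ge1).
rewrite (_ : vpiece l.+1 = (fun z => (vavg mu l.+1 f z - f z) + (-1) * (vavg mu l f z - f z))); last first.
  by apply/funext => z /=; rewrite mulN1r opprB addrA subrK.
apply: le_trans (vnormD mu p p_ge1 _ _ (md l.+1) (cmeasurableZ (-1) _ (md l))) _.
rewrite (vnormZ mu p p_ge1 _ _ (md l)) (normcN (1 : Rcomplex R)) Normc.normc1 mul1e.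
by rewrite /vpiece_bound EFinD; apply: leeD.
Qed.

Let mpiece n k l : cmeasurable (fun z => sigma n k (vpiece l) z - vpiece l z).
Proof.
apply: (vperiodic2_cmeasurable m_ge2 l) => z w h1 h2.
by rewrite (cesaro_mean_vperiodic n k l _ (vpiece_periodic l) z w h1 h2) (vpiece_periodic l z w h1 h2).
Qed.

Lemma vnorm_cesaro_vpiece_sub n k l :
  (vnorm mu p (fun z => (sigma n k (vpiece l) z - vpiece l z)%R) <=
   ((lebesgue a n l * lebesgue b k l + 1) * vpiece_bound l)%:E)%E.
Proof.
have hl := vpiece_periodic l.
have mg := vperiodic2_cmeasurable m_ge2 l _ hl.
have ms := vperiodic2_cmeasurable m_ge2 l _ (cesaro_mean_vperiodic n k l _ hl).
rewrite (_ : (fun z => _ - _) = (fun z => sigma n k (vpiece l) z + (-1) * vpiece l z)); last first.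
  by apply/funext => z; rewrite mulN1r.
apply: le_trans (vnormD mu p p_ge1 _ _ ms (cmeasurableZ (-1) _ mg)) _.
rewrite (vnormZ mu p p_ge1 _ _ mg) (normcN (1 : Rcomplex R)) Normc.normc1 mul1e.
rewrite mulrDl mul1r EFinD; apply: leeD; last exact: vnorm_vpiece.
exact: (vnorm_cesaro_mean m_ge2 mu mu_haar p p_ge1 a b n k l _ _ hl (vnorm_vpiece l)).
Qed.

Definition vpiece_error (l n k : nat) : R :=
  fine (vnorm mu p (fun z => sigma n k (vpiece l) z - vpiece l z)).

Lemma vpiece_errorE l n k :
  vnorm mu p (fun z => sigma n k (vpiece l) z - vpiece l z) = (vpiece_error l n k)%:E.
Proof.
rewrite /vpiece_error fineK// ge0_fin_numE ?vnorm_ge0//.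
by apply: le_lt_trans (vnorm_cesaro_vpiece_sub n k l) _; exact: ltry.
Qed.

Lemma vpiece_error_le l n k :
  vpiece_error l n k <= (lebesgue a n l * lebesgue b k l + 1) * vpiece_bound l.
Proof. by rewrite -lee_fin -vpiece_errorE vnorm_cesaro_vpiece_sub. Qed.

Lemma vpiece_error_cvg l e : 0 < e ->
  exists N0, forall n k, (N0 <= n)%N -> (N0 <= k)%N -> vpiece_error l n k <= e.
Proof.
move=> e0; have x0 := vpiece_bound_ge0 l; set x := vpiece_bound l in x0.
(* Using x + 1 keeps K positive when x = 0. The choice d <= 1 lets the product of the two defects be
   absorbed, giving the factor 2 M_l + 1. *)
pose K : R := (2 * (M l)%:R + 1) * (x + 1).
have K0 : 0 < K by rewrite mulr_gt0// ltr_wpDl// mulr_ge0.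
pose d := Num.min 1 (e / K).
have d0 : 0 < d by rewrite lt_min ltr01 divr_gt0.
have [N1 h1] : exists N, forall n, (N <= n)%N -> @cesaro_defect R m a n l <= d.
  have /cvgrPdist_le /(_ _ d0) [N _ hN] := @cesaro_defect_cvg R m a l a01.
  by exists N => n /hN /=; rewrite sub0r normrN ger0_norm ?cesaro_defect_ge0.
have [N2 h2] : exists N, forall n, (N <= n)%N -> @cesaro_defect R m b n l <= d.
  have /cvgrPdist_le /(_ _ d0) [N _ hN] := @cesaro_defect_cvg R m b l b01.
  by exists N => n /hN /=; rewrite sub0r normrN ger0_norm ?cesaro_defect_ge0.
exists (maxn (M l) (maxn N1 N2)) => n k.
rewrite !geq_max => /and3P[n0 n1 n2] /and3P[k0 k1 k2].
rewrite -lee_fin -vpiece_errorE.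
apply: le_trans (vnorm_cesaro_mean_sub m_ge2 mu mu_haar p p_ge1 a b n k l (vpiece l) x
  (leqW n0) (leqW k0) x0 (vpiece_periodic l) (vnorm_vpiece l)) _.
rewrite lee_fin.
have := h1 n n1; have := h2 k k2.
have := @cesaro_defect_ge0 R m a n l; have := @cesaro_defect_ge0 R m b k l.
move: (cesaro_defect a n l) (cesaro_defect b k l) => e1 e2 e20 e10 e2d e1d.
have M0 : 0 <= (M l)%:R :> R by [].
have d1 : d <= 1 by rewrite ge_min lexx.
have dK : d * K <= e by rewrite -ler_pdivlMr// ge_min lexx orbT.
apply: le_trans dK.
apply: (@le_trans _ _ ((d * ((M l)%:R + 1) + (M l)%:R * d) * x)).
  rewrite ler_wpM2r// lerD//; last by rewrite ler_wpM2l.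
  by apply: ler_pM => //; rewrite ?addr_ge0// lerD2l (le_trans e2d).
have -> : d * ((M l)%:R + 1) + (M l)%:R * d = d * (2 * (M l)%:R + 1) by ring.
rewrite /K mulrA ler_wpM2l//; first by rewrite mulr_ge0 ?(ltW d0)// addr_ge0// mulr_ge0.
by rewrite lerDl.
Qed.

Lemma vnorm_cesaro_vavg_sub n k L :
  (vnorm mu p (fun z => (sigma n k (vavg mu L f) z - vavg mu L f z)%R) <=
   (\sum_(l < L.+1) vpiece_error l n k)%:E)%E.
Proof.
elim: L => [|L IH]; first by rewrite big_ord1 -vpiece_errorE.
rewrite big_ord_recr/= EFinD -vpiece_errorE.
have pL := vavg_periodic mu L f; have ip := vperiodic2_cintegrable m_ge2 mu L _ pL.
have iq := vperiodic2_cintegrable m_ge2 mu L.+1 _ (vpiece_periodic L.+1).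
have E : vavg mu L.+1 f = (fun z => vavg mu L f z + vpiece L.+1 z).
  by apply/funext => z /=; rewrite addrC subrK.
rewrite (_ : (fun z => _ - _) = (fun z => (sigma n k (vavg mu L f) z - vavg mu L f z) +
    (sigma n k (vpiece L.+1) z - vpiece L.+1 z))); last first.
  rewrite {1}E (cesaro_meanD m_ge2 mu _ _ n k _ _ ip iq); apply/funext => z.
  by rewrite {1}E opprD addrACA.
have ms : cmeasurable (fun z => sigma n k (vavg mu L f) z - vavg mu L f z).
  apply: (vperiodic2_cmeasurable m_ge2 L) => z w h1 h2.
  by rewrite (cesaro_mean_vperiodic n k L _ pL z w h1 h2) (pL z w h1 h2).
apply: le_trans (vnormD mu p p_ge1 _ _ ms (mpiece n k L.+1)) _.
exact: leeD.
Qed.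

Lemma vnorm_cesaro_sub n k L : (n < M L)%N -> (k < M L)%N ->
  (vnorm mu p (fun z => (sigma n k f z - f z)%R) <=
   (\sum_(l < L.+1) vpiece_error l n k + 2 * u L)%:E)%E.
Proof.
move=> nL kL; have pL := vavg_periodic mu L f.
rewrite (_ : (fun z => _ - _) = (fun z => (sigma n k (vavg mu L f) z - vavg mu L f z) +
    (vavg mu L f z - f z))); last first.
  by apply/funext => z; rewrite (cesaro_mean_vavg m_ge2 mu mu_haar _ _ _ _ _ _ fi nL kL) addrA subrK.
have ms : cmeasurable (fun z => sigma n k (vavg mu L f) z - vavg mu L f z).
  apply: (vperiodic2_cmeasurable m_ge2 L) => z w h1 h2.
  by rewrite (cesaro_mean_vperiodic n k L _ pL z w h1 h2) (pL z w h1 h2).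
apply: le_trans (vnormD mu p p_ge1 _ _ ms (cmeasurableB _ _ (mavg L) mf)) _.
rewrite EFinD; apply: leeD; first exact: vnorm_cesaro_vavg_sub.
exact: vnorm_vavg_modulus.
Qed.

End Convergence.

(** * The least level resolving given frequencies *)

Section Level.
Context {m : nat -> nat} (m_ge2 : forall k, (2 <= m k)%N).
Local Notation M := (vpow m).

Let exists_level N : exists L, (N < M L)%N.
Proof. by exists N; exact: ltn_vpow. Qed.

Definition vlevel N := ex_minn (exists_level N).

Lemma vlevel_gt N : (N < M (vlevel N))%N.
Proof. by rewrite /vlevel; case: ex_minnP. Qed.

Lemma vlevel_le N l : (l < vlevel N)%N -> (M l <= N)%N.
Proof.
rewrite /vlevel; case: ex_minnP => L _ hL lL.
by rewrite leqNgt; apply: contraL lL => /hL; rewrite -leqNgt.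
Qed.

Lemma lt_vlevel k N : (M k <= N)%N -> (k < vlevel N)%N.
Proof.
move=> kN; rewrite ltnNge; apply: contraL kN => h; rewrite -ltnNge.
by apply: leq_trans (vlevel_gt N) (leq_vpow m_ge2 _ _ h).
Qed.

End Level.

(** * Kernel norms in all regimes, with a common constant *)

Section LebesgueConstants.
Context {R : realType} {m : nat -> nat} (m_ge2 : forall k, (2 <= m k)%N).
Context (B : nat) (m_le : forall k, (m k <= B)%N).
Local Notation M := (vpow m).
Local Notation lebesgue := (@cesaro_lebesgue R m).

Lemma vpow_powR_ge1 (c : R) l : 0 <= c -> 1 <= (M l)%:R `^ c.
Proof.
move=> c0; have M1 : 1 <= (M l)%:R :> R by rewrite ler1n vpow_gt0.
by have := ler_powR M1 c0; rewrite powRr0.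
Qed.

(** The last bound is free of n: if 2 M_l <= n the kernel costs only O(l + 1), and otherwise n + 1
    <= 2 M_l, so that the growth n^c turns into a power of M_l. *)
Lemma cesaro_lebesgue_bound (c : R) : 0 < c < 1 -> exists2 C : R, 0 < C &
  [/\ forall n l, lebesgue c n l <= C * n.+1%:R `^ c,
      forall n l, (2 * M l <= n)%N -> lebesgue c n l <= C * l.+1%:R &
      forall n l, lebesgue c n l <= C * l.+1%:R * (M l)%:R `^ c].
Proof.
move=> c01; have /andP[c0 c1] := c01.
have [C1 C10 h1] := cesaro_lebesgue_le m_ge2 c c01 B m_le.
have [C2 C20 h2] := cesaro_lebesgue_le_smooth m_ge2 c c01 B m_le.
have C0 : 0 < 2 * C1 + C2 by rewrite addr_gt0// mulr_gt0.
exists (2 * C1 + C2) => //.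
have H1 n l : lebesgue c n l <= (2 * C1 + C2) * n.+1%:R `^ c.
  by apply: le_trans (h1 n l) _; rewrite ler_wpM2r ?powR_ge0//; lra.
have H2 n l : (2 * M l <= n)%N -> lebesgue c n l <= (2 * C1 + C2) * l.+1%:R.
  by move=> ln; apply: le_trans (h2 n l ln) _; rewrite ler_wpM2r//; lra.
split => // n l.
have [ln|nl] := leqP (2 * M l) n.
  apply: le_trans (H2 n l ln) _; rewrite ler_peMr//.
    by rewrite mulr_ge0// ltW.
  by apply: vpow_powR_ge1; exact: ltW.
apply: le_trans (h1 n l) _.
apply: (@le_trans _ _ (C1 * (2 * (M l)%:R `^ c))).
  rewrite ler_wpM2l ?(ltW C10)//.
  apply: (@le_trans _ _ ((2 * (M l)%:R) `^ c)).
    by rewrite ge0_ler_powR ?nnegrE ?(ltW c0)// -natrM ler_nat.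
  rewrite powRM// ler_wpM2r ?powR_ge0// -[leRHS]powRr1//.
  by rewrite ler_powR ?ler1n// (ltW c1).
rewrite mulrA ler_wpM2r ?powR_ge0//.
apply: (@le_trans _ _ (2 * C1 + C2)); first by lra.
by rewrite ler_peMr ?(ltW C0)// ler1n.
Qed.

End LebesgueConstants.

(** * Products of kernel norms below and near the top level *)

Section Rates.
Context {R : realType} {m : nat -> nat} (m_ge2 : forall k, (2 <= m k)%N).
Context (B : nat) (m_le : forall k, (m k <= B)%N).
Local Notation M := (vpow m).
Context (a b : R) (a01 : 0 < a < 1) (b01 : 0 < b < 1).
Local Notation lebesgue := (@cesaro_lebesgue R m).

Let d := Num.min a b.

(** An index that is at least 2 M_l pays l + 1; the other one pays l + 1 and its own power of M_l,
    whatever its size. Either power is at most max (a, b) = a + b - d. *)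
Lemma lebesgue_product_low : exists2 C : R, 0 < C & forall n k l, (2 * M l <= maxn n k)%N ->
  lebesgue a n l * lebesgue b k l <= C * l.+1%:R ^+ 2 * (M l)%:R `^ (a + b - d).
Proof.
case/andP: (a01) => a0 a1; case/andP: (b01) => b0 b1.
have [C1 C10 [_ h1 h1']] := cesaro_lebesgue_bound m_ge2 B m_le a a01.
have [C2 C20 [_ h2 h2']] := cesaro_lebesgue_bound m_ge2 B m_le b b01.
exists (C1 * C2); first exact: mulr_gt0.
move=> n k l; have M1 : 1 <= (M l)%:R :> R by rewrite ler1n vpow_gt0.
have da : d <= a by rewrite ge_min lexx.
have db : d <= b by rewrite ge_min lexx orbT.
have pa : (M l)%:R `^ a <= (M l)%:R `^ (a + b - d) by apply: ler_powR => //; lra.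
have pb : (M l)%:R `^ b <= (M l)%:R `^ (a + b - d) by apply: ler_powR => //; lra.
have L0 c n' : 0 <= lebesgue c n' l := cesaro_lebesgue_ge0 c n' l.
rewrite leq_max => /orP[hn|hk].
  apply: le_trans (ler_pM (L0 _ _) (L0 _ _) (h1 n l hn) (h2' k l)) _.
  rewrite expr2 [leLHS](_ : _ = C1 * C2 * (l.+1%:R * l.+1%:R) * (M l)%:R `^ b); last by ring.
  by rewrite ler_wpM2l// !mulr_ge0// ltW.
apply: le_trans (ler_pM (L0 _ _) (L0 _ _) (h1' n l) (h2 k l hk)) _.
rewrite expr2 [leLHS](_ : _ = C1 * C2 * (l.+1%:R * l.+1%:R) * (M l)%:R `^ a); last by ring.
by rewrite ler_wpM2l// !mulr_ge0// ltW.
Qed.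

(** Both indices are below B M_l, so the growth in n and in k is a power of M_l up to a constant.
    The factor B makes room for the level just below the top, where only M_(l+1) exceeds both
    indices. *)
Lemma lebesgue_product_high : exists2 C : R, 0 < C & forall n k l, (maxn n k < B * M l)%N ->
  lebesgue a n l * lebesgue b k l <= C * (M l)%:R `^ (a + b).
Proof.
case/andP: (a01) => a0 a1; case/andP: (b01) => b0 b1.
have [C1 C10 [h1 _ _]] := cesaro_lebesgue_bound m_ge2 B m_le a a01.
have [C2 C20 [h2 _ _]] := cesaro_lebesgue_bound m_ge2 B m_le b b01.
have B0 : (0 < B)%N by rewrite (leq_trans _ (m_le 0%N))// (leq_trans _ (m_ge2 0%N)).
exists (C1 * C2 * B%:R `^ (a + b)).
  by rewrite !mulr_gt0// powR_gt0// ltr0n.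
move=> n k l; rewrite gtn_max => /andP[hn hk].
have L0 c n' : 0 <= lebesgue c n' l := cesaro_lebesgue_ge0 c n' l.
apply: le_trans (ler_pM (L0 _ _) (L0 _ _) (h1 n l) (h2 k l)) _.
have pn (c : R) n' : 0 < c -> (n' < B * M l)%N -> n'.+1%:R `^ c <= (B%:R * (M l)%:R) `^ c.
  by move=> c0 h; rewrite ge0_ler_powR ?nnegrE ?(ltW c0) ?mulr_ge0// -natrM ler_nat.
apply: (@le_trans _ _ (C1 * C2 * ((B%:R * (M l)%:R) `^ a * (B%:R * (M l)%:R) `^ b))).
  rewrite mulrACA ler_wpM2l ?mulr_ge0 ?(ltW C10) ?(ltW C20)//.
  by apply: ler_pM; rewrite ?powR_ge0//; apply: pn.
rewrite -powRD; last by apply/implyP => _; rewrite -natrM pnatr_eq0 muln_eq0 negb_or -!lt0n B0 vpow_gt0.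
by rewrite powRM// mulrA.
Qed.

End Rates.

(* [fine] loses nothing in the hypothesis: for f in L^p the modulus is at most
   twice the norm of f, hence finite. *)
Theorem corollary2 (R : realType) (m : nat -> nat)
  (m_ge2 : forall k, (2 <= m k)%N)
  (m_bounded : exists B : nat, forall k, (m k <= B)%N)
  (mu : probability (vilenkin m * vilenkin m)%type R) (mu_haar : haar mu)
  (p : \bar R) (p_ge1 : (1 <= p)%E)
  (f : vilenkin m * vilenkin m -> R[i]) (f_Lp : in_Lp mu p f)
  (alpha beta : R) (alpha01 : 0 < alpha < 1) (beta01 : 0 < beta < 1)
  (alpha_beta : alpha + beta < 1)
  (f_modulus : (fun n => fine (total_modulus mu p f n)) =o_\oo
               (fun n => ((vpow m n)%:R^-1 : R) `^ (alpha + beta))) :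
  vnorm mu p (fun z => cesaro_mean mu (- alpha) (- beta) nk.1 nk.2 f z - f z)
    @[nk --> (\oo, \oo)] --> 0%E.
Proof.
have [B m_le] := m_bounded.
case/andP: (alpha01) => a0 a1; case/andP: (beta01) => b0 b1.
pose u n := fine (total_modulus mu p f n).
have u0 n : 0 <= u n := modulus_ge0 mu p p_ge1 f n.
pose w n : R := (vpow m n)%:R `^ (alpha + beta).
have M0 n : 0 < (vpow m n)%:R :> R by rewrite ltr0n vpow_gt0.
have w1 n : 1 <= w n by apply: vpow_powR_ge1 => //; rewrite addr_ge0 ?ltW.
have w0 n : 0 < w n by exact: lt_le_trans (w1 n).
(* The hypothesis in product form: w l is the reciprocal of the comparison sequence. *)
have wu e : 0 < e -> exists l0, forall l, (l0 <= l)%N -> w l * u l <= e.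
  move=> e0; have /eqoP /(_ _ e0) [l0 _ hl0] := f_modulus.
  exists l0 => l /hl0 /=; rewrite ger0_norm ?u0// ger0_norm ?powR_ge0//.
  rewrite -powR_inv1 ?(ltW (M0 l))// -powRrM mulN1r powRN -/(w l) => h.
  by rewrite mulrC -ler_pdivlMr.
pose x := vpiece_bound mu p f.
have x0 l : 0 <= x l := vpiece_bound_ge0 mu p p_ge1 f l.
(* Boundedness of m makes consecutive weights comparable, as required because the piece of level l +
   1 also involves the modulus at level l. *)
have Bw l : w l.+1 <= B%:R `^ (alpha + beta) * w l.
  rewrite /w -powRM// ge0_ler_powR ?nnegrE ?mulr_ge0 ?addr_ge0 ?(ltW a0) ?(ltW b0)//.
  by rewrite -natrM ler_nat leq_mul2r m_le orbT.
pose K := B%:R `^ (alpha + beta) : R.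
have K0 : 0 <= K := powR_ge0 _ _.
have wx e : 0 < e -> exists l0, forall l, (l0 <= l)%N -> w l * x l <= e.
  (* The denominator is the sum of the coefficients 2 and 2 K below. Starting at l0 + 1 excludes
     level 0, whose bound has another form. *)
  move=> e0; have e10 : 0 < e / (2 * (1 + K)).
    by rewrite divr_gt0// mulr_gt0// ltr_pwDl.
  have [l0 h] := wu _ e10; exists l0.+1 => -[//|l] l0l.
  have hl := h l l0l; have hl1 := h l.+1 (leqW l0l).
  rewrite /x /vpiece_bound -/(u l) -/(u l.+1).
  apply: (@le_trans _ _ (2 * (w l.+1 * u l.+1) + 2 * K * (w l * u l))).
    rewrite mulrDr mulrCA; rewrite lerD2l mulrCA -!mulrA ler_wpM2l//.
    by rewrite mulrA ler_wpM2r.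
  apply: (@le_trans _ _ (2 * (e / (2 * (1 + K))) + 2 * K * (e / (2 * (1 + K))))).
    by apply: lerD; rewrite ler_wpM2l// mulr_ge0.
  rewrite le_eqVlt; apply/orP; left; apply/eqP; field.
  by rewrite gt_eqF// ltr_pwDl.
(* Below the last two levels only boundedness of w l * x l is used; its smallness is used at those
   levels. *)
have [Y Y0 hY] : exists2 Y, 0 <= Y & forall l, w l * x l <= Y.
  have [l0 hl0] := wx 1 ltr01.
  exists (1 + \sum_(l < l0) w l * x l) => [|l].
    by rewrite addr_ge0// sumr_ge0// => l _; rewrite mulr_ge0// ltW.
  have [ll|ll] := leqP l0 l.
    apply: le_trans (hl0 l ll) _; rewrite lerDl sumr_ge0// => i _.
    by rewrite mulr_ge0// ltW.
  rewrite (bigD1 (Ordinal ll))//= addrCA lerDl addr_ge0// sumr_ge0// => i _.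
  by rewrite mulr_ge0// ltW.
have [C1 C10 low] := lebesgue_product_low m_ge2 B m_le alpha beta alpha01 beta01.
have [C2 C20 high] := lebesgue_product_high m_ge2 B m_le alpha beta alpha01 beta01.
pose d := Num.min alpha beta.
have d0 : 0 < d by rewrite lt_min a0 b0.
(* Since M_l >= 2^l, the saved factor M_l^(-d) is at most q^l. *)
pose q : R := (2 `^ d)^-1.
have q0 : 0 < q by rewrite invr_gt0 powR_gt0.
have q1 : q < 1.
  rewrite invf_lt1 ?powR_gt0// -[X in X < _](powRr0 2).
  by rewrite /powR !ifF ?pnatr_eq0// ltr_expR ltr_pM2r// ln_gt0// ltr1n.
pose t := vpiece_error mu p f alpha beta.
have main : forall e, 0 < e -> exists N0, forall n k, (N0 <= n)%N -> (N0 <= k)%N ->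
    (vnorm mu p (fun z => cesaro_mean mu (- alpha) (- beta) n k f z - f z)%R <= e%:E)%E.
  (* In C1 + 1 and C2 + 1 the added 1 pays for subtracting the piece itself from its mean; it is
     absorbed because the factors beside the constants are at least 1. *)
  apply: (@double_tannery R _ t (vlevel m_ge2) (fun l => (C2 + 1) * (w l * x l))
    (fun l => 2 * u l) (fun l => (C1 + 1) * Y * (l.+1%:R ^+ 2 * q ^+ l))).
  - by move=> k; exists (vpow m k) => N; exact: lt_vlevel.
  - move=> n k _; have hL := vlevel_gt m_ge2 (maxn n k).
    apply: (vnorm_cesaro_sub m_ge2 mu mu_haar p p_ge1 f f_Lp).
      by apply: leq_ltn_trans hL; exact: leq_maxl.
    by apply: leq_ltn_trans hL; exact: leq_maxr.
  - by move=> l e e0; exact: (vpiece_error_cvg m_ge2 mu mu_haar p p_ge1 f f_Lp).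
  - move=> l n k hl.
    have h2 : (2 * vpow m l <= maxn n k)%N.
      exact: leq_trans (vpow_double m_ge2 l) (vlevel_le m_ge2 _ _ hl).
    apply: le_trans (vpiece_error_le m_ge2 mu mu_haar p p_ge1 f f_Lp _ _ l n k) _.
    have l1 : 1 <= l.+1%:R ^+ 2 :> R by rewrite exprn_ege1// ler1n.
    have v1 : 1 <= (vpow m l)%:R `^ (alpha + beta - d) :> R.
      apply: vpow_powR_ge1 => //; rewrite subr_ge0 (@le_trans _ _ alpha)//.
        by rewrite ge_min lexx.
      by rewrite lerDl ltW.
    have h3 : @cesaro_lebesgue R m alpha n l * @cesaro_lebesgue R m beta k l + 1 <=
        (C1 + 1) * l.+1%:R ^+ 2 * (vpow m l)%:R `^ (alpha + beta - d).
      apply: le_trans (lerD (low n k l h2) (lexx 1)) _.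
      rewrite [leRHS](_ : _ = C1 * l.+1%:R ^+ 2 * (vpow m l)%:R `^ (alpha + beta - d) +
        l.+1%:R ^+ 2 * (vpow m l)%:R `^ (alpha + beta - d)); last by ring.
      by rewrite lerD2l -[leLHS]mulr1 ler_pM.
    apply: le_trans (ler_wpM2r (x0 l) h3) _.
    rewrite powRB; last by apply/implyP => _; rewrite gt_eqF.
    have mq : ((vpow m l)%:R `^ d)^-1 <= q ^+ l.
      rewrite exprVn lef_pV2 ?posrE ?powR_gt0 ?exprn_gt0 ?powR_gt0//.
      rewrite -powR_mulrn ?powR_ge0// -powRrM mulrC powRrM powR_mulrn// -natrX.
      by rewrite ge0_ler_powR ?nnegrE ?ler0n ?(ltW d0)// ler_nat (expn2_le_vpow m_ge2).
    rewrite -/(w l).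
    have -> : (C1 + 1) * l.+1%:R ^+ 2 * (w l / (vpow m l)%:R `^ d) * x l =
       (C1 + 1) * l.+1%:R ^+ 2 * ((w l * x l) * ((vpow m l)%:R `^ d)^-1) by ring.
    have -> : (C1 + 1) * Y * (l.+1%:R ^+ 2 * q ^+ l) =
       (C1 + 1) * l.+1%:R ^+ 2 * (Y * q ^+ l) by ring.
    rewrite ler_wpM2l ?mulr_ge0 ?exprn_ge0 ?addr_ge0 ?(ltW C10)//.
    apply: ler_pM; [|by rewrite invr_ge0 powR_ge0|exact: hY|exact: mq].
    by rewrite mulr_ge0// ltW.
  - move=> l n k hl lh.
    apply: le_trans (vpiece_error_le m_ge2 mu mu_haar p p_ge1 f f_Lp _ _ l n k) _.
    (* At the top level L or just below it, max(n, k) < M_L <= M_(l+1) <= B M_l. *)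
    have hB : (maxn n k < B * vpow m l)%N.
      apply: leq_trans (vlevel_gt m_ge2 (maxn n k)) _.
      apply: leq_trans (leq_vpow m_ge2 _ _ hl) _.
      by rewrite /= leq_mul2r m_le orbT.
    rewrite mulrA ler_wpM2r//.
    apply: le_trans (lerD (high n k l hB) (w1 l)) _.
    by rewrite -/(w l) mulrDl mul1r.
  - move=> e e0; have C0 : 0 < C2 + 1 by rewrite addr_gt0.
    have [l0 h] := wx (e / (C2 + 1)) (divr_gt0 e0 C0).
    by exists l0 => l /h; rewrite ler_pdivlMr// mulrC.
  - move=> e e0; have [l0 h] := wu (e / 2) (divr_gt0 e0 (ltr0n R 2)).
    exists l0 => l /h hl; rewrite mulrC -ler_pdivlMr//; apply: le_trans hl.
    by rewrite ler_peMl.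
  (* The added 1 keeps the divisor positive when Y = 0. *)
  - move=> e e0; have CY : 0 < (C1 + 1) * Y + 1.
      by rewrite ltr_wpDl// mulr_ge0// addr_ge0// ltW.
    have q01 : 0 < q < 1 by rewrite q0 q1.
    have [l0 h] := summable_tail q _ q01 (divr_gt0 e0 CY).
    exists l0 => N; rewrite -mulr_sumr.
    have := h N; rewrite ler_pdivlMr// => hN; apply: le_trans hN.
    rewrite [leLHS]mulrC ler_wpM2l ?lerDl//.
    by apply: sumr_ge0 => l _; rewrite mulr_ge0 ?exprn_ge0// ltW.
have near_oo e : 0 < e -> \forall nk \near (\oo, \oo),
    (vnorm mu p (fun z => cesaro_mean mu (- alpha) (- beta) nk.1 nk.2 f z - f z)%R <= e%:E)%E.
  move=> e0; have [N0 h] := main e e0.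
  exists ([set n | (N0 <= n)%N], [set n | (N0 <= n)%N]) => /=.
    by split; exact: nbhs_infty_ge.
  by move=> [n k] /= [hn hk]; exact: h.
have fin e nk : (vnorm mu p (fun z => cesaro_mean mu (- alpha) (- beta) nk.1 nk.2 f z - f z)%R <= e%:E)%E ->
    vnorm mu p (fun z => cesaro_mean mu (- alpha) (- beta) nk.1 nk.2 f z - f z) \is a fin_num.
  move=> h; rewrite ge0_fin_numE ?vnorm_ge0//; apply: le_lt_trans h _; exact: ltry.
(* Convergence to 0 in the extended reals is split into eventual finiteness and convergence of the
   real values. *)
apply/fine_cvgP; split.
  by apply: filterS (near_oo 1 ltr01) => nk; exact: fin.
apply/cvgrPdist_le => e e0; apply: filterS (near_oo e e0) => nk h /=.
rewrite sub0r normrN ger0_norm ?fine_ge0 ?vnorm_ge0//.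
by rewrite -lee_fin fineK// (fin e).
Qed.
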